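(* In the setting described in the context, assume that (i) there exists a symmetric positive-definite matrix $C\in\mathbb{R}^{N\times N}$ such that, almost surely, $$\mathbb{E}\left[\exp\left(\alpha^\top C^{-1/2}(E-\mathbb{E}[E\mid Y])\right)\,\middle|\,Y\right]\le \exp\left(\|\alpha\|_2^2/2\right)\quad\text{for all }\alpha\in\mathbb{R}^N;$$ (ii) there is $\mu=(\mu_1,\dots,\mu_N)\in\mathbb{R}^N$ such that $|(\mathbb{E}[E\mid Y])_i|\le\mu_i$ almost surely for $1\le i\le N$; (iii) $C_{YY}^{-1/2}Y$ is a $\rho$-sub-Gaussian random vector. Then, for all $t\ge 0$ such that $\sqrt n-c\rho^2(\sqrt M+\sqrt t)>0$ and all $s\ge 0$, we have $$\mathbb{E}_Y\left[\|\hat\Theta^\top Y-\Theta_*^\top Y\|_2^2\right]\le \varepsilon_{\mathrm{err}}+\varepsilon_{\mathrm{bias}}$$ with probability at least $1-3\exp(-t)-N\exp(-s)$, where $$\varepsilon_{\mathrm{err}}:=\frac{\operatorname{tr}(C)M+2\sqrt{M\operatorname{tr}(C^2)t}+2\|C\|_2t}{(\sqrt n-c\rho^2(\sqrt M+\sqrt t))^2},$$ $$\varepsilon_{\mathrm{bias}}:=\frac{(3/2)\rho^2\|\mu\|_2^2\,n\left(M+2\sqrt{Ms}+2s\right)}{(\sqrt n-c\rho^2(\sqrt M+\sqrt t))^4}\left(1+\frac{2\sqrt t\,\|C\|_2}{\sqrt{M\operatorname{tr}(C^2)}}\left(\frac{\sqrt n+c\rho^2(\sqrt M+\sqrt t)}{\sqrt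 n-c\rho^2(\sqrt M+\sqrt t)}\right)^2\right),$$ and $c>0$ is the absolute constant described in the context.
   Context: Setting. $X$ (values in $\mathbb{R}^N$) and $Z$ (values in $\mathbb{R}^M$) are independent, square integrable random vectors with mean zero and invertible covariance matrices $C_{XX}$, $C_{ZZ}$, whose laws have continuous densities with respect to Lebesgue measure. $A\in\mathbb{R}^{M\times N}$ is a fixed matrix, $Y:=AX+Z$, and $C_{YY}$ is the covariance matrix of $Y$. The matrix $\Theta_*\in\mathbb{R}^{M\times N}$ is defined by $\Theta_*^\top:=(A^\top C_{ZZ}^{-1}A+C_{XX}^{-1})^{-1}A^\top C_{ZZ}^{-1}$ (so $y\mapsto\Theta_*^\top y$ is the linear minimum mean squared error estimator of $X$ from $Y$), and $E:=X-\Theta_*^\top Y$ is the estimation error. $\{(X_i,Y_i)\}_{i=1}^n$ are $n$ independent samples of $(X,Y)$. The matrices $\boldsymbol{X}\in\mathbb{R}^{n\times N}$ and $\boldsymbol{Y}\in\mathbb{R}^{n\times M}$ have rows $X_i^\top$ and $Y_i^\top$. The least squares estimator is $y\mapsto\hat\Theta^\top y$, where $\hat\Theta$ minimizes $\frac1n\|\boldsymbol{Y}\Theta-\boldsymbol{X}\|_F^2$ over $\Theta\in\mathbb{R}^{M\times N}$; if $\boldsymbol{Y}$ is injective it is unique and $\hat\Theta=(\boldsymbol{Y}^\top\boldsymbol{Y})^{-1}\boldsymbol{Y}^\top\boldsymbol{X}$. $\mathbb{E}_Y$ denotes expectation over a fresh $Y$ independent of the samples, with the samples held fixed; the resulting quantity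 is a random variable depending on the samples, and ''with probability'' refers to the samples. $\|\cdot\|_2$ is the Euclidean norm for vectors and the spectral norm for matrices. A real random variable $V$ is sub-Gaussian with parameter $\sigma\ge0$ if $\mathbb{E}[e^{\lambda(V-\mathbb{E}V)}]\le e^{\sigma^2\lambda^2/2}$ for all $\lambda\in\mathbb{R}$. A random vector $V$ is $\sigma$-sub-Gaussian if $a^\top V$ is sub-Gaussian with parameter $\sigma$ for every unit vector $a$. The constant $c>0$ is an absolute constant with the following property (such a constant exists): for all $n,M$, every $\rho$, every random $n\times M$ matrix $W$ whose rows are independent $\rho$-sub-Gaussian isotropic (identity covariance) random vectors in $\mathbb{R}^M$, and every $t\ge0$, with probability at least $1-2e^{-t}$, $\sqrt n-c\rho^2(\sqrt M+\sqrt t)\le\sigma_{\min}(W)\le\sigma_{\max}(W)\le\sqrt n+c\rho^2(\sqrt M+\sqrt t)$, where $\sigma_{\min},\sigma_{\max}$ are the minimal and maximal singular values. *)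

(* Defs.v *)
From HB Require Import structures.
From mathcomp Require Import all_boot all_order all_algebra.
From mathcomp Require Import all_classical all_reals all_analysis.
From mathcomp Require Import measurable_realfun.

Set Implicit Arguments.
Unset Strict Implicit.
Unset Printing Implicit Defensive.

Import Order.TTheory GRing.Theory Num.Theory.
Import numFieldNormedType.Exports.

Local Open Scope classical_set_scope.
Local Open Scope ring_scope.

(* Generators of the Borel sigma-algebra on matrices: preimages of Borel sets of R
   under the entry maps. *)
Definition mx_entry_sets (R : realType) (m n : nat) : set (set 'M[R]_(m, n)) :=
  [set B | exists i j, exists2 C : set R,
     measurable C & B = [set M : 'M[R]_(m, n) | C (M i j)]].

Definition mx_display : measure_display -> measure_display.
Proof. exact. Qed.

Section measurable_matrix.
Context {R : realType} (m n : nat).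

Let mx_set0 : <<s @mx_entry_sets R m n >> set0.
Proof. exact: sigma_algebra0. Qed.

Let mx_setC A : <<s @mx_entry_sets R m n >> A ->
  <<s @mx_entry_sets R m n >> (~` A).
Proof. exact: sigma_algebraC. Qed.

Let mx_bigcup (F : (set 'M[R]_(m, n))^nat) :
  (forall i, <<s @mx_entry_sets R m n >> (F i)) ->
  <<s @mx_entry_sets R m n >> (\bigcup_i (F i)).
Proof. exact: sigma_algebra_bigcup. Qed.

HB.instance Definition _ := @isMeasurable.Build (mx_display default_measure_display)
  'M[R]_(m, n) <<s @mx_entry_sets R m n >> mx_set0 mx_setC mx_bigcup.

End measurable_matrix.

Definition norm2 (R : realType) (n : nat) (v : 'cV[R]_n) : R :=
  Num.sqrt (\sum_i v i 0 ^+ 2).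

Definition frobenius (R : realType) (m n : nat) (A : 'M[R]_(m, n)) : R :=
  Num.sqrt (\sum_i \sum_j A i j ^+ 2).

Definition possemidefmx (R : realType) (n : nat) (A : 'M[R]_n) : Prop :=
  A^T = A /\ forall v : 'cV[R]_n, 0 <= (v^T *m A *m v) 0 0.

Definition posdefmx (R : realType) (n : nat) (A : 'M[R]_n) : Prop :=
  A^T = A /\ forall v : 'cV[R]_n, v != 0 -> 0 < (v^T *m A *m v) 0 0.

(* The positive semidefinite square root; 0 if there is none, i.e. if A is not
   symmetric positive semidefinite. *)
Definition sqrtmx (R : realType) (n : nat) (A : 'M[R]_n) : 'M[R]_n :=
  xget 0 [set B | possemidefmx B /\ B *m B = A].

(* An m x n matrix has n singular values, the square roots of the eigenvalues of
   W^T W; in particular 0 is one of them when m < n. *)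
Definition singular_values (R : realType) (m n : nat) (W : 'M[R]_(m, n)) :
    set R :=
  [set s | 0 <= s /\ eigenvalue (W^T *m W) (s ^+ 2)].

Definition sigma_min (R : realType) (m n : nat) (W : 'M[R]_(m, n)) : R :=
  inf (singular_values W).

Definition sigma_max (R : realType) (m n : nat) (W : 'M[R]_(m, n)) : R :=
  sup (singular_values W).

Definition spectral_norm (R : realType) (m n : nat) (W : 'M[R]_(m, n)) : R :=
  sigma_max W.

Definition coord (T : Type) (R : realType) (n : nat) (X : T -> 'cV[R]_n)
    (i : 'I_n) : T -> R :=
  fun w => X w i 0.

Definition meanvec d (T : measurableType d) (R : realType)
    (P : probability T R) (n : nat) (X : T -> 'cV[R]_n) : 'cV[R]_n :=
  \col_i fine 'E_P[coord X i].

Definition covmx d (T : measurableType d) (R : realType)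
    (P : probability T R) (n : nat) (X : T -> 'cV[R]_n) : 'M[R]_n :=
  \matrix_(i, j) fine (covariance P (coord X i) (coord X j)).

Definition square_integrable d (T : measurableType d) (R : realType)
    (P : probability T R) (n : nat) (X : T -> 'cV[R]_n) : Prop :=
  forall i, coord X i \in Lfun P 2%:E.

Definition independent2 d (T : measurableType d) (R : realType)
    (P : probability T R) d1 (T1 : measurableType d1)
    d2 (T2 : measurableType d2) (X : T -> T1) (Y : T -> T2) : Prop :=
  forall (A : set T1) (B : set T2), measurable A -> measurable B ->
    P (X @^-1` A `&` Y @^-1` B) = (P (X @^-1` A) * P (Y @^-1` B))%E.

Definition mutually_independent d (T : measurableType d) (R : realType)
    (P : probability T R) (I : finType) d' (T' : measurableType d')
    (X : I -> T -> T') : Prop :=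
  forall (J : {set I}) (B : I -> set T'), (forall i, measurable (B i)) ->
    P (\bigcap_(i in [set` J]) X i @^-1` B i) =
    (\prod_(i in J) P (X i @^-1` B i))%E.

(* For a function f that is nonnegative and measurable, this is its Lebesgue
   integral over R^n, computed one coordinate at a time (Tonelli). *)
Fixpoint lebesgue_cV_integral (R : realType) (n : nat) :
    ('cV[R]_n -> \bar R) -> \bar R :=
  match n return ('cV[R]_n -> \bar R) -> \bar R with
  | 0%N => fun f => f 0
  | n'.+1 => fun f => (\int[@lebesgue_measure R]_x
      lebesgue_cV_integral
        (fun v : 'cV[R]_n' => f (col_mx (x%:M : 'cV[R]_1) v)))%E
  end.

Definition has_continuous_density d (T : measurableType d) (R : realType)
    (P : probability T R) (n : nat) (X : T -> 'cV[R]_n) : Prop :=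
  exists f : 'cV[R]_n -> R,
    [/\ continuous f, forall v, 0 <= f v &
      forall B : set 'cV[R]_n, measurable B ->
        P (X @^-1` B) = lebesgue_cV_integral (fun v => (\1_B v * f v)%:E)].

Definition subgaussian d (T : measurableType d) (R : realType)
    (P : probability T R) (sigma : R) (V : T -> R) : Prop :=
  0 <= sigma /\ forall l : R,
    ('E_P[fun w => expR (l * (V w - fine 'E_P[V]))]
       <= (expR (sigma ^+ 2 * l ^+ 2 / 2))%:E)%E.

Definition subgaussian_vec d (T : measurableType d) (R : realType)
    (P : probability T R) (sigma : R) (n : nat) (V : T -> 'cV[R]_n) : Prop :=
  forall a : 'cV[R]_n, norm2 a = 1 ->
    subgaussian P sigma (fun w => (a^T *m V w) 0 0).

(* "E holds with probability at least p" for an event E that need not be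
   measurable; for measurable E this is p <= P E. *)
Definition with_prob_at_least d (T : measurableType d) (R : realType)
    (P : probability T R) (p : R) (E : set T) : Prop :=
  exists A : set T, [/\ measurable A, A `<=` E & (p%:E <= P A)%E].

Definition sigma_algebra_of (T : Type) d' (T' : measurableType d')
    (Y : T -> T') : set (set T) :=
  preimage_set_system setT Y measurable.

(* V is a version of E[U | Y]. To be used for U integrable (then V is integrable,
   as its integral over T is finite) or U nonnegative (then V >= 0 a.s.). *)
Definition is_condexp d (T : measurableType d) (R : realType)
    (P : probability T R) d' (T' : measurableType d') (Y : T -> T')
    (U V : T -> \bar R) : Prop :=
  (forall B : set (\bar R), measurable B -> sigma_algebra_of Y (V @^-1` B)) /\
  (forall A : set T, sigma_algebra_of Y A ->
     (\int[P]_(w in A) V w = \int[P]_(w in A) U w)%E).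

Definition is_condexp_vec d (T : measurableType d) (R : realType)
    (P : probability T R) d' (T' : measurableType d') (Y : T -> T')
    (n : nat) (U V : T -> 'cV[R]_n) : Prop :=
  forall i, is_condexp P Y (EFin \o coord U i) (EFin \o coord V i).

(* The defining property of the absolute constant c. Centering is part of
   isotropy: subgaussianity does not see the mean, and for uncentered rows no c
   would satisfy these bounds. *)
Definition singular_value_constant (R : realType) (c : R) : Prop :=
  forall (n M : nat) (rho : R) d (S : measurableType d) (Q : probability S R)
    (W : S -> 'M[R]_(n, M)),
    (0 < M)%N ->
    let rows := fun (i : 'I_n) w => (row i (W w))^T in
    (forall i, measurable_fun setT (rows i)) ->
    mutually_independent Q rows ->
    (forall i, meanvec Q (rows i) = 0) ->
    (forall i, covmx Q (rows i) = 1%:M) ->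
    (forall i, subgaussian_vec Q rho (rows i)) ->
    forall t : R, 0 <= t ->
    let dev := c * rho ^+ 2 * (Num.sqrt M%:R + Num.sqrt t) in
    with_prob_at_least Q (1 - 2 * expR (- t))
      [set w | [/\ Num.sqrt n%:R - dev <= sigma_min (W w),
                   sigma_min (W w) <= sigma_max (W w) &
                   sigma_max (W w) <= Num.sqrt n%:R + dev]].

Definition Theta_star (R : realType) (N M : nat) (A : 'M[R]_(M, N))
    (CXX : 'M[R]_N) (CZZ : 'M[R]_M) : 'M[R]_(M, N) :=
  (invmx (A^T *m invmx CZZ *m A + invmx CXX) *m A^T *m invmx CZZ)^T.

Definition rows_mx (T : Type) (R : realType) (n k : nat)
    (V : 'I_n -> T -> 'cV[R]_k) (w : T) : 'M[R]_(n, k) :=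
  \matrix_(i, j) V i w j 0.

Definition least_squares (R : realType) (n N M : nat) (Y : 'M[R]_(n, M))
    (X : 'M[R]_(n, N)) (Theta : 'M[R]_(M, N)) : Prop :=
  forall Theta' : 'M[R]_(M, N),
    n%:R^-1 * frobenius (Y *m Theta - X) ^+ 2 <=
    n%:R^-1 * frobenius (Y *m Theta' - X) ^+ 2.

Definition eps_err (R : realType) (n N M : nat) (c rho t : R)
    (C : 'M[R]_N) : R :=
  let dev := c * rho ^+ 2 * (Num.sqrt M%:R + Num.sqrt t) in
  (\tr C * M%:R + 2 * Num.sqrt (M%:R * \tr (C *m C) * t)
     + 2 * spectral_norm C * t)
  / (Num.sqrt n%:R - dev) ^+ 2.

Definition eps_bias (R : realType) (n N M : nat) (c rho t s : R)
    (C : 'M[R]_N) (mu : 'cV[R]_N) : R :=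
  let dev := c * rho ^+ 2 * (Num.sqrt M%:R + Num.sqrt t) in
  (3 / 2) * rho ^+ 2 * norm2 mu ^+ 2 * n%:R
    * (M%:R + 2 * Num.sqrt (M%:R * s) + 2 * s)
  / (Num.sqrt n%:R - dev) ^+ 4
  * (1 + 2 * Num.sqrt t * spectral_norm C / Num.sqrt (M%:R * \tr (C *m C))
         * ((Num.sqrt n%:R + dev) / (Num.sqrt n%:R - dev)) ^+ 2).

(* Main.v *)
(* Write W for the matrix with rows C_YY^(-1/2) Y_i, and F, B for those with rows
   E_i - E[E_i | Y_i] and E[E_i | Y_i]. The normal equations give
   W^T W C_YY^(1/2) (Theta_hat - Theta_s) = W^T (F + B), so that the risk is the squared
   Frobenius norm of W^+ (F + B), where W^+ is the pseudo-inverse; the event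
   sigma_min(W) >= s0 bounds W^+.
   Conditionally on the Y_i, F is sub-Gaussian, and W^+ (F + B) is controlled by the
   tail bound for quadratic forms of sub-Gaussian vectors with mean (Hsu, Kakade and
   Zhang): an independent Gaussian z turns exp(eta |xi|^2) into the mean of
   exp(sqrt(2 eta) z.xi), to which the linear moment bound applies. Conditioning is
   replaced throughout by integration against functions of the Y_i.
   The mean W^+ B is bounded through W^T B, a sum of independent centered vectors:
   E[E | Y] is orthogonal to Y because Theta_s is the linear MMSE estimator, and
   e^y <= y + cosh (sqrt(3/2) y) turns this and |E[E | Y]_j| <= mu_j into a
   sub-Gaussian bound, whence the factor 3/2. *)

Require Import Defs.
From HB Require Import structures.
From mathcomp Require Import complex.
From mathcomp Require Import all_boot all_order all_algebra.
From mathcomp Require Import all_classical all_reals all_analysis.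
From mathcomp Require Import measurable_realfun.
From mathcomp Require Import ring lra.

Import Order.TTheory GRing.Theory Num.Theory.
Import numFieldNormedType.Exports.

Local Open Scope classical_set_scope.
Local Open Scope ring_scope.

Set Implicit Arguments.
Unset Strict Implicit.
Unset Printing Implicit Defensive.

(** Hypothesis (i) bounds exponentials of the noise in fixed directions, whereas the direction
    paired with the i-th sample is a column of a matrix built from W^+ and depends on all the
    responses Y_1, ..., Y_n. Two extensions bridge this gap without conditional laws. For one
    sample, a direction that is a function of Y is reached coordinate by coordinate through simple
    functions. For n samples, one sample at a time is redrawn while the others are frozen; every
    other factor then depends on the redrawn sample only through its response. What is derived from
    the responses must be a measurable function of them, including W^+ and E[E | Y]. The
    quadratic-form bound is applied with a diagonal majorant of the covariance of W^+ F: in the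
    eigenbasis of C the entry (l, j) gets the variance proxy lam_j / s0^2, because (W^T W)^-1 <= 1 /
    s0^2 on the event. Sums over the M N entries produce M tr C and M tr C^2. Of the failure
    probability, 2 e^-t comes from the singular values, e^-t from the noise and e^-s from each of
    the N columns of W^T B. *)

(** * Real symmetric matrices, square roots and singular values *)

Lemma dotmxv_eq0 (R : realDomainType) (n : nat) (v : 'cV[R]_n) :
  ((v^T *m v) 0 0 == 0) = (v == 0).
Proof.
apply/eqP/eqP => [|->]; last by rewrite mulmx0 mxE.
rewrite mxE => /psumr_eq0P v0; apply/colP => i; apply/eqP; rewrite mxE.
rewrite -sqrf_eq0 expr2; have := v0 _ i isT; rewrite !mxE => -> // j _.
by rewrite mxE -expr2 sqr_ge0.
Qed.

Lemma dotmxv_ge0 (R : realDomainType) (n : nat) (v : 'cV[R]_n) :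
  0 <= (v^T *m v) 0 0.
Proof. by rewrite mxE sumr_ge0// => i _; rewrite mxE -expr2 sqr_ge0. Qed.

(** Over the complex numbers the matrix is Hermitian, so the diagonal of its spectral form is real;
    an entry of it is a root of the characteristic polynomial, whose coefficients lie in [R]. *)
Lemma sym_real_eigenvalue (R : realType) (n : nat) (A : 'M[R]_n.+1) :
  A^T = A -> exists a : R, eigenvalue A a.
Proof.
move=> As; pose K : numClosedFieldType := complex.complex R.
pose toC : {rmorphism R -> K} := complex.real_complex R.
pose B : 'M[K]_n.+1 := map_mx toC A.
have Breal : B \is a mxOver Num.real.
  by apply/mxOverP => i j; rewrite mxE; apply/complex.complex_realP; exists (A i j).
have Bs : B \is symmetricmx.
  by apply/is_hermitianmxP; rewrite expr0 scale1r map_mx_id// /B map_trmx As.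
have Bherm := realsym_hermsym Bs Breal.
have /orthomx_spectralP Beq := hermitian_normalmx Bherm.
have /mxOverP/(_ 0 0)/complex.complex_realP[a /= aE] := hermitian_spectral_diag_real Bherm.
exists a; rewrite eigenvalue_root_char -(fmorph_root toC) map_char_poly.
rewrite -eigenvalue_root_char; apply/eigenvalueP.
exists (row 0 (spectralmx B)).
  rewrite -row_mul -/B {2}Beq !mulmxA mulmxV ?spectral_unit// mul1mx.
  by apply/rowP => j; rewrite mxE mul_diag_mx !mxE aE.
apply/eqP => r0; have := spectral_unit B; rewrite -row_free_unit => /row_free_inj.
move=> /(_ 1 (delta_mx 0 0) 0); rewrite -rowE r0 mul0mx => /(_ erefl)/matrixP/(_ 0 0).
by rewrite !mxE !eqxx => /eqP; rewrite oner_eq0.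
Qed.

(* [H] is the Householder reflection exchanging [e] and [v]. *)
Lemma orthogonal_to_vector (R : realFieldType) (n : nat) (e v : 'cV[R]_n) :
  e^T *m e = 1%:M -> v^T *m v = 1%:M ->
  exists H : 'M[R]_n, H^T *m H = 1%:M /\ H *m e = v.
Proof.
move=> ee vv; have [->|ve] := eqVneq v e.
  by exists 1%:M; rewrite trmx1 !mul1mx.
pose w : 'cV[R]_n := v - e; pose q := (w^T *m w) 0 0.
have q0 : q != 0 by rewrite dotmxv_eq0 subr_eq0.
have wwE : w^T *m w = q%:M by apply/matrixP => i j; rewrite !ord1 [RHS]mxE.
have weE : w^T *m e = (- (q / 2))%:M.
  have ev : e^T *m v = v^T *m e.
    by rewrite -[LHS]trmxK trmx_mul trmxK [_ *m _]mx11_scalar tr_scalar_mx.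
  have wT : w^T = v^T - e^T by apply/matrixP => i j; rewrite !mxE.
  have xE : w^T *m w = 2 *: (1%:M - v^T *m e).
    rewrite wT /w mulmxBl !mulmxBr ee vv ev scaler_nat mulr2n.
    by rewrite opprB.
  have -> : w^T *m e = - 2^-1 *: (w^T *m w).
    by rewrite xE scalerA mulNr mulVf// scaleN1r opprB wT mulmxBl ee.
  by rewrite wwE scale_scalar_mx mulNr mulrC.
pose H := 1%:M - (2 / q) *: (w *m w^T).
have HT : H^T = H by rewrite /H linearB linearZ/= trmx1 trmx_mul trmxK.
exists H; split.
  rewrite HT {1}/H mulmxBl mul1mx -scalemxAl -mulmxA.
  have -> : w^T *m H = - w^T.
    rewrite /H mulmxBr mulmx1 -scalemxAr mulmxA wwE mul_scalar_mx scalerA.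
    by rewrite -mulrA mulVf// mulr1 scaler_nat mulr2n opprD addrA subrr add0r.
  by rewrite mulmxN scalerN opprK /H subrK.
rewrite /H mulmxBl mul1mx -scalemxAl -mulmxA weE mul_mx_scalar scalerA.
have -> : 2 / q * - (q / 2) = -1 by field.
by rewrite scaleN1r opprK /w addrC subrK.
Qed.

(** Deflation: an orthogonal [H] that sends the first basis vector to a unit eigenvector makes the
    first column of H^T A H a multiple of that basis vector and, by symmetry, the first row too. The
    induction hypothesis treats the remaining block. *)
Lemma spectral_sym (R : realType) (n : nat) (A : 'M[R]_n) : A^T = A ->
  exists (U : 'M[R]_n) (d : 'rV[R]_n),
    U^T *m U = 1%:M /\ A = U *m diag_mx d *m U^T.
Proof.
elim: n A => [|n IH] A As; first by exists 0, 0; split; apply/matrixP => -[].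
have [a /eigenvalueP[v0 v0A v0n]] := sym_real_eigenvalue As.
pose c := Num.sqrt ((v0 *m v0^T) 0 0).
have c2 : c ^+ 2 = (v0 *m v0^T) 0 0.
  by rewrite sqr_sqrtr// -{1}[v0]trmxK dotmxv_ge0.
have cn0 : c != 0.
  by rewrite -sqrf_eq0 c2 -{1}[v0]trmxK dotmxv_eq0 trmx_eq0.
pose v : 'cV[R]_n.+1 := c^-1 *: v0^T.
have Av : A *m v = a *: v.
  rewrite /v -scalemxAr scalerA mulrC -scalerA; congr (_ *: _).
  by rewrite -[LHS]trmxK trmx_mul trmxK As v0A linearZ.
have vv : v^T *m v = 1%:M.
  have -> : v^T = c^-1 *: v0 by apply/matrixP => i j; rewrite !mxE.
  rewrite /v -scalemxAl -scalemxAr scalerA -invfM -expr2 c2.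
  apply/matrixP => i j; rewrite !ord1 mxE mulVf ?mxE//.
  by have := cn0; rewrite -sqrf_eq0 c2 !mxE.
have [H [HH Hv]] : exists H : 'M[R]_n.+1, H^T *m H = 1%:M /\ H *m delta_mx 0 0 = v.
  by apply: orthogonal_to_vector vv; rewrite trmx_delta mul_delta_mx;
    apply/matrixP => i j; rewrite !ord1 !mxE.
have HT : H *m H^T = 1%:M by exact: mulmx1C.
have Hv' : H^T *m v = delta_mx 0 0 by rewrite -Hv mulmxA HH mul1mx.
pose B : 'M[R]_(1 + n) := H^T *m A *m H.
have Bs : B^T = B by rewrite /B !trmx_mul trmxK As mulmxA.
have Be : B *m (delta_mx 0 0 : 'cV_n.+1) = a *: delta_mx 0 0.
  have : (H^T *m A *m H) *m delta_mx 0 0 = a *: (delta_mx 0 0 : 'cV_n.+1).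
    by rewrite -mulmxA Hv -mulmxA Av -scalemxAr Hv'.
  exact.
have AB : A = H *m (B : 'M[R]_n.+1) *m H^T by rewrite /B !mulmxA HT mul1mx -mulmxA HT mulmx1.
clearbody B.
have Bdl : dlsubmx B = 0.
  apply/matrixP => i j; have /matrixP/(_ (rshift 1 i) 0) := Be.
  by rewrite -colE !mxE !ord1 /= mulr0 => <-; congr (B _ _); apply/val_inj.
have Bul : ulsubmx B = a%:M.
  apply/matrixP => i j; have /matrixP/(_ 0 0) := Be.
  rewrite -colE !mxE !ord1 !eqxx mulr1 mulr1n=> <-.
  by congr (B _ _); apply/val_inj.
have Bur : ursubmx B = 0 by rewrite -[LHS]trmxK trmx_ursub Bs Bdl trmx0.
have Ds : (drsubmx B)^T = drsubmx B by rewrite trmx_drsub Bs.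
have [V [d [VV Bd]]] := IH _ Ds.
pose W : 'M[R]_(1 + n) := block_mx 1%:M 0 0 V.
pose D : 'rV[R]_(1 + n) := row_mx a%:M d.
have WW : W^T *m W = 1%:M.
  rewrite /W tr_block_mx mulmx_block !trmx0 trmx1.
  by rewrite !(mulmx0,mul0mx,mul1mx,addr0,add0r) VV -scalar_mx_block.
have BW : B = W *m diag_mx D *m W^T.
  rewrite -[B]submxK Bdl Bul Bur Bd /W tr_block_mx diag_mx_row !trmx0 trmx1.
  rewrite !mulmx_block !(mulmx0,mul0mx,mul1mx,mulmx1,addr0,add0r).
  by congr (block_mx _ _ _ _); apply/matrixP => i j; rewrite !ord1 !mxE.
exists (H *m (W : 'M[R]_n.+1)), D; split.
  by rewrite trmx_mul -!mulmxA [H^T *m _]mulmxA HH mul1mx.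
rewrite AB [B in LHS]BW trmx_mul !mulmxA.
done.
Qed.

Definition dotv (R : pzRingType) (n : nat) (u v : 'cV[R]_n) : R := (u^T *m v) 0 0.

Definition sqn (R : pzRingType) (n : nat) (v : 'cV[R]_n) : R := \sum_i v i 0 ^+ 2.

Lemma dotvE (R : pzRingType) (n : nat) (u v : 'cV[R]_n) :
  dotv u v = \sum_i u i 0 * v i 0.
Proof. by rewrite /dotv mxE; apply: eq_bigr => i _; rewrite mxE. Qed.

Lemma sqnE (R : pzRingType) (n : nat) (v : 'cV[R]_n) : sqn v = dotv v v.
Proof. by rewrite dotvE; apply: eq_bigr => i _; rewrite expr2. Qed.

Lemma dotvC (R : comPzRingType) (n : nat) (u v : 'cV[R]_n) : dotv u v = dotv v u.
Proof. by rewrite !dotvE; apply: eq_bigr => i _; rewrite mulrC. Qed.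

Lemma dotvDl (R : pzRingType) (n : nat) (u v w : 'cV[R]_n) :
  dotv (u + v) w = dotv u w + dotv v w.
Proof. by rewrite !dotvE -big_split; apply: eq_bigr => i _; rewrite mxE mulrDl. Qed.

Lemma dotvDr (R : pzRingType) (n : nat) (u v w : 'cV[R]_n) :
  dotv w (u + v) = dotv w u + dotv w v.
Proof. by rewrite /dotv mulmxDr mxE. Qed.

Lemma dotvZl (R : comPzRingType) (n : nat) a (u v : 'cV[R]_n) :
  dotv (a *: u) v = a * dotv u v.
Proof.
by rewrite !dotvE mulr_sumr; apply: eq_bigr => i _; rewrite mxE mulrA.
Qed.

Lemma dotvZr (R : comPzRingType) (n : nat) a (u v : 'cV[R]_n) :
  dotv u (a *: v) = a * dotv u v.
Proof. by rewrite dotvC dotvZl dotvC. Qed.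

Lemma dotv_adj (R : comPzRingType) (m n : nat) (A : 'M[R]_(m, n)) u v :
  dotv u (A *m v) = dotv (A^T *m u) v.
Proof. by rewrite /dotv trmx_mul trmxK mulmxA. Qed.

Lemma sqn_ge0 (R : realDomainType) (n : nat) (v : 'cV[R]_n) : 0 <= sqn v.
Proof. by rewrite sumr_ge0// => i _; rewrite sqr_ge0. Qed.

Lemma sqn_eq0 (R : realDomainType) (n : nat) (v : 'cV[R]_n) :
  (sqn v == 0) = (v == 0).
Proof. by rewrite sqnE /dotv dotmxv_eq0. Qed.

Lemma norm2_sqr (R : realType) (n : nat) (v : 'cV[R]_n) : norm2 v ^+ 2 = sqn v.
Proof. by rewrite sqr_sqrtr// sqn_ge0. Qed.

Lemma sqnZ (R : comPzRingType) (n : nat) (a : R) (v : 'cV[R]_n) :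
  sqn (a *: v) = a ^+ 2 * sqn v.
Proof.
by rewrite /sqn mulr_sumr; apply: eq_bigr => i _; rewrite mxE exprMn_comm//; exact: mulrC.
Qed.

Lemma sqn_orth (R : comNzRingType) (n : nat) (U : 'M[R]_n) (v : 'cV[R]_n) :
  U^T *m U = 1%:M -> sqn (U^T *m v) = sqn v.
Proof.
by move=> /mulmx1C UU; rewrite !sqnE dotv_adj trmxK mulmxA UU mul1mx.
Qed.

Lemma dotv_diag (R : comPzRingType) (n : nat) (d : 'rV[R]_n) (v : 'cV[R]_n) :
  dotv v (diag_mx d *m v) = \sum_i d 0 i * v i 0 ^+ 2.
Proof.
rewrite dotvE; apply: eq_bigr => i _; rewrite mul_diag_mx !mxE expr2.
by rewrite mulrCA.
Qed.

Lemma dotv_spectral (R : comPzRingType) (n : nat) (U : 'M[R]_n) (d : 'rV[R]_n)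
    (v : 'cV[R]_n) :
  dotv v (U *m diag_mx d *m U^T *m v) = \sum_i d 0 i * (U^T *m v) i 0 ^+ 2.
Proof. by rewrite -!mulmxA dotv_adj dotv_diag. Qed.

Lemma eigenvalue_spectral (F : fieldType) (n : nat) (U : 'M[F]_n) (d : 'rV[F]_n) a :
  U^T *m U = 1%:M ->
  eigenvalue (U *m diag_mx d *m U^T) a <-> exists i, a = d 0 i.
Proof.
move=> UU; have UT := mulmx1C UU; split=> [/eigenvalueP[v vU v0]|[i ->]].
- have [i vi] : exists i, (v *m U) 0 i != 0.
    apply/existsP; rewrite -negb_forall; apply/negP => /forallP vU0.
    case/eqP: v0; rewrite -[v]mulmx1 -UT mulmxA.
    suff -> : v *m U = 0 by rewrite mul0mx.
    by apply/rowP => i; rewrite (eqP (vU0 i)) [RHS]mxE.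
  exists i; move: (congr1 (fun x => (x *m U) 0 i) vU).
  rewrite !mulmxA -(mulmxA _ U^T) UU mulmx1 mul_mx_diag -scalemxAl.
  by rewrite [LHS]mxE [RHS]mxE mulrC => /(mulIf vi).
- apply/eigenvalueP; exists (row i U^T).
    rewrite -row_mul !mulmxA UU mul1mx.
    by apply/rowP => j; rewrite mxE mul_diag_mx !mxE.
  apply/eqP => r0; have U0 j : U j i = 0.
    by have := congr1 (fun A : 'rV[F]_n => A 0 j) r0; rewrite !mxE.
  have := congr1 (fun A : 'M[F]_n => A i i) UU; rewrite mxE big1 => [|j _].
    by rewrite mxE eqxx => /esym/eqP; rewrite oner_eq0.
  by rewrite U0 mulr0.
Qed.

Lemma possemidef_spectral (R : realType) (n : nat) (A : 'M[R]_n) :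
  possemidefmx A -> exists (U : 'M[R]_n) (d : 'rV[R]_n),
    [/\ U^T *m U = 1%:M, A = U *m diag_mx d *m U^T & forall i, 0 <= d 0 i].
Proof.
move=> [As Age0]; have [U [d [UU Ae]]] := spectral_sym As.
exists U, d; split => // i; have := Age0 (U *m delta_mx i 0).
rewrite -mulmxA -/(dotv _ _) {1}Ae dotv_spectral mulmxA UU mul1mx.
rewrite (bigD1 i)//= big1 ?addr0.
  by rewrite mxE !eqxx expr1n mulr1.
by move=> j /negPf ji; rewrite mxE ji expr0n mulr0.
Qed.

Lemma posdef_possemidef (R : realType) (n : nat) (A : 'M[R]_n) :
  posdefmx A -> possemidefmx A.
Proof.
move=> [As Ap]; split => // v; have [->|/Ap/ltW//] := eqVneq v 0.
by rewrite mulmx0 mxE.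
Qed.

Lemma posdef_unit (R : realType) (n : nat) (A : 'M[R]_n) :
  posdefmx A -> A \in unitmx.
Proof.
move=> [As Ap]; rewrite -row_free_unit -kermx_eq0; apply/eqP/row_matrixP => i.
rewrite row0; apply/eqP/negPn/negP => r0.
have := Ap (row i (kermx A))^T; rewrite trmx_eq0 => /(_ r0).
by rewrite trmxK -row_mul mulmx_ker row0 mul0mx mxE ltxx.
Qed.

(** A semidefinite form vanishes only on the kernel of its matrix: each term d_i x_i^2 of the
    diagonal form is zero, hence each d_i x_i. *)
Lemma possemidef_unit_posdef (R : realType) (n : nat) (A : 'M[R]_n) :
  possemidefmx A -> A \in unitmx -> posdefmx A.
Proof.
move=> Apsd Au; split; first by case: Apsd.
move=> v v0; rewrite lt_neqAle (Apsd.2 v) andbT eq_sym; apply/eqP.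
have [U [d [UU Ae dge0]]] := possemidef_spectral Apsd.
rewrite -mulmxA -/(dotv _ _) {1}Ae dotv_spectral => /psumr_eq0P H0.
case/eqP: v0; rewrite -[v]mul1mx -(mulVmx Au) -mulmxA.
suff -> : A *m v = 0 by rewrite mulmx0.
rewrite Ae -!mulmxA.
suff -> : diag_mx d *m (U^T *m v) = 0 by rewrite mulmx0.
apply/colP => i; rewrite mul_diag_mx [LHS]mxE [RHS]mxE; apply/eqP.
have /eqP := H0 (fun i _ => mulr_ge0 (dge0 i) (sqr_ge0 _)) i isT.
by rewrite !mulf_eq0 orbb.
Qed.

(** [xget] selects some root, so it suffices to exhibit one: the square roots of the eigenvalues in
    the eigenbasis. *)
Lemma sqrtmxP (R : realType) (n : nat) (A : 'M[R]_n) :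
  possemidefmx A -> possemidefmx (sqrtmx A) /\ sqrtmx A *m sqrtmx A = A.
Proof.
move=> /possemidef_spectral[U [d [UU Ae dge0]]].
rewrite /sqrtmx; apply: (@xgetPex _ 0 [set B | possemidefmx B /\ B *m B = A]).
pose D := diag_mx (\row_i Num.sqrt (d 0 i)).
exists (U *m D *m U^T); split; first split.
- by rewrite !trmx_mul trmxK tr_diag_mx mulmxA.
- move=> v; rewrite -mulmxA -/(dotv _ _) dotv_spectral sumr_ge0// => i _.
  by rewrite mulr_ge0 ?sqr_ge0// mxE sqrtr_ge0.
- rewrite Ae -!mulmxA (mulmxA U^T) UU mul1mx; congr (_ *m _).
  rewrite !mulmxA; congr (_ *m _); apply/matrixP => i j.
  rewrite mul_diag_mx !mxE; case: eqP => [->|_]; rewrite ?mulr0//.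
  by rewrite !mulr1n -expr2 sqr_sqrtr.
Qed.

(** In an eigenbasis of W^T W the claim is coordinatewise, since the square root of each eigenvalue
    is a singular value and hence at least the infimum. *)
Lemma sigma_min_le (R : realType) (m n : nat) (W : 'M[R]_(m, n)) (s : R) :
  0 <= s -> s <= sigma_min W -> forall v, s ^+ 2 * sqn v <= sqn (W *m v).
Proof.
move=> s0 sW v.
have psd : possemidefmx (W^T *m W).
  split; first by rewrite trmx_mul trmxK.
  by move=> u; rewrite mulmxA -trmx_mul -mulmxA dotmxv_ge0.
have [U [d [UU We dge0]]] := possemidef_spectral psd.
have -> : sqn (W *m v) = dotv v (W^T *m W *m v).
  by rewrite -mulmxA dotv_adj trmxK sqnE.
rewrite We dotv_spectral -(sqn_orth v UU) mulr_sumr ler_sum// => i _.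
rewrite ler_wpM2r ?sqr_ge0// -[leRHS]sqr_sqrtr// lerXn2r ?nnegrE ?sqrtr_ge0//.
apply: (le_trans sW); apply: ge_inf; first by exists 0 => x -[].
split; first exact: sqrtr_ge0.
by rewrite sqr_sqrtr// We; apply/eigenvalue_spectral => //; exists i.
Qed.

Lemma spectral_norm_ge (R : realType) (n : nat) (U : 'M[R]_n) (d : 'rV[R]_n) i :
  U^T *m U = 1%:M -> (forall i, 0 <= d 0 i) ->
  d 0 i <= spectral_norm (U *m diag_mx d *m U^T).
Proof.
move=> UU dge0; set C := _ *m _ *m _.
have CC : C^T *m C = U *m diag_mx (\row_j d 0 j ^+ 2) *m U^T.
  rewrite /C !trmx_mul trmxK tr_diag_mx -!mulmxA (mulmxA U^T) UU mul1mx.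
  congr (_ *m _); rewrite mulmxA; congr (_ *m _).
  apply/matrixP => a b; rewrite mul_diag_mx !mxE.
  by case: eqP => [->|_]; rewrite ?mulr0// !mulr1n expr2.
apply: ub_le_sup; last first.
  split; first exact: dge0.
  by rewrite CC; apply/eigenvalue_spectral => //; exists i; rewrite mxE.
(* [sup] bounds the elements only of a bounded set; the [d 0 j] being nonnegative, their sum bounds
   each of them. *)
exists (\sum_j d 0 j) => s [s0]; rewrite CC => /(eigenvalue_spectral _ _ UU)[j].
rewrite mxE => /eqP; rewrite eqrXn2// => /eqP ->.
by rewrite (bigD1 j)//= lerDl sumr_ge0.
Qed.

Section gram.
Context (R : realFieldType) (m n : nat) (W : 'M[R]_(m, n)) (k : R).
Hypothesis k_gt0 : 0 < k.
Hypothesis kW : forall v, k * sqn v <= sqn (W *m v).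

Lemma gram_unit : W^T *m W \in unitmx.
Proof.
rewrite -row_free_unit -kermx_eq0; apply/eqP/row_matrixP => i.
set r := row i _; apply/eqP; rewrite row0 -trmx_eq0 -sqn_eq0 eq_le sqn_ge0 andbT.
rewrite -(pmulr_rle0 _ k_gt0); apply: le_trans (kW _) _.
by rewrite sqnE /dotv trmx_mul trmxK !mulmxA -(mulmxA r) -row_mul mulmx_ker row0 mul0mx mxE.
Qed.

(** This is (W^T W)^-1 <= 1 / k, as a quadratic form and in norm, stated through solutions. Both
    parts follow from k |a|^2 <= |W a|^2 = a.u and 2 a.u <= k |a|^2 + |u|^2 / k. *)
Lemma gram_solution (a u : 'cV[R]_n) : W^T *m W *m a = u ->
  dotv a u <= k^-1 * sqn u /\ sqn a <= k^-1 ^+ 2 * sqn u.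
Proof.
move=> Wau; have E : dotv a u = sqn (W *m a).
  by rewrite -Wau -mulmxA dotv_adj trmxK sqnE.
have ka := kW a; rewrite -E in ka.
have le1 : 2 * dotv a u <= k * sqn a + k^-1 * sqn u.
  rewrite dotvE /sqn !mulr_sumr -big_split/= ler_sum// => i _.
  rewrite -subr_ge0.
  have -> : k * a i 0 ^+ 2 + k^-1 * u i 0 ^+ 2 - 2 * (a i 0 * u i 0) =
    k * (a i 0 - k^-1 * u i 0) ^+ 2 by field; rewrite gt_eqF.
  by rewrite mulr_ge0 ?sqr_ge0// ltW.
have le2 : dotv a u <= k^-1 * sqn u by lra.
split => //; rewrite expr2 -mulrA -(ler_pM2l k_gt0) mulVKf ?gt_eqF//.
exact: le_trans ka le2.
Qed.

End gram.

(** * Measurability of matrix-valued maps *)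

Lemma measurable_mxP (R : realType) d (T : measurableType d) (m n : nat)
    (f : T -> 'M[R]_(m, n)) :
  measurable_fun setT f <-> forall i j, measurable_fun setT (fun w => f w i j).
Proof.
split=> [mf i j _ B mB|mf].
  rewrite setTI; have := mf measurableT [set A : 'M[R]_(m, n) | B (A i j)].
  rewrite setTI; apply; apply: sub_sigma_algebra.
  by exists i, j, B.
apply: (@measurability _ _ _ _ setT f (@mx_entry_sets R m n)) => //.
move=> _ [_ [i [j [B mB ->]]] <-].
exact: mf.
Qed.

Lemma measurable_entry (R : realType) (m n : nat) i j :
  measurable_fun setT (fun A : 'M[R]_(m, n) => A i j).
Proof. by move: i j; apply/measurable_mxP; exact: measurable_id. Qed.

Section measurable_matrix_operations.
Context (R : realType) d (T : measurableType d).

Lemma measurable_mulmx (m n p : nat) (f : T -> 'M[R]_(m, n)) (g : T -> 'M[R]_(n, p)) :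
  measurable_fun setT f -> measurable_fun setT g ->
  measurable_fun setT (fun w => f w *m g w).
Proof.
move=> /measurable_mxP mf /measurable_mxP mg; apply/measurable_mxP => i j.
under eq_fun do rewrite mxE.
by apply: measurable_sum => k; apply: measurable_funM.
Qed.

Lemma measurable_trmx (m n : nat) (f : T -> 'M[R]_(m, n)) :
  measurable_fun setT f -> measurable_fun setT (fun w => (f w)^T).
Proof.
move=> /measurable_mxP mf; apply/measurable_mxP => i j.
under eq_fun do rewrite mxE.
exact: mf.
Qed.

Lemma measurable_addmx (m n : nat) (f g : T -> 'M[R]_(m, n)) :
  measurable_fun setT f -> measurable_fun setT g ->
  measurable_fun setT (fun w => f w + g w).
Proof.
move=> /measurable_mxP mf /measurable_mxP mg; apply/measurable_mxP => i j.
under eq_fun do rewrite mxE.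
exact: measurable_funD.
Qed.

Lemma measurable_scalemx (m n : nat) (a : T -> R) (f : T -> 'M[R]_(m, n)) :
  measurable_fun setT a ->
  measurable_fun setT f -> measurable_fun setT (fun w => a w *: f w).
Proof.
move=> ma /measurable_mxP mf; apply/measurable_mxP => i j.
under eq_fun do rewrite mxE.
exact: measurable_funM.
Qed.

Lemma measurable_prodr (I : Type) (s : seq I) (P : pred I) (f : I -> T -> R) :
  (forall i, P i -> measurable_fun setT (f i)) ->
  measurable_fun setT (fun w => \prod_(i <- s | P i) f i w).
Proof.
move=> mf; elim: s => [|a s IH]; first by under eq_fun do rewrite big_nil; exact: measurable_cst.
under eq_fun do rewrite big_cons.
by case: (boolP (P a)) => // Pa; apply: measurable_funM => //; exact: mf.
Qed.

Lemma measurable_det (n : nat) (f : T -> 'M[R]_n) :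
  measurable_fun setT f -> measurable_fun setT (fun w => \det (f w)).
Proof.
move=> /measurable_mxP mf; rewrite /determinant.
apply: measurable_sum => s; apply: measurable_funM => //.
by apply: measurable_prodr.
Qed.

Lemma measurable_adjugate (n : nat) (f : T -> 'M[R]_n) :
  measurable_fun setT f -> measurable_fun setT (fun w => \adj (f w)).
Proof.
move=> /measurable_mxP mf; apply/measurable_mxP => i j.
under eq_fun do rewrite mxE /cofactor.
apply: measurable_funM => //; apply: measurable_det.
apply/measurable_mxP => k l; under eq_fun do rewrite !mxE.
exact: mf.
Qed.

Lemma measurable_dotv (n : nat) (f g : T -> 'cV[R]_n) :
  measurable_fun setT f -> measurable_fun setT g ->
  measurable_fun setT (fun w => dotv (f w) (g w)).
Proof.
move=> mf mg; apply: (measurableT_comp (measurable_entry 0 0)).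
by apply: measurable_mulmx => //; exact: measurable_trmx.
Qed.

Lemma measurable_sqn (n : nat) (f : T -> 'cV[R]_n) :
  measurable_fun setT f -> measurable_fun setT (fun w => sqn (f w)).
Proof. by move=> mf; under eq_fun do rewrite sqnE; exact: measurable_dotv. Qed.

Lemma measurable_expR_comp (f : T -> R) :
  measurable_fun setT f -> measurable_fun setT (fun w => expR (f w)).
Proof. by move=> mf; apply: measurableT_comp. Qed.

End measurable_matrix_operations.

(** * Integrals weighted by a function of an observation *)

Section weighted_comparison.
Import HBNNSimple.
Local Open Scope ereal_scope.

Lemma integral_nnsfun_comp d (T : measurableType d) d' (T' : measurableType d')
    (R : realType) (mu : {measure set T -> \bar R}) (Y : T -> T')
    (h : {nnsfun T' >-> R}) (U : T -> \bar R) :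
  measurable_fun setT Y -> measurable_fun setT U -> (forall w, 0 <= U w) ->
  \int[mu]_w ((h (Y w))%:E * U w) =
  \sum_(y \in range h) y%:E * \int[mu]_(w in Y @^-1` (h @^-1` [set y])) U w.
Proof.
move=> mY mU U0.
have mh y : measurable (Y @^-1` (h @^-1` [set y])).
  by rewrite -[X in measurable X]setTI; apply: mY => //; exact: measurable_sfunP.
transitivity (\int[mu]_w (\sum_(y \in range h)
   y%:E * (U \_ (Y @^-1` (h @^-1` [set y]))) w)).
  apply: eq_integral => w _; rewrite fimfunE -fsumEFin//.
  rewrite ge0_mule_fsuml; last by move=> y; exact: nnfun_muleindic_ge0.
  apply: eq_fsbigr => y _; rewrite EFinM -muleA; congr (_ * _).
  by rewrite epatch_indic/= muleC.
have y0 y : range h y -> 0 <= y%:E by move=> [t _ <-]; rewrite lee_fin.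
rewrite ge0_integral_fsum//; last 2 first.
- move=> y; apply: emeasurable_funM => //; apply/(measurable_restrictT _ _).1 => //.
  exact: measurable_funTS.
- move=> y w _.
  have [[t _ <-]|ny] := pselect (range h y).
    rewrite mule_ge0 ?lee_fin//; apply: erestrict_ge0 => //.
  rewrite patchE; case: ifPn => [|_]; last by rewrite mule0.
  by rewrite inE => /= hy; exfalso; apply: ny; exists (Y w).
apply: eq_fsbigr => y; rewrite inE => ry.
rewrite ge0_integralZl//.
- by rewrite -integral_mkcond.
- apply/(measurable_restrictT _ _).1 => //; exact: measurable_funTS.
- by move=> w _; apply: erestrict_ge0.
- exact: y0.
Qed.

Local Close Scope ereal_scope.

(** An inequality between conditional expectations given the observation is expressed as one between
    integrals over its events. It extends to nonnegative weights by linearity for simple functions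
    and by monotone convergence. The two sides may live on different spaces, so the same lemma also
    transports integrals between equal laws. *)
Lemma ge0_le_integral_comp d1 (T1 : measurableType d1) d2 (T2 : measurableType d2)
    d' (T' : measurableType d') (R : realType)
    (mu1 : {measure set T1 -> \bar R}) (mu2 : {measure set T2 -> \bar R})
    (Y1 : T1 -> T') (Y2 : T2 -> T') (U1 : T1 -> R) (U2 : T2 -> R) (H : T' -> R) :
  measurable_fun setT Y1 -> measurable_fun setT Y2 ->
  measurable_fun setT U1 -> measurable_fun setT U2 ->
  (forall w, 0 <= U1 w) -> (forall w, 0 <= U2 w) ->
  measurable_fun setT H -> (forall y, 0 <= H y) ->
  (forall B, measurable B ->
    \int[mu1]_(w in Y1 @^-1` B) (U1 w)%:E <=
    \int[mu2]_(w in Y2 @^-1` B) (U2 w)%:E)%E ->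
  (\int[mu1]_w (H (Y1 w) * U1 w)%:E <= \int[mu2]_w (H (Y2 w) * U2 w)%:E)%E.
Proof.
move=> mY1 mY2 mU1 mU2 U10 U20 /measurable_EFinP mH H0 le12.
pose h := nnsfun_approx measurableT mH.
have lim d (T : measurableType d) (mu : {measure set T -> \bar R}) (Y : T -> T') (U : T -> R) :
    measurable_fun setT Y -> measurable_fun setT U -> (forall w, 0 <= U w) ->
    (fun k => \int[mu]_w ((h k (Y w))%:E * (U w)%:E))%E @ \oo -->
    (\int[mu]_w (H (Y w) * U w)%:E)%E.
  move=> mY mU U0.
  have -> : (\int[mu]_w (H (Y w) * U w)%:E =
             \int[mu]_w (limn (fun k => ((h k (Y w))%:E * (U w)%:E))))%E.
    apply: eq_integral => w _; apply/esym/cvg_lim => //.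
    rewrite EFinM; apply: cvgeM; first exact: mule_def_fin.
      apply: (cvg_nnsfun_approx measurableT mH) => //.
      by move=> y _; rewrite lee_fin.
    exact: cvg_cst.
  apply: cvg_monotone_convergence => //.
  - move=> k; apply: emeasurable_funM; apply/measurable_EFinP => //.
    exact: measurableT_comp.
  - by move=> k w _; rewrite mule_ge0// lee_fin.
  - move=> w _ a b ab; rewrite lee_wpmul2r// lee_fin//.
    exact/lefP/nd_nnsfun_approx.
have l1 := lim _ _ mu1 _ _ mY1 mU1 U10; have l2 := lim _ _ mu2 _ _ mY2 mU2 U20.
rewrite -(cvg_lim _ l1)// -(cvg_lim _ l2)//; apply: lee_lim.
- by apply/cvg_ex; eexists; exact: l1.
- by apply/cvg_ex; eexists; exact: l2.
apply: nearW => k; rewrite !integral_nnsfun_comp//; try exact/measurable_EFinP.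
apply: lee_fsum => // y [t _ <-]; rewrite lee_wpmul2l ?lee_fin//.
exact: le12.
Qed.

End weighted_comparison.

(** * Gaussian integrals and decoupling of squares *)

(** The weighted comparison, in both directions, with the identity as observation: the constant 1
    under [nu] is compared with [p] under [mu]. *)
Lemma ge0_integral_density d (T : measurableType d) (R : realType)
    (mu nu : {measure set T -> \bar R}) (p H : T -> R) :
  measurable_fun setT p -> (forall x, 0 <= p x) ->
  (forall B, measurable B -> nu B = (\int[mu]_(x in B) (p x)%:E)%E) ->
  measurable_fun setT H -> (forall x, 0 <= H x) ->
  (\int[nu]_x (H x)%:E = \int[mu]_x (H x * p x)%:E)%E.
Proof.
move=> mp p0 nuE mH H0.
transitivity (\int[nu]_x (H x * cst 1 x)%:E)%E.
  by apply: eq_integral => x _; rewrite mulr1.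
have nu1 (B : set T) : measurable B ->
    (\int[nu]_(x in id @^-1` B) (cst 1 x : R)%:E = \int[mu]_(x in id @^-1` B) (p x)%:E)%E.
  move=> mB; rewrite (_ : (fun _ => _) = cst 1%E)// integral_cst// mul1e.
  exact: nuE.
apply/eqP; rewrite eq_le; apply/andP; split.
  by apply: (ge0_le_integral_comp (Y1:=id) (Y2:=id)) => // B mB; rewrite nu1.
by apply: (ge0_le_integral_comp (Y1:=id) (Y2:=id)) => // B mB; rewrite nu1.
Qed.

Lemma integral_normal_prob (R : realType) (H : R -> R) :
  measurable_fun setT H -> (forall x, 0 <= H x) ->
  (\int[normal_prob 0 1]_x (H x)%:E =
   \int[lebesgue_measure]_x (H x * normal_pdf 0 1 x)%:E)%E.
Proof.
move=> mH H0.
apply: (@ge0_integral_density _ _ R lebesgue_measure (normal_prob 0 1)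
  (normal_pdf 0 1)) => //; first exact: measurable_normal_pdf.
exact: normal_pdf_ge0.
Qed.

(** Completing the square: the integrand times the standard density is a constant times the normal
    density of mean b / q and variance 1 / q, with q = 1 - 2 a. *)
Lemma normal_quadratic_mgf (R : realType) (a b : R) : a < 2^-1 ->
  (\int[normal_prob 0 1]_x (expR (a * x ^+ 2 + b * x))%:E =
   ((Num.sqrt (1 - 2 * a))^-1 * expR (b ^+ 2 / (2 * (1 - 2 * a))))%:E)%E.
Proof.
move=> a2; set q := 1 - 2 * a; have q0 : 0 < q by rewrite /q; lra.
have mexp : measurable_fun setT (fun x : R => expR (a * x ^+ 2 + b * x)).
  apply: measurable_expR_comp; apply: measurable_funD => //;
  apply: measurable_funM => //; exact: measurable_funX.
rewrite integral_normal_prob//.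
set K := (Num.sqrt q)^-1 * _; set sg := (Num.sqrt q)^-1.
have sq0 : 0 < Num.sqrt q by rewrite sqrtr_gt0.
have sg0 : sg != 0 by rewrite invr_eq0 gt_eqF.
transitivity (\int[lebesgue_measure]_x (K%:E * (normal_pdf (b / q) sg x)%:E))%E.
  apply: eq_integral => x _; rewrite -EFinM; congr (_%:E).
  rewrite !normal_pdfE ?oner_eq0// /K /normal_peak /normal_fun.
  have sgq : sg ^+ 2 = q^-1 by rewrite exprVn sqr_sqrtr// ltW.
  have -> : (Num.sqrt (sg ^+ 2 * pi *+ 2))^-1 = Num.sqrt q * (Num.sqrt (pi *+ 2))^-1.
    by rewrite sgq -mulrnAr sqrtrM ?invr_ge0 ?(ltW q0)// sqrtrV ?(ltW q0)// invfM invrK.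
  rewrite sgq expr1n mul1r.
  set r := (Num.sqrt (pi *+ 2))^-1; set e0 := expR (b ^+ 2 / _).
  rewrite -!mulrA (mulrCA e0) mulKf ?gt_eqF// mulrCA [RHS]mulrCA -!expRD.
  congr (_ * expR _).
  rewrite -[_ *+ 2]mulr_natr -[q^-1 *+ 2]mulr_natr subr0.
  have aq : a = (1 - q) / 2 by rewrite /q; field.
  by rewrite {1}aq; field; rewrite gt_eqF.
rewrite ge0_integralZl//.
- by rewrite integral_normal_pdf mule1.
- exact: measurable_int (integrable_normal_pdf (b / q) sg).
- by move=> x _; rewrite lee_fin normal_pdf_ge0.
- by rewrite lee_fin mulr_ge0 ?invr_ge0 ?sqrtr_ge0 ?expR_ge0.
Qed.

(** The hypothesis integrates the variable that the conclusion integrates last; Tonelli's theorem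
    exchanges the order. *)
Lemma ge0_le_iterated_integral d1 (T1 : measurableType d1) d2 (T2 : measurableType d2)
    (R : realType) (mu1 : {sigma_finite_measure set T1 -> \bar R})
    (mu2 : {sigma_finite_measure set T2 -> \bar R}) (A B : T1 -> T2 -> R) :
  measurable_fun setT (fun p : T1 * T2 => A p.1 p.2) ->
  measurable_fun setT (fun p : T1 * T2 => B p.1 p.2) ->
  (forall x y, 0 <= A x y) -> (forall x y, 0 <= B x y) ->
  (forall y, \int[mu1]_x (A x y)%:E <= \int[mu1]_x (B x y)%:E)%E ->
  (\int[mu1]_x \int[mu2]_y (A x y)%:E <= \int[mu1]_x \int[mu2]_y (B x y)%:E)%E.
Proof.
move=> /measurable_EFinP mA /measurable_EFinP mB A0 B0 leAB.
have A0' p : (0 <= (EFin \o (fun p => A p.1 p.2)) p)%E by rewrite lee_fin.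
have B0' p : (0 <= (EFin \o (fun p => B p.1 p.2)) p)%E by rewrite lee_fin.
have FA := fubini_tonelli (m1:=mu1) (m2:=mu2) _ mA A0'.
have FB := fubini_tonelli (m1:=mu1) (m2:=mu2) _ mB B0'.
rewrite [leRHS]FB [leLHS]FA; apply: ge0_le_integral => //.
- by move=> y _; apply: integral_ge0 => x _; exact: (A0' (x, y)).
- exact: (measurable_fun_fubini_tonelli_G (m1:=mu1) _ mA A0').
- exact: (measurable_fun_fubini_tonelli_G (m1:=mu1) _ mB B0').
- by move=> y _; exact: leAB.
Qed.

Lemma normal_quadratic_mgf_scaled (R : realType) (a b r k : R) :
  a < 2^-1 -> 0 <= k ->
  (\int[normal_prob 0 1]_x (k * expR (a * x ^+ 2 + b * x + r))%:E =
   (k * ((Num.sqrt (1 - 2 * a))^-1 * expR (b ^+ 2 / (2 * (1 - 2 * a)) + r)))%:E)%E.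
Proof.
move=> a2 k0.
transitivity (\int[normal_prob 0 1]_x
    ((k * expR r)%:E * (expR (a * x ^+ 2 + b * x))%:E))%E.
  by apply: eq_integral => x _; rewrite -EFinM expRD mulrAC mulrA.
rewrite ge0_integralZl//; last by rewrite lee_fin mulr_ge0// expR_ge0.
  by rewrite normal_quadratic_mgf// -EFinM expRD; congr (_%:E); ring.
apply/measurable_EFinP/measurable_expR_comp; apply: measurable_funD => //.
  by apply: measurable_funM => //; exact: measurable_funX.
Qed.

Section decoupling.
Context d (T : measurableType d) (R : realType) (P : probability T R) (I : finType).
Variables (xi m : I -> T -> R) (h : T -> R) (lam : I -> R) (eta : R).
Hypothesis mxi : forall i, measurable_fun setT (xi i).
Hypothesis mm : forall i, measurable_fun setT (m i).
Hypothesis mh : measurable_fun setT h.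
Hypothesis h_ge0 : forall w, 0 <= h w.
Hypothesis eta_ge0 : 0 <= eta.
Hypothesis eta_lam : forall i, eta * lam i < 2^-1.
Hypothesis sub : forall z : I -> R,
  (\int[P]_w (h w * expR (\sum_i (z i * xi i w - lam i * z i ^+ 2 / 2)))%:E <=
   \int[P]_w (h w * expR (\sum_i z i * m i w))%:E)%E.

(** For a standard Gaussian g, the mean of exp (eta lam g^2 + sqrt(2 eta) m g) is exp (kap + bias):
    [kap] is the logarithm of the normalization (1 - 2 eta lam)^(-1/2), and [bias] comes from the
    completed square. *)
Let kap i : R := - ln (1 - 2 * (eta * lam i)) / 2.
Let bias i w : R := eta * m i w ^+ 2 / (1 - 2 * (eta * lam i)).

(** Interpolation between the linear bound assumed ([S] empty) and the quadratic one wanted ([S]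
    full): the coordinates in [S] have been averaged over a Gaussian, the others still carry the
    parameter [z]. *)
Let F (S : {set I}) (z : I -> R) (w : T) : R := \sum_i
  (if i \in S then eta * xi i w ^+ 2 else z i * xi i w - lam i * z i ^+ 2 / 2).
Let G (S : {set I}) (z : I -> R) (w : T) : R := \sum_i
  (if i \in S then kap i + bias i w else z i * m i w).

Let q_gt0 i : 0 < 1 - 2 * (eta * lam i).
Proof. by have := eta_lam i; lra. Qed.

Let sqrt_kap i : (Num.sqrt (1 - 2 * (eta * lam i)))^-1 = expR (kap i).
Proof.
rewrite /kap mulNr expRN; congr (_^-1); apply/eqP.
rewrite -(@eqrXn2 _ 2)// ?sqrtr_ge0 ?expR_ge0// sqr_sqrtr ?(ltW (q_gt0 i))//.
by rewrite -expRM_natl [2 * (_ / 2)]mulrC divfK// lnK ?posrE ?q_gt0.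
Qed.

(** Converts one coordinate, so that only a one-dimensional Gaussian is averaged at a time; the
    exponents of the other coordinates are carried along as [r] and [r']. *)
Let decouple_step (j : I) (r r' : T -> R) :
  measurable_fun setT r -> measurable_fun setT r' ->
  (forall x : R,
    (\int[P]_w (h w * expR (Num.sqrt (2 * eta) * x * xi j w
        - lam j * (Num.sqrt (2 * eta) * x) ^+ 2 / 2 + r w))%:E <=
     \int[P]_w (h w * expR (Num.sqrt (2 * eta) * x * m j w + r' w))%:E)%E) ->
  (\int[P]_w (h w * expR (eta * xi j w ^+ 2 + r w))%:E <=
   \int[P]_w (h w * expR (kap j + bias j w + r' w))%:E)%E.
Proof.
move=> mr mr' le_x; set s := Num.sqrt (2 * eta) in le_x *.
have s2 : s ^+ 2 = 2 * eta by rewrite sqr_sqrtr// mulr_ge0.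
clearbody s.
pose N := [the probability (measurableTypeR R) R of normal_prob (0 : R) 1].
have m1 (u : T -> R) : measurable_fun setT u ->
   measurable_fun setT (fun p : T * measurableTypeR R => u p.1).
  by move=> mu; exact: (measurableT_comp mu measurable_fst).
have mx : measurable_fun setT (fun p : T * measurableTypeR R => p.2) by exact: measurable_snd.
pose A (w : T) (x : R) := h w * expR (s * x * xi j w + r w).
pose B (w : T) (x : R) := h w * expR (eta * lam j * x ^+ 2 + s * m j w * x + r' w).
have mA : measurable_fun setT (fun p : T * measurableTypeR R => A p.1 p.2).
  apply: measurable_funM; first exact: m1.
  apply: measurable_expR_comp; apply: measurable_funD; last exact: m1.
  apply: measurable_funM; last exact: m1.
  exact: measurable_funM.
have mB : measurable_fun setT (fun p : T * measurableTypeR R => B p.1 p.2).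
  apply: measurable_funM; first exact: m1.
  apply: measurable_expR_comp; apply: measurable_funD; last exact: m1.
  apply: measurable_funD.
    by apply: measurable_funM => //; exact: measurable_funX.
  apply: measurable_funM => //; apply: (m1 (fun w => s * m j w)).
  exact: measurable_funM.
have eqA w : (h w * expR (eta * xi j w ^+ 2 + r w))%:E = (\int[N]_x (A w x)%:E)%E.
  under eq_integral => x _.
    rewrite /A (_ : s * x * xi j w = 0 * x ^+ 2 + s * xi j w * x); last by ring.
    over.
  rewrite normal_quadratic_mgf_scaled// mulr0 subr0 sqrtr1 invr1 mul1r mulr1.
  by rewrite exprMn s2 (_ : 2 * eta * xi j w ^+ 2 / 2 = eta * xi j w ^+ 2)//; field.
have eqB w : (h w * expR (kap j + bias j w + r' w))%:E = (\int[N]_x (B w x)%:E)%E.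
  rewrite normal_quadratic_mgf_scaled// sqrt_kap -expRD addrA.
  have -> // : (s * m j w) ^+ 2 / (2 * (1 - 2 * (eta * lam j))) = bias j w.
  by rewrite /bias exprMn s2; field; rewrite gt_eqF// q_gt0.
under eq_integral do rewrite eqA.
under [leRHS]eq_integral do rewrite eqB.
apply: (ge0_le_iterated_integral (mu1:=P) (A:=A) (B:=B) N mA mB) => [w x|w x|x].
- by rewrite mulr_ge0// expR_ge0.
- by rewrite mulr_ge0// expR_ge0.
(* The penalty does not depend on [w]; moved to the right-hand side it is the term eta lam_j x^2 of
   [B], whose Gaussian integral converges as eta lam_j < 1/2. *)
have e0 : (0 <= (expR (lam j * (s * x) ^+ 2 / 2))%:E)%E by rewrite lee_fin expR_ge0.
have := le_x x.
have -> : (\int[P]_w (A w x)%:E = (expR (lam j * (s * x) ^+ 2 / 2))%:E *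
   \int[P]_w (h w * expR (s * x * xi j w - lam j * (s * x) ^+ 2 / 2 + r w))%:E)%E.
  rewrite -ge0_integralZl//.
  - apply: eq_integral => w _; rewrite -EFinM mulrCA -expRD.
    by rewrite /A; do 3 f_equal; ring.
  - by apply/measurable_EFinP; apply: measurable_funM => //; apply: measurable_expR_comp;
      apply: measurable_funD => //; apply: measurable_funB => //; exact: measurable_funM.
  - by move=> w _; rewrite lee_fin mulr_ge0// expR_ge0.
have -> : (\int[P]_w (B w x)%:E = (expR (lam j * (s * x) ^+ 2 / 2))%:E *
   \int[P]_w (h w * expR (s * x * m j w + r' w))%:E)%E.
  rewrite -ge0_integralZl//.
  - apply: eq_integral => w _; rewrite -EFinM mulrCA -expRD.
    by rewrite /B exprMn s2; do 3 f_equal; field.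
  - by apply/measurable_EFinP; apply: measurable_funM => //; apply: measurable_expR_comp;
      apply: measurable_funD => //; exact: measurable_funM.
  - by move=> w _; rewrite lee_fin mulr_ge0// expR_ge0.
by move=> le; rewrite lee_wpmul2l.
Qed.

Let mF S z : measurable_fun setT (F S z).
Proof.
apply: measurable_sum => i; case: (i \in S).
  by apply: measurable_funM => //; exact: measurable_funX.
by apply: measurable_funB => //; apply: measurable_funM.
Qed.

Let mbias i : measurable_fun setT (bias i).
Proof.
apply: measurable_funM => //; apply: measurable_funM => //.
exact: measurable_funX.
Qed.

Let mG S z : measurable_fun setT (G S z).
Proof.
apply: measurable_sum => i; case: (i \in S).
  exact: measurable_funD.
exact: measurable_funM.
Qed.

Let decouple_set (S : {set I}) (z : I -> R) :
  (\int[P]_w (h w * expR (F S z w))%:E <= \int[P]_w (h w * expR (G S z w))%:E)%E.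
Proof.
move: {2}#|S| (erefl #|S|) z => k; elim: k S => [|k IH] S Sk z.
  have S0 : S = finset.set0 by apply/eqP; rewrite -cards_eq0 Sk.
  have FE w : F S z w = \sum_i (z i * xi i w - lam i * z i ^+ 2 / 2).
    by apply: eq_bigr => i _; rewrite S0 inE.
  have GE w : G S z w = \sum_i z i * m i w.
    by apply: eq_bigr => i _; rewrite S0 inE.
  under eq_integral do rewrite FE.
  under [leRHS]eq_integral do rewrite GE.
  exact: sub.
have [j jS] : exists j, j \in S by apply/finset.set0Pn; rewrite -cards_eq0 Sk.
pose r w := \sum_(i | i != j)
  (if i \in S then eta * xi i w ^+ 2 else z i * xi i w - lam i * z i ^+ 2 / 2).
pose r' w := \sum_(i | i != j) (if i \in S then kap i + bias i w else z i * m i w).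
have FE w : F S z w = eta * xi j w ^+ 2 + r w by rewrite /F (bigD1 j)//= jS.
have GE w : G S z w = kap j + bias j w + r' w by rewrite /G (bigD1 j)//= jS.
under eq_integral do rewrite FE.
under [leRHS]eq_integral do rewrite GE.
apply: decouple_step.
- apply: (@eq_measurable_fun _ _ _ _ _ (fun w => F S z w - eta * xi j w ^+ 2)).
    by move=> w _; rewrite FE addrAC subrr add0r.
  apply: measurable_funB => //; apply: measurable_funM => //.
  exact: measurable_funX.
- apply: (@eq_measurable_fun _ _ _ _ _ (fun w => G S z w - (kap j + bias j w))).
    by move=> w _; rewrite GE addrAC subrr add0r.
  by apply: measurable_funB => //; apply: measurable_funD.
(* Coordinate [j] leaves [S] and receives the parameter sqrt(2 eta) x, which [decouple_step]
   averages over a standard Gaussian x. *)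
move=> x; pose z' i := if i == j then Num.sqrt (2 * eta) * x else z i.
have S'k : #|S :\ j| = k by apply/eqP; rewrite -eqSS -Sk (cardsD1 j S) jS.
have := IH _ S'k z'.
have F'E w : F (S :\ j) z' w = Num.sqrt (2 * eta) * x * xi j w
        - lam j * (Num.sqrt (2 * eta) * x) ^+ 2 / 2 + r w.
  rewrite /F (bigD1 j)//= /z' !inE eqxx/=; congr (_ + _).
  by apply: eq_bigr => i ij; rewrite !inE ij (negbTE ij).
have G'E w : G (S :\ j) z' w = Num.sqrt (2 * eta) * x * m j w + r' w.
  rewrite /G (bigD1 j)//= /z' !inE eqxx/=; congr (_ + _).
  by apply: eq_bigr => i ij; rewrite !inE ij (negbTE ij).
under eq_integral do rewrite F'E.
by under [X in (_ <= X)%E -> _]eq_integral do rewrite G'E.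
Qed.

Lemma gaussian_decoupling :
  (\int[P]_w (h w * expR (eta * \sum_i xi i w ^+ 2))%:E <=
   \int[P]_w (h w * expR (\sum_i (- ln (1 - 2 * (eta * lam i)) / 2 +
      eta * m i w ^+ 2 / (1 - 2 * (eta * lam i)))))%:E)%E.
Proof.
have := decouple_set finset.setT (fun _ => 0).
have FE w : F finset.setT (fun _ => 0) w = eta * \sum_i xi i w ^+ 2.
  by rewrite mulr_sumr; apply: eq_bigr => i _; rewrite inE.
under eq_integral do rewrite FE.
have GE w : G finset.setT (fun _ => 0) w = \sum_i (kap i + bias i w).
  by apply: eq_bigr => i _; rewrite inE.
by under [X in (_ <= X)%E -> _]eq_integral do rewrite GE.
Qed.

End decoupling.

(** * Tail bound for quadratic forms *)

Lemma expR_ge_taylor2 (R : realType) (y : R) : 0 <= y ->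
  1 + y + y ^+ 2 / 2 <= expR y.
Proof.
move=> y0; apply: (@le_trans _ _ (series (exp_coeff y) 3)).
  rewrite /series/= !big_nat_recr//= big_geq// /exp_coeff /= !expr0 !expr1 fact0 add0r.
  by rewrite !divr1.
apply: nondecreasing_cvgn_le; last exact: is_cvg_series_exp_coeff.
by apply: nondecreasing_series => k _ _; exact: exp_coeff_ge0.
Qed.

Lemma expRB_ge (R : realType) (y : R) : 0 <= y -> 2 * y <= expR y - expR (- y).
Proof.
move=> y0; have := expR_ge_taylor2 y0; set w := 1 + y + y ^+ 2 / 2 => wle.
have w1 : 1 <= w by rewrite /w -addrA lerDl addr_ge0// divr_ge0// sqr_ge0.
have w0 : 0 < w by exact: lt_le_trans ltr01 w1.
apply: (@le_trans _ _ (w - w^-1)); last first.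
  by rewrite lerB// expRN lef_pV2// posrE ?expR_gt0.
rewrite -(ler_pM2r w0) mulrBl mulVf ?gt_eqF//.
(* The difference of the two sides is w^2 - 1 - 2 y w = y^4 / 4. *)
have : 0 <= y ^+ 4 by rewrite exprn_even_ge0.
by rewrite /w; nra.
Qed.

(** With y = - ln (1 - u) the right-hand side is (e^y - e^-y) / 4, so the claim is 2 y <= e^y -
    e^-y. *)
Lemma neg_ln1B_le (R : realType) (u : R) : 0 <= u -> u < 1 ->
  - ln (1 - u) / 2 <= u / 2 + u ^+ 2 / (4 * (1 - u)).
Proof.
move=> u0 u1; have q0 : 0 < 1 - u by lra.
have y0 : 0 <= - ln (1 - u) by rewrite oppr_ge0 ln_le0//; lra.
have := expRB_ge y0; rewrite opprK expRN lnK ?posrE// => H.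
have -> : u / 2 + u ^+ 2 / (4 * (1 - u)) = ((1 - u)^-1 - (1 - u)) / 4.
  by field; rewrite gt_eqF.
lra.
Qed.

Lemma measurable_ltr_set d (T : measurableType d) (R : realType) (f g : T -> R) :
  measurable_fun setT f -> measurable_fun setT g -> measurable [set w | f w < g w].
Proof.
move=> mf mg; have /(_ measurableT [set true]) := measurable_fun_ltr mf mg.
by rewrite setTI; apply.
Qed.

Lemma integral_prob_cst d (T : measurableType d) (R : realType)
    (P : probability T R) (k : \bar R) : (\int[P]__ k = k)%E.
Proof. by rewrite [LHS](integral_cst P measurableT)/= probability_setT mule1. Qed.

Section quadratic_tail.
Context d (T : measurableType d) (R : realType) (P : probability T R) (I : finType).
Variables (xi m : I -> T -> R) (G : set T) (lam : I -> R) (L beta t : R).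
Hypothesis mxi : forall i, measurable_fun setT (xi i).
Hypothesis mm : forall i, measurable_fun setT (m i).
Hypothesis mG : measurable G.
Hypothesis lam_ge0 : forall i, 0 <= lam i.
Hypothesis lam_le : forall i, lam i <= L.
Hypothesis L_ge0 : 0 <= L.
Hypothesis t_ge0 : 0 <= t.
Hypothesis m_le : forall w, G w -> \sum_i m i w ^+ 2 <= beta.
Hypothesis sub : forall z : I -> R,
  (\int[P]_w (\1_G w * expR (\sum_i (z i * xi i w - lam i * z i ^+ 2 / 2)))%:E <=
   \int[P]_w (\1_G w * expR (\sum_i z i * m i w))%:E)%E.

Let v := \sum_i lam i ^+ 2.

(** The logarithm is bounded with u = 2 eta lam_i, and every denominator 1 - 2 eta lam_i is replaced
    by the smaller 1 - 2 eta L. *)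
Let moment_bound (eta : R) : 0 <= eta -> eta * L < 2^-1 ->
  (\int[P]_w (\1_G w * expR (eta * \sum_i xi i w ^+ 2))%:E <=
   (expR (eta * \sum_i lam i + (eta ^+ 2 * v + eta * beta) / (1 - 2 * (eta * L))))%:E)%E.
Proof.
move=> eta0 etaL.
have q0 : 0 < 1 - 2 * (eta * L) by lra.
have etalamL i : eta * lam i <= eta * L by rewrite ler_wpM2l.
have etalam i : eta * lam i < 2^-1 by exact: le_lt_trans etaL.
apply: le_trans (gaussian_decoupling mxi mm _ _ eta0 etalam sub) _ => //.
set K := eta * _ + _.
apply: (@le_trans _ _ (\int[P]_w (expR K)%:E)%E); last first.
  by rewrite integral_prob_cst.
apply: ge0_le_integral => //.
- apply/measurable_EFinP; apply: measurable_funM => //.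
  apply: measurable_expR_comp; apply: measurable_sum => i.
  apply: measurable_funD => //; apply: measurable_funM => //.
  by apply: measurable_funM => //; exact: measurable_funX.
move=> w _; rewrite lee_fin indicE.
have [/set_mem Gw|_] := boolP (w \in G); last by rewrite mul0r expR_ge0.
rewrite mul1r ler_expR.
apply: (@le_trans _ _ (\sum_i (eta * lam i + eta ^+ 2 * lam i ^+ 2 / (1 - 2 * (eta * L))
    + eta * m i w ^+ 2 / (1 - 2 * (eta * L))))).
  apply: ler_sum => i _; have el := etalam i.
  have ql : 0 < 1 - 2 * (eta * lam i) by lra.
  have qq : (1 - 2 * (eta * lam i))^-1 <= (1 - 2 * (eta * L))^-1.
    by rewrite lef_pV2 ?posrE//; have := etalamL i; lra.
  apply: lerD; last by rewrite ler_wpM2l// mulr_ge0// sqr_ge0.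
  have ge0 : 0 <= 2 * (eta * lam i) by rewrite !mulr_ge0.
  have lt1 : 2 * (eta * lam i) < 1 by lra.
  apply: le_trans (neg_ln1B_le ge0 lt1) _.
  apply: lerD; first by rewrite mulrC mulKf.
  rewrite -exprMn; set e := eta * lam i in ql qq *.
  rewrite (_ : (2 * e) ^+ 2 / (4 * (1 - 2 * e)) = e ^+ 2 / (1 - 2 * e)); last first.
    by field; rewrite gt_eqF.
  by rewrite ler_wpM2l// sqr_ge0.
rewrite !big_split/= -!mulr_suml -!mulr_sumr -/v -addrA -mulrDl.
apply: lerD => //; apply: ler_wpM2r; first by rewrite invr_ge0 ltW.
by apply: lerD => //; apply: ler_wpM2l => //; exact: m_le.
Qed.

Let r := Num.sqrt (t / v).

(** Chernoff's bound on the event [G], where the squared means sum to at most [beta]; the indicator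
    of [G] serves as the weight of the decoupling. *)
Lemma quadratic_tail : 0 < v ->
  (P (G `&` [set w | (\sum_i lam i + 2 * Num.sqrt (v * t) + 2 * L * t
        + beta * (1 + 2 * L * Num.sqrt (t / v)) < \sum_i xi i w ^+ 2)%R])
   <= (expR (- t))%:E)%E.
Proof.
move=> v0; rewrite -/r; set tau := _ + _ + _ + _.
have r0 : 0 <= r by exact: sqrtr_ge0.
have r2 : r ^+ 2 = t / v by rewrite sqr_sqrtr// divr_ge0// ltW.
have q0 : 0 < 1 + 2 * L * r by rewrite ltr_wpDr// mulr_ge0// mulr_ge0.
(* Chosen so that 1 - 2 eta L = 1 / (1 + 2 L r); as t = v r^2, the Chernoff exponent is then exactly
   -t. *)
pose eta := r / (1 + 2 * L * r).
have eta0 : 0 <= eta by rewrite divr_ge0// ltW.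
have qE : 1 - 2 * (eta * L) = (1 + 2 * L * r)^-1.
  by rewrite /eta; field; rewrite gt_eqF.
have etaL : eta * L < 2^-1.
  have : 0 < 1 - 2 * (eta * L) by rewrite qE invr_gt0.
  by move: (eta * L) => x; lra.
have mS : measurable_fun setT (fun w => \sum_i xi i w ^+ 2).
  by apply: measurable_sum => i; exact: measurable_funX.
have mB : measurable [set w | (tau < \sum_i xi i w ^+ 2)%R].
  exact: measurable_ltr_set.
set B := [set w | _] in mB *.
have mGB : measurable (G `&` B) by exact: measurableI.
rewrite -[X in P X]setIT -(integral_indic P measurableT mGB).
apply: (@le_trans _ _ (\int[P]_w ((expR (- (eta * tau)))%:E *
   (\1_G w * expR (eta * \sum_i xi i w ^+ 2))%:E))%E).
  apply: ge0_le_integral => //.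
  - exact/measurable_EFinP/measurable_indic.
  - apply/emeasurable_funM => //; apply/measurable_EFinP; apply: measurable_funM => //.
    by apply: measurable_expR_comp; apply: measurable_funM.
  move=> w _; rewrite -EFinM lee_fin indicI/= mulrCA ler_wpM2l ?indicE//.
  rewrite -expRD addrC -mulrBr.
  have [/set_mem Bw|_] := boolP (w \in B); last by rewrite expR_ge0.
  by rewrite -expR0 ler_expR mulr_ge0// subr_ge0 ltW.
rewrite ge0_integralZl//; last first.
  apply/measurable_EFinP; apply: measurable_funM => //.
  by apply: measurable_expR_comp; apply: measurable_funM.
apply: le_trans (lee_wpmul2l _ (moment_bound eta0 etaL)) _.
  by rewrite lee_fin expR_ge0.
rewrite -EFinM lee_fin -expRD ler_expR qE invrK.
have vtE : Num.sqrt (v * t) = v * r.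
  apply/eqP; rewrite -(@eqrXn2 _ 2)// ?sqrtr_ge0 ?mulr_ge0 ?(ltW v0)//.
  rewrite sqr_sqrtr ?mulr_ge0 ?(ltW v0)// exprMn r2.
  by apply/eqP; field; rewrite gt_eqF.
have tE : t = v * r ^+ 2 by rewrite r2; field; rewrite gt_eqF.
rewrite /tau vtE {1 2}tE /eta; move: (\sum_i lam i) q0 => s q0.
rewrite le_eqVlt; apply/orP; left; apply/eqP.
by field; rewrite gt_eqF.
Qed.

End quadratic_tail.

(** * The inequality e^y <= y + cosh (sqrt(3/2) y) *)

Section exp_cosh.
Variable R : realType.

Let ex (y : R) n : R := \sum_(k < n) y ^+ k / k`!%:R.
(** Partial sums of cosh (sqrt(3/2) y), with the root squared away. *)
Let ch (y : R) n : R := \sum_(k < n) (3 / 2) ^+ k * y ^+ k.*2 / (k.*2)`!%:R.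

(* Odd terms are absorbed by the neighbouring even ones through
   [2 y^(2k+1) <= (2k+1) y^(2k) + y^(2k+2) / (2k+1)]. *)
Let partial_sums (y : R) N : (0 < N)%N ->
  ex y N.*2.+1 - y + y ^+ N.*2 / (N.*2)`!%:R / 2 <= ch y N.+1.
Proof.
case: N => // N _; elim: N => [|N IH].
  (* The case N = 1 is an equality and fixes the constant: y^2 / 2, plus the half of it that is
     reserved to absorb y^3, makes (3/2) y^2 / 2. *)
  rewrite /ex /ch !big_ord_recr !big_ord0/= !fact0 !factS fact0 !expr0 !expr1.
  rewrite le_eqVlt; apply/orP; left; apply/eqP.
  by field.
set n := N.+1 in IH *; have n0 : (0 < n)%N by [].
clearbody n; have d2 : (n.*2)%:R = 2 * n%:R :> R by rewrite -mul2n natrM.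
have n1 : 1 <= n%:R :> R by rewrite ler1n.
rewrite /ch big_ord_recr/= -/(ch y n.+1) doubleS /ex 2!big_ord_recr/= -/(ex y n.*2.+1).
set F := (n.*2)`!%:R : R in IH *; set z := y ^+ n.*2 in IH *.
have F0 : 0 < F by rewrite ltr0n fact_gt0.
have z0 : 0 <= z by rewrite /z -mul2n exprM exprn_ge0// sqr_ge0.
have -> : y ^+ n.*2.+1 = z * y by rewrite exprSr.
have -> : y ^+ n.*2.+2 = z * y ^+ 2 by rewrite -addn2 exprD.
have -> : (n.*2.+2)`!%:R = (2 * n%:R + 2) * (2 * n%:R + 1) * F.
  by rewrite !factS !natrM mulrA -!natr1 d2 /F; ring.
have -> : (n.*2.+1)`!%:R = (2 * n%:R + 1) * F.
  by rewrite factS natrM -natr1 d2.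
(* The new even term of [ch] must cover 3/2 of that of the exponential, half of it again in reserve,
   together with its share of the odd term; (3/2)^(n+1) >= 9/4 is enough as n >= 1. *)
have key : n%:R + 1 + (3 / 2) * (2 * n%:R + 1) <= (3 / 2) ^+ n.+1 * (2 * n%:R + 1) :> R.
  have c94 : 9 / 4 <= (3 / 2 : R) ^+ n.+1.
    rewrite (_ : 9 / 4 = (3 / 2) ^+ 2); last by rewrite expr2; field.
    by rewrite ler_weXn2l//; lra.
  have : 9 / 4 * (2 * n%:R + 1) <= (3 / 2) ^+ n.+1 * (2 * n%:R + 1) :> R.
    by apply: ler_wpM2r => //; lra.
  lra.
clearbody F z.
set x : R := n%:R in n1 key *.
have odd_le : z * y / ((2 * x + 1) * F) <=
    z / F / 2 + z * y ^+ 2 / ((2 * x + 1) ^+ 2 * F) / 2.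
  rewrite -subr_ge0.
  have -> : z / F / 2 + z * y ^+ 2 / ((2 * x + 1) ^+ 2 * F) / 2 - z * y / ((2 * x + 1) * F)
     = z / F / 2 * (1 - y / (2 * x + 1)) ^+ 2.
    by field; rewrite gt_eqF//=; lra.
  by rewrite mulr_ge0 ?sqr_ge0// !divr_ge0// ltW.
have last_le : z * y ^+ 2 / ((2 * x + 1) ^+ 2 * F) / 2 + 3 / 2 *
      (z * y ^+ 2 / ((2 * x + 2) * (2 * x + 1) * F)) <=
    (3 / 2) ^+ n.+1 * (z * y ^+ 2) / ((2 * x + 2) * (2 * x + 1) * F).
  rewrite -subr_ge0; set c := (3 / 2) ^+ n.+1 in key *.
  have -> : c * (z * y ^+ 2) / ((2 * x + 2) * (2 * x + 1) * F) -
    (z * y ^+ 2 / ((2 * x + 1) ^+ 2 * F) / 2 + 3 / 2 *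
      (z * y ^+ 2 / ((2 * x + 2) * (2 * x + 1) * F))) =
    z * y ^+ 2 / F * ((2 * x + 2)^-1 / (2 * x + 1) ^+ 2) *
     (c * (2 * x + 1) - (x + 1 + (3 / 2) * (2 * x + 1))).
    by field; rewrite gt_eqF//= !gt_eqF//; lra.
  rewrite mulr_ge0// ?subr_ge0// mulr_ge0//.
    by apply: divr_ge0; [exact: mulr_ge0 z0 (sqr_ge0 _)|exact: ltW].
  by apply: divr_ge0; [rewrite invr_ge0; lra|exact: sqr_ge0].
move: IH odd_le last_le; set o := z * y / _; set e := z * y ^+ 2 / (_ * _ * F).
set c := (3 / 2) ^+ n.+1 * _ / _; set g := z / F / 2.
by set a1 := ex _ _; set a2 := ch _ _; set q := z * y ^+ 2 / _ / 2; lra.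
Qed.

(** The inequality between partial sums passes to the limit along the odd lengths 2 n + 1, the
    reserved half term being nonnegative. *)
Lemma expR_le_add_cosh (y : R) :
  expR y <= y + (expR (Num.sqrt (3 / 2) * y) + expR (- (Num.sqrt (3 / 2) * y))) / 2.
Proof.
set a := Num.sqrt (3 / 2); have a2 : a ^+ 2 = 3 / 2 by rewrite sqr_sqrtr//; lra.
clearbody a; have exE z n : series (exp_coeff z) n = ex z n.
  by rewrite /series/= big_mkord; apply: eq_bigr => k _; rewrite /exp_coeff.
(* Averaging over the two signs cancels the odd terms. *)
have chE n : (ex (a * y) n.*2 + ex (- (a * y)) n.*2) / 2 = ch y n.
  elim: n => [|n IH]; first by rewrite /ex /ch !big_ord0 addr0 mul0r.
  rewrite doubleS /ch big_ord_recr/= -/(ch y n) -IH.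
  have exS z : ex z n.*2.+2 = ex z n.*2 + z ^+ n.*2 / (n.*2)`!%:R + z ^+ n.*2.+1 / (n.*2.+1)`!%:R.
    by rewrite /ex !big_ord_recr.
  rewrite !exS.
  have -> : (- (a * y)) ^+ n.*2 = (a * y) ^+ n.*2.
    by rewrite -mul2n !exprM sqrrN.
  have -> : (- (a * y)) ^+ n.*2.+1 = - (a * y) ^+ n.*2.+1.
    by rewrite !exprSr mulrN -mul2n !exprM sqrrN.
  have -> : (3 / 2) ^+ n * y ^+ n.*2 = (a * y) ^+ n.*2.
    by rewrite [in RHS]exprMn -mul2n (exprM a) a2.
  rewrite mulNr; move: (ex _ _) (ex _ _) (_ / _) (_ / _) => p q e o.
  by field.
rewrite -lerBlDl.
have dbl : (fun n => n.*2) @ \oo --> \oo.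
  by move=> A [K _ KA]; exists K => // n /= Kn; apply: KA => /=;
    rewrite (leq_trans Kn)// -addnn leq_addr.
have cvX z : ex z @ \oo --> expR z.
  have -> : ex z = series (exp_coeff z) by apply/funext => n; rewrite exE.
  exact: is_cvg_series_exp_coeff.
have cvE z : (fun n => ex z n.*2) @ \oo --> expR z.
  exact: (cvg_comp (fun n => n.*2) (ex z) dbl (cvX z)).
have cvS (u : R^nat) (l : R) : u @ \oo --> l -> (fun n => u n.+1) @ \oo --> l.
  have succ : (fun n => n.+1) @ \oo --> \oo.
    by move=> A [K _ KA]; exists K => // n /= Kn; apply: KA => /=; rewrite (leq_trans Kn).
  exact: (cvg_comp (fun n => n.+1) u succ).
have cvA : (fun n => ex y n.*2.+1 - y) @ \oo --> expR y - y.
  apply: cvgB; last exact: cvg_cst.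
  exact: (cvg_comp (fun n => n.*2) (fun k => ex y k.+1) dbl (cvS _ _ (cvX y))).
have cvB : (fun n => (ex (a * y) n.+1.*2 + ex (- (a * y)) n.+1.*2) / 2) @ \oo -->
    (expR (a * y) + expR (- (a * y))) / 2.
  apply: cvgM; last exact: cvg_cst.
  by apply: cvgD; apply: (cvS (fun n => ex _ n.*2)); exact: cvE.
rewrite -(cvg_lim _ cvA)// -(cvg_lim _ cvB)//; apply: ler_lim.
- by apply/cvg_ex; eexists; exact: cvA.
- by apply/cvg_ex; eexists; exact: cvB.
exists 1%N => // n n1 /=; rewrite chE; apply: le_trans (partial_sums y n1).
rewrite lerDl divr_ge0// divr_ge0//.
by rewrite -mul2n exprM exprn_ge0// sqr_ge0.
Qed.

End exp_cosh.

(** * Functions of an observation and conditional sub-Gaussian bounds *)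

(* [g y] is the infimum of the rationals [q] such that [y] lies in a set whose
   preimage is [V < q]. *)
Lemma sigma_algebra_of_factor d (T : measurableType d) d' (T' : measurableType d')
    (R : realType) (Y : T -> T') (V : T -> R) :
  (forall B : set (\bar R), measurable B ->
     sigma_algebra_of Y ((EFin \o V) @^-1` B)) ->
  exists2 g : T' -> R, measurable_fun setT g & forall w, V w = g (Y w).
Proof.
move=> VY.
have /choice[B BP] (q : rat) : exists B : set T',
    measurable B /\ forall w, B (Y w) <-> V w < ratr q.
  have mq : measurable [set x : \bar R | (x < (ratr q)%:E)%E].
    rewrite (_ : [set _ | _] = `]-oo, (ratr q)%:E[%classic); first exact: emeasurable_itv.
    by apply/seteqP; split => x; rewrite /= in_itv.
  have [B mB] := VY _ mq; rewrite setTI => BE; exists B; split => // w.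
  have := congr1 (fun S => S w) BE; rewrite /= lte_fin => ->.
  by split.
(* [+oo] is neutral for the infimum: it is the value at indices that code no rational and at
   rationals q for which y is outside [B q]. *)
pose f (n : nat) (y : T') : \bar R :=
  if unpickle n is Some q then (if y \in B q then (ratr q)%:E else +oo%E) else +oo%E.
have mf n : measurable_fun setT (f n).
  rewrite /f; case: (unpickle n) => [q|]; last exact: measurable_cst.
  apply: measurable_fun_ifT => //.
  apply: (@measurable_fun_bool _ _ _ _ true); rewrite setTI.
  rewrite (_ : _ @^-1` _ = B q); first exact: (BP q).1.
  by apply/seteqP; split => y /=; [exact: set_mem|exact: mem_set].
pose g y := einfs (f^~ y) 0%N.
(* Off the range of [Y] the infimum may be infinite; [fine] gives it a real value there. *)
exists (fine \o g).
  apply: measurableT_comp; first exact: fine_measurable.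
  exact: measurable_fun_einfs.
move=> w; suff gE : g (Y w) = (V w)%:E by rewrite /= gE.
rewrite /g /einfs /sdrop; apply/eqP; rewrite eq_le; apply/andP; split.
- apply/lee_addgt0Pr => e e0.
  have [q] := @rat_in_itvoo R (V w) (V w + e) ltac:(by rewrite ltrDl).
  rewrite in_itv/= => /andP[Vq qe].
  apply: ereal_inf_le; exists (ratr q)%:E; last by rewrite lee_fin ltW.
  exists (pickle q) => //=; rewrite /f pickleK.
  by rewrite mem_set//; apply/(BP q).2.
- apply: le_ereal_inf_tmp => _ [n _ <-]; rewrite /f.
  case: (unpickle n) => [q|]; last by rewrite leey.
  case: ifPn => [/set_mem/(BP q).2 Vq|]; last by rewrite leey.
  by rewrite lee_fin ltW.
Qed.

Section conditional_subgaussian.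
Context d (T : measurableType d) d' (T' : measurableType d') (R : realType).
Variables (P : probability T R) (N : nat) (Y : T -> T') (F : T -> 'cV[R]_N).
Variable C : 'M[R]_N.
Hypothesis mY : measurable_fun setT Y.
Hypothesis mF : measurable_fun setT F.

Let phi (b : 'cV[R]_N) (w : T) : R := expR (dotv b (F w) - dotv b (C *m b) / 2).

Hypothesis sub : forall (b : 'cV[R]_N) (B : set T'), measurable B ->
  (\int[P]_(w in Y @^-1` B) (expR (dotv b (F w)))%:E <=
   \int[P]_(w in Y @^-1` B) (expR (dotv b (C *m b) / 2))%:E)%E.

Let mphi (b : T -> 'cV[R]_N) : measurable_fun setT b ->
  measurable_fun setT (fun w => phi (b w) w).
Proof.
move=> mb; apply: measurable_expR_comp; apply: measurable_funB.
  exact: measurable_dotv.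
apply: measurable_funM => //; apply: measurable_dotv => //.
by apply: measurable_mulmx => //; exact: measurable_cst.
Qed.

Let sub_const (b : 'cV[R]_N) (H : T' -> R) :
  measurable_fun setT H -> (forall y, 0 <= H y) ->
  (\int[P]_w (H (Y w) * phi b w)%:E <= \int[P]_w (H (Y w))%:E)%E.
Proof.
move=> mH H0; set k := expR (- (dotv b (C *m b) / 2)).
have mexp : measurable_fun setT (fun w => expR (dotv b (F w))).
  by apply: measurable_expR_comp; apply: measurable_dotv => //; exact: measurable_cst.
have le_k : (\int[P]_w (k * H (Y w) * expR (dotv b (F w)))%:E <=
    \int[P]_w (k * H (Y w) * expR (dotv b (C *m b) / 2))%:E)%E.
  apply: (ge0_le_integral_comp (H := fun y => k * H y) (Y1:=Y) (Y2:=Y)) => //.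
  - exact: measurable_funM.
  - by move=> y; rewrite mulr_ge0// expR_ge0.
  - by move=> B mB; exact: sub.
rewrite (eq_integral (fun w => (k * H (Y w) * expR (dotv b (F w)))%:E)); last first.
  by move=> w _; rewrite /phi expRD -/k; congr EFin; ring.
apply: le_trans le_k _; rewrite le_eqVlt; apply/orP; left; apply/eqP.
by apply: eq_integral => w _; rewrite mulrAC -expRD addNr expR0 mul1r.
Qed.

Let upd (j : 'I_N) (r : R) (b : 'cV[R]_N) : 'cV[R]_N :=
  \col_i (if i == j then r else b i 0).

Let mupd j (d1 : measure_display) (T1 : measurableType d1) (r : T1 -> R) (b : T1 -> 'cV[R]_N) :
  measurable_fun setT r -> measurable_fun setT b ->
  measurable_fun setT (fun y => upd j (r y) (b y)).
Proof.
move=> mr /measurable_mxP mb; apply/measurable_mxP => i k.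
under eq_fun do rewrite mxE.
by case: (i == j) => //; exact: mb.
Qed.

Import HBSimple.

(** Induction on the number [k] of leading coordinates of [b] that may vary. The last varying one is
    approximated by simple functions; on each level set it is constant, and the induction hypothesis
    applies with the indicator included in [H]. With no dominating function at hand, the limit is
    taken by Fatou's lemma. *)
Let sub_coord (k : nat) : forall (b : T' -> 'cV[R]_N) (H : T' -> R),
  (forall i : 'I_N, (k <= i)%N -> exists c, forall y, b y i 0 = c) ->
  measurable_fun setT b -> measurable_fun setT H -> (forall y, 0 <= H y) ->
  (\int[P]_w (H (Y w) * phi (b (Y w)) w)%:E <= \int[P]_w (H (Y w))%:E)%E.
Proof.
elim: k => [|k IH] b H bc mb mH H0.
  have /choice[c cE] : forall i : 'I_N, exists c, forall y, b y i 0 = c.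
    by move=> i; exact: bc.
  have bE y : b y = \col_i c i by apply/colP => i; rewrite cE mxE.
  under eq_integral do rewrite bE.
  exact: sub_const.
have [Nk|kN] := leqP N k.
  by apply: IH => // i ki; have := ltn_ord i; rewrite ltnNge (leq_trans Nk ki).
pose j : 'I_N := Ordinal kN.
have mbj : measurable_fun setT (EFin \o (fun y => b y j 0)).
  by apply/measurable_EFinP; move/measurable_mxP : mb; exact.
have [s sb] := approximation_sfun measurableT mbj.
have step (u : {sfun T' >-> R}) :
    (\int[P]_w (H (Y w) * phi (upd j (u (Y w)) (b (Y w))) w)%:E <=
     \int[P]_w (H (Y w))%:E)%E.
  have one (y : T') : \sum_(r \in range u) (\1_(u @^-1` [set r]) y : R) = 1.
    rewrite (fsbigD1 (u y))//.
    rewrite fsbig1; first by rewrite /= addr0 indicE mem_set.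
    by move=> r [_ /= ruy]; rewrite indicE memNset//= => /esym.
  have mi r : measurable_fun setT (fun w => \1_(u @^-1` [set r]) (Y w) : R).
    by apply: measurableT_comp => //; exact: measurable_indic.
  have split_range (f : T -> R) : (forall w, 0 <= f w) -> measurable_fun setT f ->
      (\int[P]_w (f w)%:E =
       \sum_(r \in range u) \int[P]_w (\1_(u @^-1` [set r]) (Y w) * f w)%:E)%E.
    move=> f0 mf; rewrite -ge0_integral_fsum//.
    - apply: eq_integral => w _; rewrite fsumEFin//; congr EFin.
      by rewrite -mulr_fsuml one mul1r.
    - by move=> r; apply/measurable_EFinP; exact: measurable_funM.
    - by move=> r w _; rewrite lee_fin mulr_ge0// indicE.
  have mHY : measurable_fun setT (fun w => H (Y w)) by exact: measurableT_comp.
  rewrite [leLHS]split_range; last 2 first.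
  - by move=> w; rewrite mulr_ge0// expR_ge0.
  - apply: measurable_funM => //; apply: mphi; apply: mupd.
      exact: measurableT_comp.
    exact: measurableT_comp.
  rewrite [leRHS]split_range//; apply: lee_fsum => // r _.
  have -> : (\int[P]_w (\1_(u @^-1` [set r]) (Y w) *
      (H (Y w) * phi (upd j (u (Y w)) (b (Y w))) w))%:E =
     \int[P]_w (\1_(u @^-1` [set r]) (Y w) * H (Y w) *
       phi (upd j r (b (Y w))) w)%:E)%E.
    apply: eq_integral => w _; rewrite mulrA indicE; congr EFin.
    by have [/set_mem/= ->//|_] := boolP (_ \in _); rewrite !mul0r.
  apply: (IH (fun y => upd j r (b y)) (fun y => \1_(u @^-1` [set r]) y * H y)) => //.
  - move=> i ki; have [->|ij] := eqVneq i j.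
      by exists r => y; rewrite mxE eqxx.
    have [|c cE] := bc i; first by rewrite ltn_neqAle ki andbT eq_sym.
    by exists c => y; rewrite mxE (negbTE ij).
  - by apply: mupd => //; exact: measurable_cst.
  - by apply: measurable_funM => //; exact: measurable_indic.
  - by move=> y; rewrite mulr_ge0// indicE.
have lim w : (fun n => (H (Y w) * phi (upd j (s n (Y w)) (b (Y w))) w)%:E) @ \oo -->
    (H (Y w) * phi (b (Y w)) w)%:E.
  apply: cvg_EFin; first exact: nearW.
  apply: cvgM; first exact: cvg_cst.
  have sY : (fun n => s n (Y w)) @ \oo --> b (Y w) j 0 by exact: fine_cvg (sb (Y w) I).
  pose q r := dotv (upd j r (b (Y w))) (F w)
    - dotv (upd j r (b (Y w))) (C *m upd j r (b (Y w))) / 2.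
  (* The exponent is a quadratic polynomial in the updated coordinate, hence continuous in it. *)
  have qlim : (fun n => q (s n (Y w))) @ \oo --> q (b (Y w) j 0).
    set b0 := upd j 0 (b (Y w)); set e : 'cV[R]_N := delta_mx j 0.
    have qE : q = fun r => (dotv b0 (F w) - dotv b0 (C *m b0) / 2) +
        (r * (dotv e (F w) - (dotv b0 (C *m e) + dotv e (C *m b0)) / 2) +
        r * r * (- (dotv e (C *m e) / 2))).
      apply/funext => r; rewrite /q.
      have -> : upd j r (b (Y w)) = b0 + r *: e.
        apply/colP => i; rewrite !mxE eqxx andbT.
        by case: eqP => _; rewrite ?(add0r, mulr0, addr0, mulr1).
      rewrite mulmxDr -scalemxAr !(dotvDl, dotvDr, dotvZl, dotvZr).
      by field.
    rewrite qE; apply: cvgD; first exact: cvg_cst.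
    by apply: cvgD; apply: cvgM; [|exact: cvg_cst|exact: cvgM|exact: cvg_cst].
  have bE : upd j (b (Y w) j 0) (b (Y w)) = b (Y w).
    by apply/colP => i; rewrite mxE; case: eqP => [->|].
  have -> : phi (b (Y w)) w = expR (q (b (Y w) j 0)) by rewrite /q bE.
  apply: (cvg_comp (fun n => q (s n (Y w))) expR qlim).
  exact: continuous_expR.
apply: (@le_trans _ _ (\int[P]_w limn_einf
    (fun n => (H (Y w) * phi (upd j (s n (Y w)) (b (Y w))) w)%:E))%E).
  rewrite le_eqVlt; apply/orP; left; apply/eqP; apply: eq_integral => w _.
  by have [-> _] := cvg_limn_einf_sup (lim w).
apply: le_trans (fatou P measurableT _ _) _.
- move=> n; apply/measurable_EFinP; apply: measurable_funM.
    exact: measurableT_comp.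
  by apply: mphi; apply: mupd; exact: measurableT_comp.
- by move=> n w _; rewrite lee_fin mulr_ge0// expR_ge0.
rewrite limn_einf_lim; apply: lime_le; first exact: is_cvg_einfs.
apply: nearW => n; apply: (le_trans _ (step (s n))).
by apply: ereal_inf_lbound; exists n => //=.
Qed.

(** All [N] coordinates of the direction may vary with the observation. The result stands in for a
    conditional law of [F] given [Y], under which the direction could be treated as fixed. *)
Lemma conditional_subgaussian (b : T' -> 'cV[R]_N) (H : T' -> R) :
  measurable_fun setT b -> measurable_fun setT H -> (forall y, 0 <= H y) ->
  (\int[P]_w (H (Y w) * expR (dotv (b (Y w)) (F w)
      - dotv (b (Y w)) (C *m b (Y w)) / 2))%:E <= \int[P]_w (H (Y w))%:E)%E.
Proof.
by apply: (@sub_coord N) => i; rewrite leqNgt ltn_ord.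
Qed.

End conditional_subgaussian.

(** * Equal laws, resampling and independent samples *)

Lemma ge0_eq_law_integral d1 (T1 : measurableType d1) d2 (T2 : measurableType d2)
    d' (T' : measurableType d') (R : realType)
    (mu1 : {measure set T1 -> \bar R}) (mu2 : {measure set T2 -> \bar R})
    (Y1 : T1 -> T') (Y2 : T2 -> T') (H : T' -> R) :
  measurable_fun setT Y1 -> measurable_fun setT Y2 ->
  (forall B, measurable B -> mu1 (Y1 @^-1` B) = mu2 (Y2 @^-1` B)) ->
  measurable_fun setT H -> (forall y, 0 <= H y) ->
  (\int[mu1]_w (H (Y1 w))%:E = \int[mu2]_w (H (Y2 w))%:E)%E.
Proof.
move=> mY1 mY2 law mH H0.
have cst1 d (T : measurableType d) (mu : {measure set T -> \bar R}) (Y : T -> T') B :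
    measurable_fun setT Y -> measurable B ->
    (\int[mu]_(w in Y @^-1` B) (1 : R)%:E = mu (Y @^-1` B))%E.
  move=> mY mB; rewrite [LHS]integral_cst ?mul1e//.
  by rewrite -[X in measurable X]setTI; exact: mY.
have E d (T : measurableType d) (mu : {measure set T -> \bar R}) (Y : T -> T') :
    (\int[mu]_w (H (Y w))%:E = \int[mu]_w (H (Y w) * 1)%:E)%E.
  by apply: eq_integral => w _; rewrite mulr1.
rewrite !E; apply/eqP; rewrite eq_le; apply/andP; split.
- by apply: ge0_le_integral_comp => // B mB; rewrite !cst1// law.
- by apply: ge0_le_integral_comp => // B mB; rewrite !cst1// law.
Qed.

Section resampling.
Context d (S : measurableType d) d' (V : measurableType d') (R : realType).
Variables (Q : probability S R) (n : nat) (U : 'I_n -> S -> V).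
Hypothesis mU : forall i, measurable_fun setT (U i).
Hypothesis indep : mutually_independent Q U.

Definition family_tuple (w : S) : n.-tuple V := [tuple U i w | i < n].

Definition replace_tnth (k : 'I_n) (u : V) (x : n.-tuple V) : n.-tuple V :=
  [tuple if i == k then u else tnth x i | i < n].

Lemma measurable_family_tuple : measurable_fun setT family_tuple.
Proof.
apply/measurable_fun_tnthP => i; rewrite (_ : _ \o _ = U i)//.
by apply/funext => w /=; rewrite tnth_mktuple.
Qed.

Lemma measurable_replace_tnth k d1 (T1 : measurableType d1) (u : T1 -> V)
    (x : T1 -> n.-tuple V) :
  measurable_fun setT u -> measurable_fun setT x ->
  measurable_fun setT (fun p => replace_tnth k (u p) (x p)).
Proof.
move=> mu mx; apply/measurable_fun_tnthP => i.
have [->|ik] := eqVneq i k.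
  by rewrite (_ : _ \o _ = u)//; apply/funext => w /=; rewrite tnth_mktuple eqxx.
rewrite (_ : _ \o _ = (fun t => tnth t i) \o x).
  by apply: measurableT_comp => //; exact: measurable_tnth.
by apply/funext => w /=; rewrite tnth_mktuple (negbTE ik).
Qed.

Let box (B : 'I_n -> set V) : set (n.-tuple V) := [set x | forall i, B i (tnth x i)].

Let boxes : set (set (n.-tuple V)) :=
  [set A | exists B : 'I_n -> set V, (forall i, measurable (B i)) /\ A = box B].

Let measurable_box B : (forall i, measurable (B i)) -> measurable (box B).
Proof.
move=> mB; rewrite (_ : box B = \bigcap_(i in [set: 'I_n]) ((fun x => tnth x i) @^-1` B i)).
  apply: fin_bigcap_measurable => // i _.
  by rewrite -[X in measurable X]setTI; exact: measurable_tnth.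
by apply/seteqP; split => x /= Bx i; [move=> _|]; exact: Bx.
Qed.

Let measurable_boxes : @measurable _ (n.-tuple V) = <<s boxes >>.
Proof.
apply/seteqP; split; last first.
  apply: smallest_sub; first exact: sigma_algebra_measurable.
  by move=> _ [B [mB ->]]; exact: measurable_box.
apply: smallest_sub; first exact: smallest_sigma_algebra.
move=> A; rewrite -bigcup_seq => -[i _ [B mB <-]]; apply: sub_sigma_algebra.
exists (fun j => if j == i then B else setT); split.
  by move=> j; case: ifP.
apply/seteqP; split => x /=.
  by move=> [_ Bx] j; case: eqP => [->|].
by move=> /(_ i); rewrite eqxx.
Qed.

Let mQ k : measurable_fun setT (fun p : S * S => replace_tnth k (U k p.2) (family_tuple p.1)).
Proof.
apply: measurable_replace_tnth; first exact: (measurableT_comp (mU k) measurable_snd).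
exact: (measurableT_comp measurable_family_tuple measurable_fst).
Qed.

(** Independence in the form used below: drawing the k-th entry afresh on a second copy of [S] does
    not change the law of the family. The two laws agree on boxes, a generating class stable under
    intersection. *)
Let law_replace k (A : set (n.-tuple V)) : measurable A ->
  Q (family_tuple @^-1` A) =
  (Q \x Q)%E ((fun p : S * S => replace_tnth k (U k p.2) (family_tuple p.1)) @^-1` A).
Proof.
move=> mA.
pose f1 : {mfun S >-> n.-tuple V} := HB.pack family_tuple
  (isMeasurableFun.Build _ _ _ _ _ measurable_family_tuple).
pose f2 : {mfun (S * S)%type >-> n.-tuple V} := HB.pack
  (fun p : S * S => replace_tnth k (U k p.2) (family_tuple p.1))
  (isMeasurableFun.Build _ _ _ _ _ (mQ k)).
apply: (measure_unique boxes (fun=> setT) measurable_boxes _ _ _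
  (pushforward Q f1) (pushforward (Q \x Q)%E f2)) => //.
- move=> _ _ [B1 [mB1 ->]] [B2 [mB2 ->]].
  exists (fun i => B1 i `&` B2 i); split=> [i|]; first exact: measurableI.
  apply/seteqP; split => x /=; first by move=> [x1 x2] i; split.
  by move=> x12; split => i; have [] := x12 i.
- move=> _; exists (fun=> setT); split => //.
  by apply/seteqP; split.
- by rewrite bigcup_const//; exists 0%N.
- move=> _ [B [mB ->]].
  change (Q (family_tuple @^-1` box B) = (Q \x Q)%E
    ((fun p : S * S => replace_tnth k (U k p.2) (family_tuple p.1)) @^-1` box B)).
  have -> : family_tuple @^-1` box B =
    \bigcap_(i in [set` (finset.setT : {set 'I_n})]) U i @^-1` B i.
    apply/seteqP; split => w /= Bw i.
      by move=> _; have := Bw i; rewrite tnth_mktuple.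
    by rewrite tnth_mktuple; apply: Bw; rewrite /= inE.
  rewrite indep// (bigD1 k)/= ?inE//.
  have -> : (fun p : S * S => replace_tnth k (U k p.2) (family_tuple p.1)) @^-1` box B =
    (\bigcap_(i in [set` (finset.setT :\ k)%SET]) U i @^-1` B i)
      `*` (U k @^-1` B k).
    apply/seteqP; split => -[w w'] /=.
      move=> Bw; split=> [i|]; last by have := Bw k; rewrite tnth_mktuple eqxx.
      rewrite /= !inE => /andP[ik _]; have := Bw i.
      by rewrite tnth_mktuple (negbTE ik) tnth_mktuple.
    move=> [Bw Bw'] i; rewrite tnth_mktuple; case: eqP => [->//|/eqP ik].
    by rewrite tnth_mktuple; apply: Bw; rewrite /= !inE ik.
  have mUB i : measurable (U i @^-1` B i).
    by rewrite -[X in measurable X]setTI; exact: mU.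
  rewrite product_measure1E//; last exact: fin_bigcap_measurable.
  rewrite muleC; congr (_ * _)%E; apply/esym.
  apply: etrans (indep (finset.setT :\ k)%SET mB) _.
  by apply: eq_bigl => i; rewrite !inE andbT.
- move=> _; apply: (@le_lt_trans _ _ 1%E); last by rewrite ltry.
  by apply: (@probability_le1 _ _ _ Q); exact: measurableT.
Qed.

Lemma integral_resample k (Phi : n.-tuple V -> R) :
  measurable_fun setT Phi -> (forall x, 0 <= Phi x) ->
  (\int[Q]_w (Phi (family_tuple w))%:E =
   \int[Q]_w \int[Q]_w' (Phi (replace_tnth k (U k w') (family_tuple w)))%:E)%E.
Proof.
move=> mPhi Phi0.
rewrite (ge0_eq_law_integral (mu2 := (Q \x Q)%E) measurable_family_tuple (mQ k) (law_replace k))//.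
rewrite fubini_tonelli1//.
- apply/measurable_EFinP; exact: measurableT_comp.
- by move=> p; rewrite lee_fin.
Qed.

(** An inequality in the k-th variable, for all frozen values of the others, integrates to one for
    the whole family. *)
Lemma le_integral_resample k (Phi Psi : n.-tuple V -> R) :
  measurable_fun setT Phi -> (forall x, 0 <= Phi x) ->
  measurable_fun setT Psi -> (forall x, 0 <= Psi x) ->
  (forall x, \int[Q]_w (Phi (replace_tnth k (U k w) x))%:E <=
             \int[Q]_w (Psi (replace_tnth k (U k w) x))%:E)%E ->
  (\int[Q]_w (Phi (family_tuple w))%:E <= \int[Q]_w (Psi (family_tuple w))%:E)%E.
Proof.
move=> mPhi Phi0 mPsi Psi0 le; rewrite !(integral_resample k)//.
have mF (f : n.-tuple V -> R) : measurable_fun setT f -> (forall x, 0 <= f x) ->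
    measurable_fun setT (fun w : S => \int[Q]_w' (f (replace_tnth k (U k w') (family_tuple
      w)))%:E)%E.
  move=> mf f0.
  apply: (measurable_fun_fubini_tonelli_F (m2:=Q) (fun p => (f (replace_tnth k (U k p.2)
    (family_tuple p.1)))%:E)).
  - by apply/measurable_EFinP; exact: (measurableT_comp mf (mQ k)).
  - by move=> p; rewrite lee_fin.
apply: ge0_le_integral => //.
- by move=> w _; apply: integral_ge0 => w' _; rewrite lee_fin.
- exact: mF.
- exact: mF.
Qed.

End resampling.

Section sample_subgaussian.
Context d (S : measurableType d) d1 (V : measurableType d1)
  d2 (T' : measurableType d2) (R : realType).
Variables (Q : probability S R) (n N : nat) (U : 'I_n -> S -> V).
Variables (y : V -> T') (f : V -> 'cV[R]_N) (C : 'M[R]_N).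
Hypothesis mU : forall i, measurable_fun setT (U i).
Hypothesis indep : mutually_independent Q U.
Hypothesis my : measurable_fun setT y.
Hypothesis mf : measurable_fun setT f.
Hypothesis one_sample : forall (k : 'I_n) (b : T' -> 'cV[R]_N) (H : T' -> R),
  measurable_fun setT b -> measurable_fun setT H -> (forall z, 0 <= H z) ->
  (\int[Q]_w (H (y (U k w)) * expR (dotv (b (y (U k w))) (f (U k w))
      - dotv (b (y (U k w))) (C *m b (y (U k w))) / 2))%:E <=
   \int[Q]_w (H (y (U k w)))%:E)%E.

Variables (h : n.-tuple T' -> R) (b : 'I_n -> n.-tuple T' -> 'cV[R]_N).
Hypothesis mh : measurable_fun setT h.
Hypothesis h_ge0 : forall x, 0 <= h x.
Hypothesis mb : forall i, measurable_fun setT (b i).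

Let ymap (x : n.-tuple V) : n.-tuple T' := [tuple y (tnth x i) | i < n].
Let e (i : 'I_n) (z : n.-tuple T') (u : V) : R :=
  dotv (b i z) (f u) - dotv (b i z) (C *m b i z) / 2.
(** Only the first [k] factors are kept, so that they can be integrated out from the last one
    down. *)
Let Phi (k : nat) (x : n.-tuple V) : R :=
  h (ymap x) * expR (\sum_(i < n | (i < k)%N) e i (ymap x) (tnth x i)).

Let mymap : measurable_fun setT ymap.
Proof.
apply/measurable_fun_tnthP => i.
rewrite (_ : _ \o _ = y \o (fun t => tnth t i)).
  by apply: measurableT_comp => //; exact: measurable_tnth.
by apply/funext => x /=; rewrite tnth_mktuple.
Qed.

Let me d0 (T0 : measurableType d0) i (z : T0 -> n.-tuple T') (u : T0 -> V) :
  measurable_fun setT z -> measurable_fun setT u ->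
  measurable_fun setT (fun w => e i (z w) (u w)).
Proof.
move=> mz mu; have mbz : measurable_fun setT (fun w => b i (z w)).
  exact: measurableT_comp.
apply: measurable_funB; first by apply: measurable_dotv => //; exact: measurableT_comp.
apply: measurable_funM => //; apply: measurable_dotv => //.
by apply: measurable_mulmx => //; exact: measurable_cst.
Qed.

Let mPhi k : measurable_fun setT (Phi k).
Proof.
apply: measurable_funM; first exact: measurableT_comp.
apply: measurable_expR_comp.
under eq_fun do rewrite big_mkcond.
apply: measurable_sum => i; case: (i < k)%N => //.
by apply: me => //; exact: measurable_tnth.
Qed.

Let Phi_ge0 k x : 0 <= Phi k x.
Proof. by rewrite mulr_ge0// expR_ge0. Qed.

Let ymap_replace (k : 'I_n) u x :
  ymap (replace_tnth k u x) = replace_tnth k (y u) (ymap x).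
Proof.
by apply: eq_from_tnth => i; rewrite !tnth_mktuple; case: eqP.
Qed.

(** Once the other samples are frozen, every factor but the j-th depends on the j-th sample only
    through its response and enters the weight [H]; the j-th direction is likewise a function of
    that response, as [one_sample] requires. *)
Let Phi_step (k : nat) : (k < n)%N ->
  (\int[Q]_w (Phi k.+1 (family_tuple U w))%:E <=
   \int[Q]_w (Phi k (family_tuple U w))%:E)%E.
Proof.
move=> kn; pose j : 'I_n := Ordinal kn.
apply: (le_integral_resample mU indep (k := j) (mPhi _) (Phi_ge0 _) (mPhi _) (Phi_ge0 _)) => x.
pose rp (z : T') := replace_tnth j z (ymap x).
have mrp : measurable_fun setT rp.
  by apply: measurable_replace_tnth => //; exact: measurable_cst.
pose H (z : T') : R := h (rp z) * expR (\sum_(i < n | (i < k)%N) e i (rp z) (tnth x i)).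
have mH : measurable_fun setT H.
  apply: measurable_funM; first exact: measurableT_comp.
  apply: measurable_expR_comp.
  under eq_fun do rewrite big_mkcond.
  apply: measurable_sum => i; case: (i < k)%N => //.
  by apply: me => //; exact: measurable_cst.
have H0 z : 0 <= H z by rewrite mulr_ge0// expR_ge0.
have PhiE w : Phi k (replace_tnth j (U j w) x) = H (y (U j w)).
  rewrite /Phi ymap_replace /H; congr (_ * expR _); apply: eq_bigr => i ik.
  rewrite [tnth (replace_tnth _ _ _) _]tnth_mktuple; case: eqP => // ij.
  by move: ik; rewrite ij ltnn.
have PhiSE w : Phi k.+1 (replace_tnth j (U j w) x) =
    H (y (U j w)) * expR (e j (rp (y (U j w))) (U j w)).
  rewrite -PhiE /Phi -mulrA -expRD ymap_replace (bigD1 j)/=; last exact: ltnSn.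
  rewrite (eq_bigl (fun i : 'I_n => (i < k)%N)); last first.
    by move=> i; rewrite ltnS -(inj_eq val_inj)/=; case: ltngtP.
  by rewrite addrC [tnth (replace_tnth j _ x) j]tnth_mktuple eqxx.
under eq_integral do rewrite PhiSE.
under [leRHS]eq_integral do rewrite PhiE.
exact: (@one_sample j (fun z => b j (rp z)) H (measurableT_comp (mb j) mrp) mH H0).
Qed.

Lemma sample_subgaussian :
  (\int[Q]_w (h [tuple y (U i w) | i < n] *
     expR (\sum_(i < n) (dotv (b i [tuple y (U i w) | i < n]) (f (U i w))
       - dotv (b i [tuple y (U i w) | i < n]) (C *m b i [tuple y (U i w) | i < n]) / 2)))%:E
   <= \int[Q]_w (h [tuple y (U i w) | i < n])%:E)%E.
Proof.
have yE w : ymap (family_tuple U w) = [tuple y (U i w) | i < n].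
  by apply: eq_from_tnth => i; rewrite !tnth_mktuple.
have main k : (k <= n)%N ->
    (\int[Q]_w (Phi k (family_tuple U w))%:E <= \int[Q]_w (Phi 0 (family_tuple U w))%:E)%E.
  elim: k => [_|k IH kn]; first exact: lexx.
  apply: le_trans (Phi_step kn) (IH _); exact: ltnW.
apply: le_trans (le_trans _ (main n (leqnn n))) _.
- rewrite le_eqVlt; apply/orP; left; apply/eqP; apply: eq_integral => w _.
  rewrite /Phi yE; congr (_ * expR _)%:E; apply: eq_big => [i|i _].
    by rewrite ltn_ord.
  by rewrite /e tnth_mktuple.
- rewrite le_eqVlt; apply/orP; left; apply/eqP; apply: eq_integral => w _.
  by rewrite /Phi yE big_pred0_eq expR0 mulr1.
Qed.

End sample_subgaussian.

Lemma eq_law_integral d1 (T1 : measurableType d1) d2 (T2 : measurableType d2)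
    d' (T' : measurableType d') (R : realType)
    (mu1 : {measure set T1 -> \bar R}) (mu2 : {measure set T2 -> \bar R})
    (Y1 : T1 -> T') (Y2 : T2 -> T') (H : T' -> R) :
  measurable_fun setT Y1 -> measurable_fun setT Y2 ->
  (forall B, measurable B -> mu1 (Y1 @^-1` B) = mu2 (Y2 @^-1` B)) ->
  measurable_fun setT H ->
  (\int[mu1]_w (H (Y1 w))%:E = \int[mu2]_w (H (Y2 w))%:E)%E.
Proof.
move=> mY1 mY2 law mH; rewrite integralE [RHS]integralE; congr (_ - _)%E.
- have E d (T : measurableType d) (mu : {measure set T -> \bar R}) (Y : T -> T') :
    (\int[mu]_w ((fun w => (H (Y w))%:E)^\+ w) = \int[mu]_w (Num.max (H (Y w)) 0)%:E)%E.
    by apply: eq_integral => w _; rewrite funeposE EFin_max.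
  rewrite !E; apply: (ge0_eq_law_integral (H := fun y => Num.max (H y) 0)) => //.
    exact: measurable_maxr.
  by move=> y; rewrite le_max lexx orbT.
- have E d (T : measurableType d) (mu : {measure set T -> \bar R}) (Y : T -> T') :
    (\int[mu]_w ((fun w => (H (Y w))%:E)^\- w) = \int[mu]_w (Num.max (- H (Y w)) 0)%:E)%E.
    by apply: eq_integral => w _; rewrite funenegE EFin_max.
  rewrite !E; apply: (ge0_eq_law_integral (H := fun y => Num.max (- H y) 0)) => //.
    by apply: measurable_maxr => //; exact: measurableT_comp.
  by move=> y; rewrite le_max lexx orbT.
Qed.

(** * Orthogonality to functions of an observation *)

Section orthogonality.
Context d (T : measurableType d) d' (T' : measurableType d') (R : realType).
Variables (P : probability T R) (Y : T -> T') (D : T -> R) (h : T' -> R).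
Hypothesis mY : measurable_fun setT Y.
Hypothesis mh : measurable_fun setT h.
Hypothesis iD : P.-integrable setT (EFin \o D).
Hypothesis ihD : P.-integrable setT (EFin \o (fun w => h (Y w) * D w)).
Hypothesis D0 : forall B, measurable B -> (\int[P]_(w in Y @^-1` B) (D w)%:E = 0)%E.

Let p (x : R) := Num.max x 0.
Let q (x : R) := Num.max (- x) 0.

Let p_ge0 x : 0 <= p x. Proof. by rewrite le_max lexx orbT. Qed.
Let q_ge0 x : 0 <= q x. Proof. by rewrite le_max lexx orbT. Qed.
Let pq x : x = p x - q x.
Proof. by rewrite /p /q; case: (lerP x 0); case: (lerP (- x) 0); lra. Qed.
Let abs_pq x : `|x| = p x + q x.
Proof.
rewrite /p /q; have [x0|x0] := lerP 0 x.
  by rewrite ger0_norm//; case: (lerP (- x) 0); lra.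
by rewrite ltr0_norm//; case: (lerP (- x) 0); lra.
Qed.

Let mD : measurable_fun setT D.
Proof. exact/measurable_EFinP/measurable_int/iD. Qed.

Let mp d0 (T0 : measurableType d0) (f : T0 -> R) :
  measurable_fun setT f -> measurable_fun setT (fun x => p (f x)).
Proof. by move=> mf; apply: measurable_maxr. Qed.
Let mq d0 (T0 : measurableType d0) (f : T0 -> R) :
  measurable_fun setT f -> measurable_fun setT (fun x => q (f x)).
Proof. by move=> mf; apply: measurable_maxr => //; exact: measurableT_comp. Qed.

Let integrable_le (f g : T -> R) : P.-integrable setT (EFin \o f) ->
  measurable_fun setT g -> (forall w, `|g w| <= `|f w|) ->
  P.-integrable setT (EFin \o g).
Proof.
move=> fi mg gf; apply: (le_integrable measurableT _ _ fi).
- exact/measurable_EFinP.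
- by move=> w _; rewrite /= lee_fin.
Qed.

Let pos_neg B : measurable B ->
  (\int[P]_(w in Y @^-1` B) (p (D w))%:E = \int[P]_(w in Y @^-1` B) (q (D w))%:E)%E.
Proof.
move=> mB; have mYB : measurable (Y @^-1` B).
  by rewrite -[X in measurable X]setTI; exact: mY.
have ip : P.-integrable setT (EFin \o (fun w => p (D w))).
  by apply: integrable_le iD (mp mD) _ => w; rewrite ger0_norm// abs_pq lerDl.
have iq : P.-integrable setT (EFin \o (fun w => q (D w))).
  by apply: integrable_le iD (mq mD) _ => w; rewrite ger0_norm// abs_pq lerDr.
have ipB := integrableS measurableT mYB (subsetT _) ip.
have iqB := integrableS measurableT mYB (subsetT _) iq.
have := D0 mB; under eq_integral do rewrite (pq (D _)) EFinB.
rewrite integralB// => /eqP.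
rewrite sube_eq ?add0e ?integral_fune_fin_num//.
by move/eqP.
Qed.

(** Splitting [h] and [D] into positive and negative parts gives four products, each dominated by
    the integrable |h(Y) D|; the weighted comparison in both directions makes them cancel in
    pairs. *)
Lemma integral_comp_orthogonal : (\int[P]_w (h (Y w) * D w)%:E = 0)%E.
Proof.
have mhY : measurable_fun setT (fun w => h (Y w)) by exact: measurableT_comp.
have eqpq (H : T' -> R) : measurable_fun setT H -> (forall y, 0 <= H y) ->
    (\int[P]_w (H (Y w) * p (D w))%:E = \int[P]_w (H (Y w) * q (D w))%:E)%E.
  move=> mH H0; apply/eqP; rewrite eq_le; apply/andP; split.
  - apply: ge0_le_integral_comp => //; [exact: mp|exact: mq|].
    by move=> B mB; rewrite pos_neg.
  - apply: ge0_le_integral_comp => //; [exact: mq|exact: mp|].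
    by move=> B mB; rewrite pos_neg.
have ifg (F G : R -> R) : (forall x, 0 <= F x <= `|x|) -> (forall x, 0 <= G x <= `|x|) ->
    measurable_fun setT (fun w => F (h (Y w))) -> measurable_fun setT (fun w => G (D w)) ->
    P.-integrable setT (EFin \o (fun w => F (h (Y w)) * G (D w))).
  move=> F0 G0 mF mG; apply: integrable_le ihD _ _; first exact: measurable_funM.
  move=> w; have /andP[Fa Fb] := F0 (h (Y w)); have /andP[Ga Gb] := G0 (D w).
  by rewrite (ger0_norm (mulr_ge0 Fa Ga)) normrM ler_pM.
have p01 x : 0 <= p x <= `|x| by rewrite p_ge0/= abs_pq lerDl.
have q01 x : 0 <= q x <= `|x| by rewrite q_ge0/= abs_pq lerDr.
have ipp := ifg p p p01 p01 (mp mhY) (mp mD); have ipq := ifg p q p01 q01 (mp mhY) (mq mD).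
have iqp := ifg q p q01 p01 (mq mhY) (mp mD); have iqq := ifg q q q01 q01 (mq mhY) (mq mD).
have Epp := eqpq (fun y => p (h y)) (mp mh) (fun y => p_ge0 _).
have Eqp := eqpq (fun y => q (h y)) (mq mh) (fun y => q_ge0 _).
transitivity (\int[P]_w ((p (h (Y w)) * p (D w))%:E - (p (h (Y w)) * q (D w))%:E
   - ((q (h (Y w)) * p (D w))%:E - (q (h (Y w)) * q (D w))%:E)))%E.
  by apply: eq_integral => w _; rewrite {1}(pq (h _)) {1}(pq (D w)) -!EFinB; congr EFin; ring.
rewrite integralB//; [|exact: integrableB|exact: integrableB].
rewrite !integralB// Epp Eqp !subee ?integral_fune_fin_num// ?sube0//.
Qed.

End orthogonality.

(** * Norms of sub-Gaussian vectors and bounded multipliers *)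

Lemma ge0_integral_realZl d (T : measurableType d) (R : realType)
    (mu : {measure set T -> \bar R}) (k : R) (f : T -> R) :
  0 <= k -> measurable_fun setT f -> (forall w, 0 <= f w) ->
  (\int[mu]_w (k * f w)%:E = k%:E * \int[mu]_w (f w)%:E)%E.
Proof.
move=> k0 mf f0; under eq_integral do rewrite EFinM.
rewrite ge0_integralZl//; first exact/measurable_EFinP.
by move=> w _; rewrite lee_fin.
Qed.

Lemma ge0_integral_realD d (T : measurableType d) (R : realType)
    (mu : {measure set T -> \bar R}) (f g : T -> R) :
  measurable_fun setT f -> (forall w, 0 <= f w) ->
  measurable_fun setT g -> (forall w, 0 <= g w) ->
  (\int[mu]_w (f w + g w)%:E = \int[mu]_w (f w)%:E + \int[mu]_w (g w)%:E)%E.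
Proof.
move=> mf f0 mg g0; under eq_integral do rewrite EFinD.
rewrite ge0_integralD//; try (by move=> w _; rewrite lee_fin);
  exact/measurable_EFinP.
Qed.

(** The quadratic tail bound with equal weights and zero means. It asks for a positive sum of
    squares, so the case [sigma2 = 0], which arises from a zero [rho] or a zero coordinate of [mu],
    is separate. *)
Lemma subgaussian_norm_tail d (T : measurableType d) (R : realType)
    (P : probability T R) (k : nat) (xi : T -> 'cV[R]_k) (sigma2 s : R) :
  (0 < k)%N -> 0 <= sigma2 -> 0 <= s -> measurable_fun setT xi ->
  (forall z : 'cV[R]_k,
    \int[P]_w (expR (dotv z (xi w)))%:E <= (expR (sigma2 * sqn z / 2))%:E)%E ->
  (P [set w | (sigma2 * (k%:R + 2 * Num.sqrt (k%:R * s) + 2 * s) < sqn (xi w))%R]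
   <= (expR (- s))%:E)%E.
Proof.
move=> k0 sg0 s0 mxi sub.
pose x (i : 'I_k) (w : T) := xi w i 0.
have mx i : measurable_fun setT (x i) by exact: (measurable_mxP _).1 mxi i 0.
have sub' (z : 'I_k -> R) :
    (\int[P]_w (\1_setT w * expR (\sum_i (z i * x i w - sigma2 * z i ^+ 2 / 2)))%:E <=
     \int[P]_w (\1_setT w * expR (\sum_i z i * 0))%:E)%E.
  have zE : \sum_i sigma2 * z i ^+ 2 / 2 = sigma2 * sqn (\col_i z i) / 2.
    rewrite -mulr_suml -mulr_sumr /sqn; congr (_ * _ / _).
    by apply: eq_bigr => i _; rewrite mxE.
  have -> : (\int[P]_w (\1_setT w * expR (\sum_i z i * 0))%:E = 1)%E.
    rewrite -[RHS](@integral_prob_cst _ _ _ P); apply: eq_integral => w _.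
    by rewrite indicT mul1r big1 ?expR0// => i _; rewrite mulr0.
  have -> : (\int[P]_w (\1_setT w * expR (\sum_i (z i * x i w - sigma2 * z i ^+ 2 / 2)))%:E
      = (expR (- (sigma2 * sqn (\col_i z i) / 2)))%:E *
        \int[P]_w (expR (dotv (\col_i z i) (xi w)))%:E)%E.
    rewrite -[RHS]ge0_integral_realZl; last 3 first.
    - exact: expR_ge0.
    - by apply: measurable_expR_comp; apply: measurable_dotv => //; exact: measurable_cst.
    - by move=> w; exact: expR_ge0.
    apply: eq_integral => w _; rewrite indicT mul1r -expRD sumrB zE addrC.
    by rewrite dotvE; do 3 f_equal; apply: eq_bigr => i _; rewrite mxE.
  apply: le_trans (lee_wpmul2l _ (sub _)) _; first by rewrite lee_fin expR_ge0.
  by rewrite -EFinM -expRD addNr expR0.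
have [sgE|sgn0] := eqVneq sigma2 0.
  (* Decoupling with eta = 1 gives E e^(|xi|^2) <= 1, hence E |xi|^2 <= 0 and xi = 0 almost
     surely. *)
  have : (\int[P]_w (\1_setT w * expR (1 * \sum_i x i w ^+ 2))%:E <=
      \int[P]_w (\1_setT w * expR (\sum_(i < k)
       (- ln (1 - 2 * (1 * sigma2)) / 2 + 1 * 0 ^+ 2 / (1 - 2 * (1 * sigma2)))))%:E)%E.
    apply: (gaussian_decoupling (lam := fun=> sigma2) (m := fun _ _ => 0)) => //.
    by rewrite sgE mulr0 invr_gt0.
  rewrite sgE.
  have -> : (\int[P]_w (\1_setT w * expR (\sum_(i < k)
       (- ln (1 - 2 * (1 * 0)) / 2 + 1 * 0 ^+ 2 / (1 - 2 * (1 * 0)))))%:E = 1)%E.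
    rewrite -[RHS](@integral_prob_cst _ _ _ P); apply: eq_integral => w _.
    rewrite indicT big1 => [|i _]; first by rewrite expR0 mulr1.
    by rewrite !mulr0 subr0 ln1 oppr0 expr0n mulr0 !mul0r addr0.
  move=> le1.
  have ms : measurable_fun setT (fun w => sqn (xi w)) by exact: measurable_sqn.
  have le2 : (1 + \int[P]_w (sqn (xi w))%:E <= 1)%E.
    apply: le_trans le1; rewrite -{1}(@integral_prob_cst _ _ _ P 1%E) -ge0_integralD//.
    - apply: ge0_le_integral => //.
      + by move=> w _; rewrite adde_ge0// lee_fin sqn_ge0.
      + by apply: emeasurable_funD => //; exact/measurable_EFinP.
      + apply/measurable_EFinP; apply: measurable_funM => //.
        by apply: measurable_expR_comp; apply: measurable_funM => //; apply: measurable_sum => i;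
          exact: measurable_funX.
      + by move=> w _; rewrite indicT mul1r mul1r -EFinD lee_fin expR_ge1Dx.
    - by move=> w _; rewrite lee_fin sqn_ge0.
    - exact/measurable_EFinP.
  have i0 : (\int[P]_w (sqn (xi w))%:E = 0)%E.
    apply/eqP; rewrite eq_le integral_ge0 ?andbT; last first.
      by move=> w _; rewrite lee_fin sqn_ge0.
    by move: le2; rewrite -{2}(adde0 1%E) leeD2lE.
  apply: (@le_trans _ _ 0%E); last by rewrite lee_fin expR_ge0.
  have mb : measurable [set w | (0 * (k%:R + 2 * Num.sqrt (k%:R * s) + 2 * s) < sqn (xi w))%R].
    by apply: measurable_ltr_set => //; exact: measurable_cst.
  have /(ae_eq_integral_abs P measurableT) [] := (measurable_EFinP _ _).2 ms.
  move=> /(_ _)[|N [mN N0 sub0]].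
    by rewrite -[RHS]i0; apply: eq_integral => w _ /=; rewrite ger0_norm ?sqn_ge0.
  move=> _; rewrite -N0; apply: le_measure; rewrite ?inE// => w /=.
  rewrite mul0r => w0; apply: sub0 => /= /(_ I) [] /eqP; by rewrite gt_eqF.
have sgp : 0 < sigma2 by rewrite lt_neqAle eq_sym sgn0.
have kp : 0 < k%:R :> R by rewrite ltr0n.
have vE : \sum_(i < k) sigma2 ^+ 2 = k%:R * sigma2 ^+ 2.
  by rewrite sumr_const card_ord mulr_natl.
have := quadratic_tail (P := P) (xi := x) (m := fun _ _ => 0) (G := setT) (lam := fun=> sigma2)
  (L := sigma2) (beta := 0) (t := s) mx (fun=> measurable_cst _) measurableT (fun=> sg0)
  (fun=> lexx _) sg0 s0.
rewrite vE => /(_ _ sub' _); rewrite setTI mul0r addr0.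
rewrite (_ : \sum_(i < k) sigma2 + 2 * Num.sqrt (k%:R * sigma2 ^+ 2 * s) + 2 * sigma2 * s =
   sigma2 * (k%:R + 2 * Num.sqrt (k%:R * s) + 2 * s)); last first.
  rewrite (_ : k%:R * sigma2 ^+ 2 * s = sigma2 ^+ 2 * (k%:R * s)); last by ring.
  rewrite sqrtrM ?sqr_ge0// sqrtr_sqr ger0_norm// sumr_const card_ord -mulr_natl.
  by ring.
apply; last by rewrite mulr_gt0// exprn_gt0.
by move=> w _; rewrite big1// => i _; rewrite expr0n.
Qed.

Lemma expR_sym_le (R : realType) (x y : R) : `|x| <= `|y| ->
  expR x + expR (- x) <= expR y + expR (- y).
Proof.
have abs (z : R) : expR z + expR (- z) = expR `|z| + expR (- `|z|).
  have [z0|z0] := lerP 0 z; first by rewrite ger0_norm.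
  by rewrite ltr0_norm// opprK addrC.
rewrite (abs x) (abs y); move: `|x| `|y| (normr_ge0 x) => a b a0 ab.
have eab : expR a <= expR b by rewrite ler_expR.
rewrite -subr_ge0 !expRN.
have -> : expR b + (expR b)^-1 - (expR a + (expR a)^-1) =
   (expR b - expR a) * (1 - (expR a * expR b)^-1).
  by field; rewrite !gt_eqF// expR_gt0.
apply: mulr_ge0; first by rewrite subr_ge0.
rewrite subr_ge0 invf_le1 ?mulr_gt0 ?expR_gt0//.
by rewrite -expRD -expR0 ler_expR addr_ge0// (le_trans a0).
Qed.

(* The centering E[V g] = 0 replaces the (false in general) centering of V given g. *)
Lemma bounded_multiplier_mgf d (T : measurableType d) (R : realType)
    (P : probability T R) (V g : T -> R) (mu r2 : R) :
  measurable_fun setT V -> measurable_fun setT g ->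
  {ae P, forall w, `|g w| <= mu} ->
  P.-integrable setT (EFin \o (fun w => V w * g w)) ->
  (\int[P]_w (V w * g w)%:E = 0)%E ->
  (forall l : R, \int[P]_w (expR (l * V w))%:E <= (expR (r2 * l ^+ 2 / 2))%:E)%E ->
  (\int[P]_w (expR (V w * g w))%:E <= (expR (3 / 2 * mu ^+ 2 * r2 / 2))%:E)%E.
Proof.
move=> mV mg gmu iVg Vg0 sub; set a := Num.sqrt (3 / 2 : R).
have a2 : a ^+ 2 = 3 / 2 by rewrite sqr_sqrtr//; lra.
have mVg : measurable_fun setT (fun w => V w * g w) by exact: measurable_funM.
pose f w := V w * g w.
(* The hyperbolic cosine with [g] replaced by its bound [mu]: its mean involves only the moment
   generating function of [V]. *)
pose ch w := 2^-1 * expR (a * mu * V w) + 2^-1 * expR (- (a * mu) * V w).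
have mch : measurable_fun setT ch.
  by apply: measurable_funD; apply: measurable_funM => //; apply: measurable_expR_comp;
    apply: measurable_funM.
have ch_le : (\int[P]_w (ch w)%:E <= (expR (3 / 2 * mu ^+ 2 * r2 / 2))%:E)%E.
  have me l : measurable_fun setT (fun w => expR (l * V w)).
    by apply: measurable_expR_comp; apply: measurable_funM.
  have e0 l w : 0 <= expR (l * V w) by exact: expR_ge0.
  rewrite ge0_integral_realD; last 4 first.
  - exact: measurable_funM.
  - by move=> w; rewrite mulr_ge0.
  - exact: measurable_funM.
  - by move=> w; rewrite mulr_ge0.
  rewrite !ge0_integral_realZl//.
  apply: le_trans (leeD (lee_wpmul2l _ (sub _)) (lee_wpmul2l _ (sub _))) _; rewrite ?lee_fin//.
  rewrite sqrrN exprMn a2.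
  rewrite (_ : r2 * (3 / 2 * mu ^+ 2) / 2 = 3 / 2 * mu ^+ 2 * r2 / 2); last by ring.
  by move: (expR _) => x; lra.
(* The linear term has no sign; its positive and negative parts are put on opposite sides to keep
   all integrands nonnegative, and their integrals cancel because E[V g] = 0. *)
have le_ae : {ae P, forall w, setT w ->
    ((expR (f w) + Num.max (- f w) 0)%:E <= (Num.max (f w) 0 + ch w)%:E)%E}.
  apply: filterS gmu => w gw _; rewrite lee_fin.
  have le1 := expR_le_add_cosh (f w); rewrite -/a in le1.
  have le2 : expR (a * f w) + expR (- (a * f w)) <= expR (a * mu * V w) + expR (- (a * mu * V w)).
    apply: expR_sym_le; rewrite /f !normrM -mulrA ler_wpM2l// mulrC.
    by rewrite ler_wpM2r// (le_trans gw)// ler_norm.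
  have -> : ch w = (expR (a * mu * V w) + expR (- (a * mu * V w))) / 2.
    by rewrite /ch mulNr; field.
  by case: (lerP (f w) 0); case: (lerP (- f w) 0); lra.
have mfp : measurable_fun setT (fun w => Num.max (f w) 0) by exact: measurable_maxr.
have mfn : measurable_fun setT (fun w => Num.max (- f w) 0).
  by apply: measurable_maxr => //; exact: measurableT_comp.
have mef : measurable_fun setT (fun w => expR (f w)) by exact: measurable_expR_comp.
have max_ge0 (z : R) : 0 <= Num.max z 0 by rewrite le_max lexx orbT.
have ch0 w : 0 <= ch w by rewrite /ch addr_ge0// mulr_ge0// expR_ge0.
have ifp : P.-integrable setT (EFin \o (fun w => Num.max (f w) 0)).
  apply: (le_integrable measurableT _ _ iVg); first exact/measurable_EFinP.
  move=> w _; rewrite /= lee_fin -/(f w) ger0_norm//.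
  by case: (lerP (f w) 0) => // f0; rewrite ler_norm.
have ifn : P.-integrable setT (EFin \o (fun w => Num.max (- f w) 0)).
  apply: (le_integrable measurableT _ _ iVg); first exact/measurable_EFinP.
  move=> w _; rewrite /= lee_fin -/(f w) ger0_norm// -normrN.
  by case: (lerP (- f w) 0) => // f0; rewrite ler_norm.
have eqpn : (\int[P]_w (Num.max (f w) 0)%:E = \int[P]_w (Num.max (- f w) 0)%:E)%E.
  have : (\int[P]_w ((Num.max (f w) 0)%:E - (Num.max (- f w) 0)%:E) = 0)%E.
    rewrite -[RHS]Vg0; apply: eq_integral => w _; rewrite -EFinB -/(f w); congr EFin.
    by case: (lerP (f w) 0); case: (lerP (- f w) 0); lra.
  rewrite integralB// => /eqP; rewrite sube_eq ?add0e ?integral_fune_fin_num//.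
  by move/eqP.
have : (\int[P]_w (expR (f w))%:E + \int[P]_w (Num.max (- f w) 0)%:E <=
        \int[P]_w (Num.max (f w) 0)%:E + \int[P]_w (ch w)%:E)%E.
  rewrite -(ge0_integral_realD P mef _ mfn) => [|w|w]; [|exact: expR_ge0|exact: max_ge0].
  rewrite -(ge0_integral_realD P mfp _ mch) => [|w|w]; [|exact: max_ge0|exact: ch0].
  apply: ae_ge0_le_integral => //.
  - by move=> w _; rewrite lee_fin addr_ge0// expR_ge0.
  - by apply/measurable_EFinP; exact: measurable_funD.
  - by move=> w _; rewrite lee_fin addr_ge0.
  - by apply/measurable_EFinP; exact: measurable_funD.
rewrite eqpn addeC leeD2lE ?integral_fune_fin_num// => le_ch.
exact: le_trans le_ch ch_le.
Qed.

(** * Second moments and conditional expectations *)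

Section moments.
Context d (T : measurableType d) (R : realType) (P : probability T R).

Definition Ex (f : T -> R) : R := fine (\int[P]_w (f w)%:E).

Lemma Ex_sum (I : finType) (c : I -> R) (f : I -> T -> R) :
  (forall i, P.-integrable setT (EFin \o f i)) ->
  Ex (fun w => \sum_i c i * f i w) = \sum_i c i * Ex (f i).
Proof.
move=> fi; rewrite /Ex; under eq_integral do rewrite -sumEFin.
have cf i : P.-integrable setT (fun w => (c i * f i w)%:E).
  by apply: eq_integrable (integrableZl measurableT (c i) (fi i)) => // w _ /=.
rewrite integral_sum// (eq_bigr (fun i => (c i * fine (\int[P]_w (f i w)%:E))%:E)).
  by rewrite sumEFin.
move=> i _; under eq_integral do rewrite EFinM.
by rewrite (integralZl measurableT (fi i)) EFinM fineK// integral_fune_fin_num//; exact: fi.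
Qed.

Lemma Lfun2_integrable_mul (f g : T -> R) : f \in Lfun P 2%:E -> g \in Lfun P 2%:E ->
  P.-integrable setT (EFin \o (fun w => f w * g w)).
Proof. by move=> f2 g2; apply/Lfun1_integrable; exact: Lfun2_mul_Lfun1. Qed.

Lemma Lfun2_sum (I : finType) (c : I -> R) (f : I -> T -> R) :
  (forall i, f i \in Lfun P 2%:E) -> (fun w => \sum_i c i * f i w) \in Lfun P 2%:E.
Proof.
move=> f2; have p1 : (1 <= 2%:E :> \bar R)%E by rewrite lee1n.
rewrite (_ : (fun w => _) = \sum_i (c i \o* f i)).
  by apply: rpred_sum => i _; exact: Lfun_scale.
by apply/funext => w; rewrite fct_sumE; apply: eq_bigr => i _ /=; rewrite mulrC.
Qed.

Lemma square_integrable_mulmx (m n : nat) (B : 'M[R]_(m, n)) (V : T -> 'cV[R]_n) :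
  square_integrable P V -> square_integrable P (fun w => B *m V w).
Proof.
move=> V2 i; rewrite /Defs.coord (_ : (fun w => _) = fun w => \sum_k B i k * Defs.coord V k w).
  exact: Lfun2_sum.
by apply/funext => w; rewrite mxE.
Qed.

Lemma square_integrable_add (n : nat) (V W : T -> 'cV[R]_n) :
  square_integrable P V -> square_integrable P W ->
  square_integrable P (fun w => V w + W w).
Proof.
move=> V2 W2 i; have p1 : (1 <= 2%:E :> \bar R)%E by rewrite lee1n.
rewrite /Defs.coord (_ : (fun w => _) = Defs.coord V i + Defs.coord W i).
  by apply: rpredD; [exact: V2|exact: W2].
by apply/funext => w; rewrite mxE.
Qed.

(** Uncentered second moments: they are bilinear, and agree with [covmx] once the mean is zero. *)
Definition mom (m n : nat) (V : T -> 'cV[R]_m) (W : T -> 'cV[R]_n) : 'M[R]_(m, n) :=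
  \matrix_(i, j) Ex (fun w => Defs.coord V i w * Defs.coord W j w).

Lemma mom_tr m n (V : T -> 'cV[R]_m) (W : T -> 'cV[R]_n) : mom W V = (mom V W)^T.
Proof.
apply/matrixP => i j; rewrite !mxE; congr Ex.
by apply/funext => w; rewrite mulrC.
Qed.

Lemma mom_mull m n p (B : 'M[R]_(p, m)) (V : T -> 'cV[R]_m) (W : T -> 'cV[R]_n) :
  square_integrable P V -> square_integrable P W ->
  mom (fun w => B *m V w) W = B *m mom V W.
Proof.
move=> V2 W2; apply/matrixP => i j; rewrite !mxE.
rewrite (_ : (fun w => _) = fun w => \sum_k B i k * (Defs.coord V k w * Defs.coord W j w)).
  by rewrite Ex_sum => [|k]; [apply: eq_bigr => k _; rewrite mxE|exact: Lfun2_integrable_mul].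
by apply/funext => w; rewrite /Defs.coord mxE mulr_suml; apply: eq_bigr => k _; rewrite mulrA.
Qed.

Lemma mom_addl m n (V V' : T -> 'cV[R]_m) (W : T -> 'cV[R]_n) :
  square_integrable P V -> square_integrable P V' -> square_integrable P W ->
  mom (fun w => V w + V' w) W = mom V W + mom V' W.
Proof.
move=> V2 V'2 W2; apply/matrixP => i j; rewrite !mxE /Ex.
have iV := Lfun2_integrable_mul (V2 i) (W2 j).
have iV' := Lfun2_integrable_mul (V'2 i) (W2 j).
rewrite -fineD ?integral_fune_fin_num//; congr fine.
rewrite -integralD//; apply: eq_integral => w _.
by rewrite /Defs.coord mxE mulrDl EFinD.
Qed.

Lemma mom_mulr m n p (B : 'M[R]_(p, n)) (V : T -> 'cV[R]_m) (W : T -> 'cV[R]_n) :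
  square_integrable P V -> square_integrable P W ->
  mom V (fun w => B *m W w) = mom V W *m B^T.
Proof. by move=> V2 W2; rewrite mom_tr mom_mull// trmx_mul -mom_tr. Qed.

Lemma mom_addr m n (V : T -> 'cV[R]_m) (W W' : T -> 'cV[R]_n) :
  square_integrable P V -> square_integrable P W -> square_integrable P W' ->
  mom V (fun w => W w + W' w) = mom V W + mom V W'.
Proof. by move=> V2 W2 W'2; rewrite mom_tr mom_addl// linearD/= -!mom_tr. Qed.

Lemma Ex_mean n (V : T -> 'cV[R]_n) i : Ex (Defs.coord V i) = meanvec P V i 0.
Proof. by rewrite mxE unlock. Qed.

Lemma covmx_mom n (V : T -> 'cV[R]_n) : square_integrable P V ->
  meanvec P V = 0 -> covmx P V = mom V V.
Proof.
move=> V2 V0; apply/matrixP => i j; rewrite !mxE.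
have E0 k : fine 'E_P[Defs.coord V k] = 0.
  by have := congr1 (fun u : 'cV[R]_n => u k 0) V0; rewrite !mxE.
rewrite unlock !E0 /Ex unlock; congr fine; apply: eq_integral => w _ /=.
by rewrite [X in X%:E](_ : _ = (Defs.coord V i w - 0) * (Defs.coord V j w - 0))// !subr0.
Qed.

Lemma mom_dotv n (V : T -> 'cV[R]_n) (u : 'cV[R]_n) : square_integrable P V ->
  (\int[P]_w (dotv u (V w) ^+ 2)%:E = (dotv u (mom V V *m u))%:E)%E.
Proof.
move=> V2; pose L w := u^T *m V w.
have L2 : square_integrable P L by exact: square_integrable_mulmx.
rewrite -[LHS]fineK; last first.
  rewrite (_ : (fun w => _) = EFin \o (fun w => Defs.coord L 0 w * Defs.coord L 0 w)).
    by rewrite integral_fune_fin_num//; exact: Lfun2_integrable_mul.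
  by apply/funext => w /=; rewrite expr2.
congr EFin; transitivity (mom L L 0 0).
  by rewrite mxE /Ex; congr fine; apply: eq_integral => w _; rewrite expr2.
by rewrite mom_mull// mom_mulr// trmxK /dotv mulmxA.
Qed.

Lemma mom_possemidef n (V : T -> 'cV[R]_n) : square_integrable P V ->
  possemidefmx (mom V V).
Proof.
move=> V2; split; first by rewrite -mom_tr.
move=> u; rewrite -mulmxA -/(dotv _ _) -lee_fin -mom_dotv//.
by apply: integral_ge0 => w _; rewrite lee_fin sqr_ge0.
Qed.

Lemma meanvec_mulmx m n (B : 'M[R]_(m, n)) (V : T -> 'cV[R]_n) :
  square_integrable P V -> meanvec P (fun w => B *m V w) = B *m meanvec P V.
Proof.
move=> V2; apply/colP => i; rewrite -Ex_mean [RHS]mxE.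
rewrite (_ : Defs.coord _ i = fun w => \sum_k B i k * Defs.coord V k w); last first.
  by apply/funext => w; rewrite /Defs.coord mxE.
rewrite Ex_sum => [|k]; first by apply: eq_bigr => k _; rewrite Ex_mean.
by apply/Lfun1_integrable; apply: Lfun_subset12 (V2 k); exact: fin_num_measure.
Qed.

Lemma meanvec_add n (V W : T -> 'cV[R]_n) :
  square_integrable P V -> square_integrable P W ->
  meanvec P (fun w => V w + W w) = meanvec P V + meanvec P W.
Proof.
move=> V2 W2; apply/colP => i; rewrite [RHS]mxE -!Ex_mean /Ex.
have i1 (U : T -> 'cV[R]_n) : square_integrable P U ->
    P.-integrable setT (EFin \o Defs.coord U i).
  by move=> U2; apply/Lfun1_integrable; apply: Lfun_subset12 (U2 i); exact: fin_num_measure.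
rewrite -fineD ?integral_fune_fin_num//; [|exact: i1|exact: i1].
rewrite -integralD//; [|exact: i1|exact: i1].
by congr fine; apply: eq_integral => w _; rewrite /Defs.coord mxE EFinD.
Qed.

End moments.

Lemma measurable_preimageT d (T : measurableType d) d' (T' : measurableType d')
    (Y : T -> T') (B : set T') :
  measurable_fun setT Y -> measurable B -> measurable (Y @^-1` B).
Proof. by move=> mY mB; rewrite -[X in measurable X]setTI; exact: mY. Qed.

Lemma ae_bounded_integrable d (T : measurableType d) (R : realType)
    (P : probability T R) (f g : T -> R) (mu : R) :
  measurable_fun setT g -> {ae P, forall w, `|g w| <= mu} ->
  P.-integrable setT (EFin \o f) ->
  P.-integrable setT (EFin \o (fun w => f w * g w)).
Proof.
move=> mg gmu fi; have mf : measurable_fun setT f.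
  exact/measurable_EFinP/measurable_int/fi.
have imuf := integrableZl measurableT `|mu| fi.
apply/integrableP; split; first by apply/measurable_EFinP; exact: measurable_funM.
have /integrableP[_] := imuf; apply: le_lt_trans.
apply: ae_ge0_le_integral => //.
- by apply: measurableT_comp => //; apply/measurable_EFinP; exact: measurable_funM.
- by apply: measurableT_comp => //; apply: measurable_funeM; exact/measurable_EFinP.
- apply: filterS gmu => w gw _ /=; rewrite lee_fin !normrM mulrC normr_id.
  by rewrite ler_wpM2r// (le_trans gw)// ler_norm.
Qed.

(** Orthogonality is used twice. With [Z] observed, Z_j is orthogonal to 1_(X in B) - P(X in B) by
    independence; having mean zero, it then integrates to 0 over every event of [X]. With [X]
    observed, this gives E[X_i Z_j] = 0. *)
Lemma independent2_mom d (T : measurableType d) (R : realType) (P : probability T R)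
    (N M : nat) (X : T -> 'cV[R]_N) (Z : T -> 'cV[R]_M) :
  measurable_fun setT X -> measurable_fun setT Z -> independent2 P X Z ->
  square_integrable P X -> square_integrable P Z -> meanvec P Z = 0 ->
  mom P X Z = 0.
Proof.
move=> mX mZ indep X2 Z2 Z0; apply/matrixP => i j; rewrite !mxE /Ex.
have mXi : measurable_fun setT (fun x : 'cV[R]_N => x i 0) by exact: measurable_entry.
have mZj : measurable_fun setT (fun z : 'cV[R]_M => z j 0) by exact: measurable_entry.
have iZj : P.-integrable setT (EFin \o (fun w => Z w j 0)).
  by apply/Lfun1_integrable; apply: Lfun_subset12 (Z2 j); exact: fin_num_measure.
have EZj : (\int[P]_w (Z w j 0)%:E = 0)%E.
  rewrite -[LHS]fineK ?integral_fune_fin_num//; congr EFin.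
  by have := Ex_mean P Z j; rewrite Z0 mxE.
rewrite (_ : (\int[P]_w _ = 0)%E)//.
apply: (integral_comp_orthogonal (Y := X) (h := fun x => x i 0) (D := fun w => Z w j 0)) => //.
  exact: (Lfun2_integrable_mul (X2 i) (Z2 j)).
move=> B mB; pose D w : R := \1_(X @^-1` B) w - fine (P (X @^-1` B)).
have mXB := measurable_preimageT mX mB.
have i1 : P.-integrable setT (EFin \o \1_(X @^-1` B)).
  exact: integrable_indic.
have ic : P.-integrable setT (EFin \o cst (fine (P (X @^-1` B)))).
  exact: finite_measure_integrable_cst.
have mD : measurable_fun setT D by apply: measurable_funB => //; exact: measurable_indic.
have PXB : P (X @^-1` B) \is a fin_num by exact: fin_num_measure.
have D1 w : `|D w| <= 1.
  have p0 : 0 <= fine (P (X @^-1` B)) by rewrite fine_ge0.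
  have p1 : fine (P (X @^-1` B)) <= 1 by rewrite -lee_fin fineK// probability_le1.
  by rewrite /D indicE; case: (w \in _); rewrite /= ler_norml; apply/andP; split; lra.
have iZD : P.-integrable setT (EFin \o (fun w => Z w j 0 * D w)).
  by apply: (ae_bounded_integrable (mu := 1)) => //; exact: aeW.
have iD : P.-integrable setT (EFin \o D).
  by apply: eq_integrable (integrableB measurableT i1 ic) => // w _ /=; rewrite EFinB.
have ZD0 : (\int[P]_w (Z w j 0 * D w)%:E = 0)%E.
  apply: (integral_comp_orthogonal mZ mZj iD iZD) => B' mB'.
  have mZB' := measurable_preimageT mZ mB'.
  under eq_integral do rewrite /D EFinB.
  rewrite integralB//; [|exact: integrableS i1|exact: integrableS ic].
  rewrite integral_indic// integral_cst//= fineK// -indep// subee//.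
  by rewrite fin_num_measure//; exact: measurableI.
rewrite integral_mkcond (_ : _ \_ _ = fun w => ((Z w j 0 * D w)%:E +
    (fine (P (X @^-1` B)))%:E * (Z w j 0)%:E)%E); last first.
  apply/funext => w; rewrite patchE /D indicE -EFinM -EFinD.
  by case: (w \in _) => /=; congr EFin; ring.
rewrite integralD// ?ZD0 ?add0e ?integralZl// ?EZj ?mule0//.
exact: integrableZl.
Qed.

(** The difference of [U] and its conditional expectation integrates to 0 over the events of [Y];
    the almost sure bound on [V] supplies the integrability of h(Y) V. *)
Lemma condexp_orthogonal d (T : measurableType d) d' (T' : measurableType d')
    (R : realType) (P : probability T R) (Y : T -> T') (U V : T -> R) (mu : R)
    (h : T' -> R) :
  measurable_fun setT Y -> measurable_fun setT V ->
  is_condexp P Y (EFin \o U) (EFin \o V) ->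
  {ae P, forall w, `|V w| <= mu} ->
  P.-integrable setT (EFin \o U) ->
  measurable_fun setT h ->
  P.-integrable setT (EFin \o (fun w => h (Y w))) ->
  P.-integrable setT (EFin \o (fun w => h (Y w) * U w)) ->
  (\int[P]_w (h (Y w) * V w)%:E = \int[P]_w (h (Y w) * U w)%:E)%E.
Proof.
move=> mY mV [_ UV] Vmu iU mh ih ihU.
have iV : P.-integrable setT (EFin \o V).
  have i1 : P.-integrable setT (EFin \o cst (1 : R)) by exact: finite_measure_integrable_cst.
  apply: eq_integrable (ae_bounded_integrable mV Vmu i1) => // w _ /=.
  by rewrite mul1r.
have ihV := ae_bounded_integrable mV Vmu ih.
pose D w := U w - V w.
have iD : P.-integrable setT (EFin \o D).
  by apply: eq_integrable (integrableB measurableT iU iV) => // w _ /=; rewrite EFinB.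
have ihD : P.-integrable setT (EFin \o (fun w => h (Y w) * D w)).
  apply: eq_integrable (integrableB measurableT ihU ihV) => // w _ /=.
  by rewrite -EFinB mulrBr.
have := integral_comp_orthogonal mY mh iD ihD.
have -> : (\int[P]_w (h (Y w) * D w)%:E =
    \int[P]_w (h (Y w) * U w)%:E - \int[P]_w (h (Y w) * V w)%:E)%E.
  rewrite -integralB//; apply: eq_integral => w _.
  by rewrite -EFinB mulrBr.
move=> H; have /eqP : (\int[P]_w (h (Y w) * U w)%:E - \int[P]_w (h (Y w) * V w)%:E = 0)%E.
  apply: H => B mB; have mYB := measurable_preimageT mY mB.
  have iUB : P.-integrable (Y @^-1` B) (EFin \o U) by exact: integrableS iU.
  have iVB : P.-integrable (Y @^-1` B) (EFin \o V) by exact: integrableS iV.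
  under eq_integral do rewrite /D EFinB.
  have e : (\int[P]_(w in Y @^-1` B) (V w)%:E = \int[P]_(w in Y @^-1` B) (U w)%:E)%E.
    by apply: UV; exists B => //; rewrite setTI.
  by rewrite integralB// e subee// integral_fune_fin_num.
by rewrite sube_eq ?add0e ?integral_fune_fin_num// => /eqP ->.
Qed.

(** * Matrix algebra of least squares *)

Lemma col_mulmx (R : pzSemiRingType) (m n p : nat) (A : 'M[R]_(m, n)) (B : 'M[R]_(n, p)) j :
  col j (A *m B) = A *m col j B.
Proof. by rewrite !colE mulmxA. Qed.

Lemma posdef_inv (R : realType) (n : nat) (A : 'M[R]_n) :
  posdefmx A -> posdefmx (invmx A).
Proof.
move=> Apos; have Au := posdef_unit Apos; case: Apos => Asym Apos.
split=> [|v v0]; first by rewrite trmx_inv Asym.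
have e : v = A *m (invmx A *m v) by rewrite mulmxA mulmxV// mul1mx.
rewrite -mulmxA {1}e trmx_mul Asym; apply: Apos.
by apply: contra_neq v0 => u0; rewrite e u0 mulmx0.
Qed.

Lemma posdef_congr_add (R : realType) (m n : nat) (B : 'M[R]_(m, n)) (P : 'M[R]_m)
    (Q : 'M[R]_n) : possemidefmx P -> posdefmx Q -> posdefmx (B^T *m P *m B + Q).
Proof.
move=> [Psym P0] [Qsym Q0]; split.
  by rewrite linearD/= !trmx_mul trmxK Psym Qsym mulmxA.
move=> v v0; rewrite mulmxDr mulmxDl mxE ltr_wpDl ?Q0//.
by have := P0 (B *m v); rewrite trmx_mul !mulmxA.
Qed.

(* With [covmx P Y = A CXX A^T + CZZ], this is the orthogonality of the estimation
   error to the observation. *)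
Lemma Theta_star_orthogonal (R : realType) (N M : nat) (A : 'M[R]_(M, N))
    (CXX : 'M[R]_N) (CZZ : 'M[R]_M) : posdefmx CXX -> posdefmx CZZ ->
  (Theta_star A CXX CZZ)^T *m (A *m CXX *m A^T + CZZ) = CXX *m A^T.
Proof.
move=> Xpos Zpos; have Xu := posdef_unit Xpos; have Zu := posdef_unit Zpos.
have Hu : A^T *m invmx CZZ *m A + invmx CXX \in unitmx.
  apply/posdef_unit/posdef_congr_add; last exact: posdef_inv.
  exact/posdef_possemidef/posdef_inv.
rewrite /Theta_star trmxK; set H := A^T *m _ *m _ + _ in Hu *.
(* After multiplication by [H], both sides equal A^T C_ZZ^-1 A C_XX A^T + A^T. *)
rewrite -[RHS](mulKmx Hu) -!mulmxA; congr (_ *m _).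
rewrite /H mulmxDl !mulmxDr -!mulmxA mulVmx// mulmx1; congr (_ + _).
by rewrite mulKmx.
Qed.

Lemma frobenius_sqr (R : realType) (m n : nat) (A : 'M[R]_(m, n)) :
  frobenius A ^+ 2 = \tr (A^T *m A).
Proof.
rewrite sqr_sqrtr; last by apply: sumr_ge0 => i _; apply: sumr_ge0 => j _; rewrite sqr_ge0.
rewrite exchange_big; apply: eq_bigr => j _; rewrite mxE.
by apply: eq_bigr => i _; rewrite mxE expr2.
Qed.

Lemma frobenius_sum (R : realType) (m n : nat) (A : 'M[R]_(m, n)) :
  frobenius A ^+ 2 = \sum_i \sum_j A i j ^+ 2.
Proof.
by rewrite sqr_sqrtr//; apply: sumr_ge0 => i _; apply: sumr_ge0 => j _; rewrite sqr_ge0.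
Qed.

Lemma frobenius_sqn (R : realType) (m n : nat) (A : 'M[R]_(m, n)) :
  frobenius A ^+ 2 = \sum_j sqn (col j A).
Proof.
rewrite frobenius_sum exchange_big; apply: eq_bigr => j _.
by apply: eq_bigr => i _; rewrite mxE.
Qed.

Lemma frobenius_orth (R : realType) (m n : nat) (A : 'M[R]_(m, n)) (U : 'M[R]_n) :
  U^T *m U = 1%:M -> frobenius (A *m U) ^+ 2 = frobenius A ^+ 2.
Proof.
move=> UU; have UU' : U *m U^T = 1%:M by exact: mulmx1C.
by rewrite !frobenius_sqr trmx_mul -mulmxA mxtrace_mulC -!mulmxA UU' mulmx1.
Qed.

Lemma frobenius_subZ (R : comPzRingType) (m n : nat) (r a : 'M[R]_(m, n)) (e : R) :
  \tr ((r - e *: a)^T *m (r - e *: a)) =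
  \tr (r^T *m r) + (e ^+ 2 * \tr (a^T *m a) - 2 * e * \tr (a^T *m r)).
Proof.
have -> : (r - e *: a)^T = r^T - e *: a^T by rewrite linearB/= linearZ.
rewrite mulmxBl !mulmxBr -!scalemxAr -!scalemxAl -!scaleNr !mxtraceD -!scaleN1r !mxtraceZ
  !mxtraceD !mxtraceZ.
have -> : \tr (r^T *m a) = \tr (a^T *m r) by rewrite -mxtrace_tr trmx_mul trmxK.
by rewrite expr2; ring.
Qed.

(** Perturbing the minimizer by - e G, with G = Y^T (Y Theta - X), gives e^2 h - 2 e g >= 0 for
    every e, where g = |G|^2 and h = |Y G|^2. *)
Lemma normal_equations (R : realType) (n N M : nat) (Y : 'M[R]_(n, M))
    (X : 'M[R]_(n, N)) (Theta : 'M[R]_(M, N)) :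
  (0 < n)%N -> least_squares Y X Theta -> Y^T *m (Y *m Theta - X) = 0.
Proof.
move=> n0 ls; set r := Y *m Theta - X; set G := Y^T *m r.
have n1 : 0 < n%:R^-1 :> R by rewrite invr_gt0 ltr0n.
set g := frobenius G ^+ 2; set h := frobenius (Y *m G) ^+ 2.
have g0 : 0 <= g by exact: sqr_ge0.
have h0 : 0 <= h by exact: sqr_ge0.
have ls' e : 0 <= e ^+ 2 * h - 2 * e * g.
  have := ls (Theta - e *: G); rewrite ler_pM2l// !frobenius_sqr.
  have -> : Y *m (Theta - e *: G) - X = r - e *: (Y *m G).
    by rewrite mulmxBr addrAC -scalemxAr.
  rewrite -/r -subr_ge0.
  rewrite [X in X - _](_ : _ = \tr (r^T *m r) + (e ^+ 2 * h - 2 * e * g)).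
    by rewrite addrAC subrr add0r.
  have Gg : \tr ((Y *m G)^T *m r) = g by rewrite /g frobenius_sqr trmx_mul -mulmxA.
  by rewrite frobenius_subZ Gg /h frobenius_sqr.
have h1 : 0 < 1 + h by lra.
(* For g > 0 any e in (0, 2 g / h) makes this polynomial negative; the denominator 1 + h also covers
   h = 0. *)
have := ls' (g / (1 + h)).
have -> : (g / (1 + h)) ^+ 2 * h - 2 * (g / (1 + h)) * g =
    - (g ^+ 2 * (2 + h) / (1 + h) ^+ 2) by field; lra.
rewrite oppr_ge0 pmulr_lle0 ?invr_gt0 ?exprn_gt0// pmulr_lle0; last by lra.
move=> g2; have /eqP : g ^+ 2 = 0 by apply/eqP; rewrite eq_le g2 sqr_ge0.
rewrite expf_eq0/= => /eqP ; rewrite /g frobenius_sqn => /psumr_eq0P G0.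
apply/matrixP => i j; have /eqP : sqn (col j G) = 0.
  by apply: G0 => // k _; exact: sqn_ge0.
by rewrite sqn_eq0 => /eqP/colP/(_ i); rewrite !mxE.
Qed.

(* Defined through the adjugate so as to be a measurable function of [W]; it is the
   pseudo-inverse when [W] is injective. *)
Definition pinv (R : realType) (n M : nat) (W : 'M[R]_(n, M)) : 'M[R]_(M, n) :=
  (\det (W^T *m W))^-1 *: (\adj (W^T *m W) *m W^T).

(** The inverse is written as x (x^2)^(-1), with a measurable real power of a nonnegative base; at 0
    both sides are 0 by the convention on inverses. *)
Lemma measurable_inv_comp (R : realType) d (T : measurableType d) (f : T -> R) :
  measurable_fun setT f -> measurable_fun setT (fun w => (f w)^-1).
Proof.
move=> mf; rewrite (_ : (fun w => _) = fun w => f w * (f w ^+ 2) `^ (-1)).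
  apply: measurable_funM => //.
  apply: (measurableT_comp (f := fun x : R => x `^ (-1)) (g := fun w => f w ^+ 2)).
    exact: measurable_powR.
  exact: measurable_funX.
apply/funext => w; rewrite powR_inv1 ?sqr_ge0//.
have [->|f0] := eqVneq (f w) 0; first by rewrite mul0r invr0.
by rewrite expr2 invfM mulrA divff// mul1r.
Qed.

Lemma measurable_pinv (R : realType) d (T : measurableType d) (n M : nat)
    (W : T -> 'M[R]_(n, M)) :
  measurable_fun setT W -> measurable_fun setT (fun w => pinv (W w)).
Proof.
move=> mW; have mWt := measurable_trmx mW; have mG := measurable_mulmx mWt mW.
apply: measurable_scalemx; first exact/measurable_inv_comp/measurable_det.
by apply: measurable_mulmx => //; exact: measurable_adjugate.
Qed.

Section pinv.
Context (R : realType) (n M : nat) (W : 'M[R]_(n, M)) (k : R).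
Hypothesis k_gt0 : 0 < k.
Hypothesis kW : forall v, k * sqn v <= sqn (W *m v).

Let Wu : W^T *m W \in unitmx := gram_unit k_gt0 kW.

Lemma pinvE : pinv W = invmx (W^T *m W) *m W^T.
Proof. by rewrite /pinv /invmx Wu scalemxAl. Qed.

Lemma pinvK : pinv W *m W = 1%:M.
Proof. by rewrite pinvE -mulmxA mulVmx. Qed.

Lemma least_squares_pinv N (B : 'M[R]_M) (X : 'M[R]_(n, N)) Theta :
  (0 < n)%N -> B \in unitmx -> least_squares (W *m B) X Theta ->
  B *m Theta = pinv W *m X.
Proof.
move=> n0 Bu /(normal_equations n0); rewrite trmx_mul -!mulmxA.
rewrite -unitmx_tr in Bu; move/(congr1 (mulmx (invmx B^T))).
rewrite mulKmx// mulmx0 mulmxBr => /eqP; rewrite subr_eq0 => /eqP e.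
by rewrite pinvE -mulmxA -e (mulmxA W^T) mulKmx.
Qed.

(** The columns of W^+ B solve the Gram equations with right-hand side W^T B. This is what allows
    the bias to be estimated through a sum over the samples. *)
Lemma frobenius_pinv N (B : 'M[R]_(n, N)) :
  frobenius (pinv W *m B) ^+ 2 <= k^-1 ^+ 2 * frobenius (W^T *m B) ^+ 2.
Proof.
rewrite !frobenius_sqn mulr_sumr; apply: ler_sum => j _.
apply: (gram_solution k_gt0 kW (a := col j (pinv W *m B)) _).2.
rewrite -col_mulmx pinvE; congr col.
  by rewrite -[invmx _ *m _ *m _]mulmxA mulKVmx.
Qed.

(** As W^+ (W^+)^T = (W^T W)^-1, the left-hand side is the trace of D Z^T (W^T W)^-1 Z with D =
    [diag_mx d], and (W^T W)^-1 <= 1 / k applies to each column of [Z]. *)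
Lemma pinv_noise N (Uo : 'M[R]_N) (d : 'rV[R]_N) (Z : 'M[R]_(M, N)) :
  Uo^T *m Uo = 1%:M -> (forall j, 0 <= d 0 j) ->
  \sum_i dotv (col i (Uo *m Z^T *m pinv W))
     (Uo *m diag_mx d *m Uo^T *m col i (Uo *m Z^T *m pinv W)) <=
  k^-1 * \sum_j d 0 j * sqn (col j Z).
Proof.
move=> UU d0; set K := _ *m pinv W.
have -> : \sum_i dotv (col i K) (Uo *m diag_mx d *m Uo^T *m col i K) =
    \tr (K^T *m (Uo *m diag_mx d *m Uo^T *m K)).
  apply: eq_bigr => i _; rewrite dotvE mxE; apply: eq_bigr => a _.
  by rewrite -col_mulmx !mxE.
have -> : K^T *m (Uo *m diag_mx d *m Uo^T *m K) =
    (pinv W)^T *m Z *m diag_mx d *m Z^T *m pinv W.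
  rewrite /K !trmx_mul trmxK !mulmxA.
  by rewrite -[_ *m Uo^T *m Uo]mulmxA UU mulmx1 -[_ *m Uo^T *m Uo]mulmxA UU mulmx1.
rewrite -!mulmxA mxtrace_mulC !mulmxA.
have -> : Z *m diag_mx d *m Z^T *m pinv W *m (pinv W)^T =
    Z *m (diag_mx d *m (Z^T *m (invmx (W^T *m W) *m 1%:M))).
  rewrite -!mulmxA {2}pinvE trmx_mul trmxK trmx_inv trmx_mul trmxK.
  by rewrite [pinv W *m _]mulmxA pinvK mul1mx mulmx1.
rewrite mulmx1 mxtrace_mulC /mxtrace mulr_sumr; apply: ler_sum => j _.
rewrite -!mulmxA mul_diag_mx mxE mulrCA.
apply: ler_wpM2l => //.
have [+ _] := gram_solution k_gt0 kW (a := invmx (W^T *m W) *m col j Z)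
  (u := col j Z) (mulKVmx Wu _).
rewrite dotvC; apply: le_trans; rewrite /dotv -col_mulmx !mxE.
by apply: ler_sum => l _; rewrite !mxE.
Qed.
End pinv.

(** * Transfer to the law of the samples *)

Section equal_laws.
Context d1 (T1 : measurableType d1) d2 (T2 : measurableType d2)
  d' (T' : measurableType d') (R : realType)
  (P1 : probability T1 R) (P2 : probability T2 R) (Y1 : T1 -> T') (Y2 : T2 -> T')
  (k : nat) (v : T' -> 'cV[R]_k).
Hypothesis mY1 : measurable_fun setT Y1.
Hypothesis mY2 : measurable_fun setT Y2.
Hypothesis eq_law : forall B, measurable B -> P1 (Y1 @^-1` B) = P2 (Y2 @^-1` B).
Hypothesis mv : measurable_fun setT v.

Lemma eq_law_expectation (h : 'cV[R]_k -> R) : measurable_fun setT h ->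
  ('E_P1[fun w => h (v (Y1 w))] = 'E_P2[fun w => h (v (Y2 w))])%E.
Proof.
move=> mh; rewrite unlock; apply: (eq_law_integral mY1 mY2 eq_law (H := fun y => h (v y))).
exact: measurableT_comp mh mv.
Qed.

Lemma eq_law_meanvec :
  meanvec P1 (fun w => v (Y1 w)) = meanvec P2 (fun w => v (Y2 w)).
Proof.
apply/colP => i; rewrite !mxE; congr fine.
by apply: (eq_law_expectation (h := fun x => x i 0)); exact: measurable_entry.
Qed.

Lemma eq_law_covmx :
  covmx P1 (fun w => v (Y1 w)) = covmx P2 (fun w => v (Y2 w)).
Proof.
apply/matrixP => i j; rewrite !mxE; congr fine.
have E l : fine 'E_P1[Defs.coord (fun w => v (Y1 w)) l] =
    fine 'E_P2[Defs.coord (fun w => v (Y2 w)) l].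
  by have := congr1 (fun u : 'cV[R]_k => u l 0) eq_law_meanvec; rewrite !mxE.
rewrite [in LHS]unlock [in RHS]unlock !E.
apply: (eq_law_expectation (h := fun x => (x i 0 - _) * (x j 0 - _))).
by apply: measurable_funM; apply: measurable_funB => //; exact: measurable_entry.
Qed.

Lemma eq_law_subgaussian_vec (rho : R) :
  subgaussian_vec P2 rho (fun w => v (Y2 w)) ->
  subgaussian_vec P1 rho (fun w => v (Y1 w)).
Proof.
move=> sub a a1; have [rho0 suba] := sub a a1; split=> // l.
have mdot : measurable_fun setT (fun x : 'cV[R]_k => (a^T *m x) 0 0).
  by apply: (measurable_dotv (f := fun=> a) (g := id)).
rewrite (eq_law_expectation mdot).
rewrite (eq_law_expectation (h := fun x => expR (l * ((a^T *m x) 0 0 - _)))).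
  exact: suba.
apply: measurable_expR_comp; apply: measurable_funM => //.
exact: measurable_funB.
Qed.
End equal_laws.

(* [singular_value_constant] is applied to the law of [W], so that the event it
   provides is an event for the matrix [W w]. *)
Lemma singular_value_event (R : realType) (c : R) (n M : nat) (rho t : R)
    d (S : measurableType d) (Q : probability S R) (W : S -> 'M[R]_(n, M)) :
  singular_value_constant c -> (0 < M)%N -> 0 <= t -> measurable_fun setT W ->
  mutually_independent Q (fun i w => (row i (W w))^T) ->
  (forall i, meanvec Q (fun w => (row i (W w))^T) = 0) ->
  (forall i, covmx Q (fun w => (row i (W w))^T) = 1%:M) ->
  (forall i, subgaussian_vec Q rho (fun w => (row i (W w))^T)) ->
  exists A : set 'M[R]_(n, M), [/\ measurable A,
    ((1 - 2 * expR (- t))%:E <= Q (W @^-1` A))%E &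
    forall B, A B -> Num.sqrt n%:R - c * rho ^+ 2 * (Num.sqrt M%:R + Num.sqrt t)
      <= sigma_min B].
Proof.
move=> cP M0 t0 mW indep W0 W1 Wsub.
pose Wf : {RV Q >-> 'M[R]_(n, M)} := HB.pack W (isMeasurableFun.Build _ _ _ _ _ mW).
have mrow i : measurable_fun setT (fun B : 'M[R]_(n, M) => (row i B)^T).
  apply/measurable_mxP => a b.
  rewrite (_ : (fun w => _) = fun B : 'M[R]_(n, M) => B i a).
    exact: measurable_entry.
  by apply/funext => B; rewrite !mxE.
have eql (B : set 'M[R]_(n, M)) : measurable B ->
  distribution Q Wf (id @^-1` B) = Q (W @^-1` B) by [].
have [] := cP n M rho _ _ (distribution Q Wf) id M0 mrow _ _ _ _ t t0.
- by move=> J B mB; exact: indep.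
- move=> i; rewrite -(W0 i).
  exact: (eq_law_meanvec (Y1 := id) (Y2 := W) (v := fun B => (row i B)^T)).
- move=> i; rewrite -(W1 i).
  exact: (eq_law_covmx (Y1 := id) (Y2 := W) (v := fun B => (row i B)^T)).
- move=> i; apply: (eq_law_subgaussian_vec (Y1 := id) (Y2 := W)
    (v := fun B => (row i B)^T)) (Wsub i) => //.
- by move=> A [mA AS QA]; exists A; split=> // B /AS[].
Qed.

(** * Population moments and exponential bounds *)

Section population.
Context d (T : measurableType d) (R : realType) (P : probability T R).

Lemma observation_moments (N M : nat) (X : T -> 'cV[R]_N) (Z : T -> 'cV[R]_M)
    (A : 'M[R]_(M, N)) :
  measurable_fun setT X -> measurable_fun setT Z -> independent2 P X Z ->
  square_integrable P X -> square_integrable P Z ->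
  meanvec P X = 0 -> meanvec P Z = 0 ->
  covmx P X \in unitmx -> covmx P Z \in unitmx ->
  let Y := fun w => A *m X w + Z w in
  [/\ square_integrable P Y, meanvec P Y = 0, mom P Y Y = covmx P Y,
      posdefmx (covmx P Y) &
      mom P (fun w => X w - (Theta_star A (covmx P X) (covmx P Z))^T *m Y w) Y = 0].
Proof.
move=> mX mZ indep X2 Z2 X0 Z0 Xu Zu Y.
have XZ : mom P X Z = 0 by exact: independent2_mom.
have ZX : mom P Z X = 0 by rewrite mom_tr XZ trmx0.
have AX2 : square_integrable P (fun w => A *m X w) by exact: square_integrable_mulmx.
have Y2 : square_integrable P Y by exact: square_integrable_add.
have Y0 : meanvec P Y = 0.
  by rewrite meanvec_add// meanvec_mulmx// X0 Z0 mulmx0 addr0.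
have CY := covmx_mom Y2 Y0.
have XX := covmx_mom X2 X0; have ZZ := covmx_mom Z2 Z0.
have XY : mom P X Y = covmx P X *m A^T.
  by rewrite mom_addr// mom_mulr// XZ addr0 XX.
have YY : mom P Y Y = A *m covmx P X *m A^T + covmx P Z.
  rewrite mom_addl// mom_mull// XY mulmxA; congr (_ + _).
  by rewrite mom_addr// mom_mulr// ZX mul0mx add0r ZZ.
have Xpos : posdefmx (covmx P X).
  by apply: possemidef_unit_posdef => //; rewrite XX; exact: mom_possemidef.
have Zpos : posdefmx (covmx P Z).
  by apply: possemidef_unit_posdef => //; rewrite ZZ; exact: mom_possemidef.
split=> //.
  rewrite CY YY -{1}[A]trmxK; apply: posdef_congr_add => //.
  exact: posdef_possemidef.
set Th := Theta_star _ _ _.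
have -> : (fun w => X w - Th^T *m Y w) = (fun w => X w + (- Th^T) *m Y w).
  by apply/funext => w; rewrite mulNmx.
rewrite mom_addl//; last exact: square_integrable_mulmx.
by rewrite mom_mull// mulNmx YY Theta_star_orthogonal// XY subrr.
Qed.

Lemma expected_sqr_error (M N : nat) (V : T -> 'cV[R]_M) (S : 'M[R]_M)
    (D : 'M[R]_(M, N)) :
  measurable_fun setT V -> square_integrable P V -> S^T = S -> S *m S = mom P V V ->
  ('E_P[fun w => (norm2 (D^T *m V w) ^+ 2)%R] = (frobenius (S *m D) ^+ 2)%:E)%E.
Proof.
move=> mV V2 Ssym SS; rewrite unlock.
under eq_integral => w _.
  rewrite norm2_sqr (_ : sqn _ = \sum_j dotv (col j D) (V w) ^+ 2); last first.
    apply: eq_bigr => j _; congr (_ ^+ 2); rewrite dotvE mxE.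
    by apply: eq_bigr => i _; rewrite !mxE.
  rewrite -sumEFin; over.
rewrite ge0_integral_sum//; last 2 first.
- move=> j; apply/measurable_EFinP/measurable_funX.
  exact: (measurable_dotv (f := fun=> col j D)).
- by move=> j w _; rewrite lee_fin sqr_ge0.
rewrite frobenius_sqn -sumEFin; apply: eq_bigr => j _.
by rewrite mom_dotv// col_mulmx -SS -mulmxA dotv_adj Ssym -sqnE.
Qed.

Lemma subgaussian_vec_mgf (n : nat) (rho : R) (V : T -> 'cV[R]_n) :
  square_integrable P V -> meanvec P V = 0 -> subgaussian_vec P rho V ->
  forall th, (\int[P]_w (expR (dotv th (V w)))%:E <=
    (expR (rho ^+ 2 * sqn th / 2))%:E)%E.
Proof.
move=> V2 V0 sub th; have [->|th0] := eqVneq th 0.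
  rewrite (_ : (fun w => _) = cst 1%E); last first.
    by apply/funext => w; rewrite /dotv trmx0 mul0mx mxE expR0.
  rewrite integral_prob_cst /sqn big1 ?mulr0 ?mul0r ?expR0// => i _.
  by rewrite mxE expr0n.
have nth : 0 < norm2 th.
  rewrite lt_neqAle sqrtr_ge0 andbT eq_sym; apply: contra_neq th0 => e.
  by apply/eqP; rewrite -sqn_eq0 -norm2_sqr e expr0n.
pose a := (norm2 th)^-1 *: th.
have a1 : norm2 a = 1.
  by rewrite /norm2 -/(sqn a) sqnZ -norm2_sqr exprVn mulVf ?sqrtr1// expf_neq0// gt_eqF.
have [_ /(_ (norm2 th))] := sub a a1.
rewrite (_ : fine _ = 0); last first.
  have := meanvec_mulmx a^T V2; rewrite V0 mulmx0 => /colP/(_ 0).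
  by rewrite !mxE.
rewrite norm2_sqr unlock; apply: le_trans; rewrite le_eqVlt; apply/orP; left; apply/eqP.
apply: eq_integral => w _; rewrite subr0 -/(dotv a (V w)) /a dotvZl mulrA.
by rewrite divff ?mul1r// gt_eqF.
Qed.

Lemma is_condexp_le d' (T' : measurableType d') (Y : T -> T') (U : T -> \bar R)
    (V : T -> \bar R) (k : R) (B : set T') :
  measurable_fun setT Y -> measurable B -> is_condexp P Y U V -> 0 <= k ->
  {ae P, forall w, (V w <= k%:E)%E} ->
  (\int[P]_(w in Y @^-1` B) U w <= \int[P]_(w in Y @^-1` B) k%:E)%E.
Proof.
move=> mY mB [mV UV] k0 Vk; have mYB := measurable_preimageT mY mB.
rewrite -UV; last by exists B => //; rewrite setTI.
have mV' : measurable_fun setT V.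
  move=> _ D /mV[E mE <-]; rewrite setTI setTI; exact: measurable_preimageT.
(* [V] is only bounded above, so its negative part is dropped before the comparison. *)
rewrite integralE; apply: (@le_trans _ _ (\int[P]_(w in Y @^-1` B) V^\+%E w)%E).
  by rewrite geeDl// oppe_le0; apply: integral_ge0 => w _.
apply: ae_ge0_le_integral => //.
  by apply: measurable_funTS; exact: measurable_funepos.
by apply: filterS Vk => w Vw _; rewrite funeposE ge_max Vw lee_fin.
Qed.

Lemma conditional_mgf (N M : nat) (Y : T -> 'cV[R]_M) (F : T -> 'cV[R]_N)
    (C : 'M[R]_N) (G : 'cV[R]_N -> T -> \bar R) :
  measurable_fun setT Y -> posdefmx C ->
  (forall alpha : 'cV[R]_N, is_condexp P Y
     (fun w => (expR ((alpha^T *m invmx (sqrtmx C) *m F w) 0 0))%:E) (G alpha)) ->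
  {ae P, forall w, forall alpha : 'cV[R]_N,
     (G alpha w <= (expR (norm2 alpha ^+ 2 / 2))%:E)%E} ->
  forall (b : 'cV[R]_N) (B : set 'cV[R]_M), measurable B ->
  (\int[P]_(w in Y @^-1` B) (expR (dotv b (F w)))%:E <=
   \int[P]_(w in Y @^-1` B) (expR (dotv b (C *m b) / 2))%:E)%E.
Proof.
move=> mY Cpos Gcond Gle b B mB; have [[Ssym _] SS] := sqrtmxP (posdef_possemidef Cpos).
have Su : sqrtmx C \in unitmx.
  by have := posdef_unit Cpos; rewrite -{1}SS unitmx_mul => /andP[].
(* With alpha = C^(1/2) b, the exponent alpha^T C^(-1/2) F is b.F, and |alpha|^2 = b.(C b). *)
have := is_condexp_le mY mB (Gcond (sqrtmx C *m b)) (expR_ge0 _) _.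
rewrite trmx_mul Ssym mulmxK//.
have -> : dotv b (C *m b) = norm2 (sqrtmx C *m b) ^+ 2.
  by rewrite norm2_sqr sqnE -{1}SS -mulmxA dotv_adj Ssym.
by apply; apply: filterS Gle => w; exact.
Qed.

Lemma is_condexp_vec_factor (N : nat) d' (T' : measurableType d') (Y : T -> T')
    (U V : T -> 'cV[R]_N) : is_condexp_vec P Y U V ->
  exists2 g : T' -> 'cV[R]_N, measurable_fun setT g & forall w, V w = g (Y w).
Proof.
move=> UV.
have /choice[g gP] : forall i : 'I_N, exists g : T' -> R,
    measurable_fun setT g /\ forall w, V w i 0 = g (Y w).
  by move=> i; have [g mg gV] := sigma_algebra_of_factor (UV i).1; exists g.
exists (fun y => \col_i g i y).
  apply/measurable_mxP => i j; rewrite (_ : (fun w => _) = g i); first exact: (gP i).1.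
  by apply/funext => y; rewrite mxE.
by move=> w; apply/colP => i; rewrite mxE (gP i).2.
Qed.
End population.

(** The instance of [sample_subgaussian] in which nothing is observed: the response is [tt], the
    direction is constant and the matrix is sigma2 times the identity. *)
Lemma iid_sum_mgf d (S : measurableType d) d1 (V : measurableType d1) (R : realType)
    (Q : probability S R) (n k : nat) (U : 'I_n -> S -> V) (q : V -> 'cV[R]_k) (sigma2 : R) :
  (forall i, measurable_fun setT (U i)) -> mutually_independent Q U ->
  measurable_fun setT q ->
  (forall i th, \int[Q]_w (expR (dotv th (q (U i w))))%:E <=
    (expR (sigma2 * sqn th / 2))%:E)%E ->
  forall th, (\int[Q]_w (expR (dotv th (\sum_i q (U i w))))%:E <=
    (expR (n%:R * sigma2 * sqn th / 2))%:E)%E.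
Proof.
move=> mU indep mq sub th.
have dotC b : dotv b ((sigma2%:M : 'M[R]_k) *m b) = sigma2 * sqn b.
  by rewrite mul_scalar_mx dotvZr -sqnE.
have mdot b i : measurable_fun setT (fun w => dotv b (q (U i w))).
  by apply: (measurable_dotv (f := fun=> b)) => //; exact: measurableT_comp mq (mU i).
have one i (b : unit -> 'cV[R]_k) (H : unit -> R) :
    measurable_fun setT b -> measurable_fun setT H -> (forall z, 0 <= H z) ->
    (\int[Q]_w (H tt * expR (dotv (b tt) (q (U i w))
      - dotv (b tt) ((sigma2%:M : 'M[R]_k) *m b tt) / 2))%:E <= \int[Q]_w (H tt)%:E)%E.
  move=> _ _ H0; rewrite dotC integral_prob_cst.
  rewrite (_ : (fun w => _) = fun w => (H tt * expR (- (sigma2 * sqn (b tt) / 2)) *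
      expR (dotv (b tt) (q (U i w))))%:E); last first.
    by apply/funext => w; rewrite addrC expRD mulrA.
  rewrite ge0_integral_realZl//; last first.
  - exact: measurable_expR_comp.
  - by rewrite mulr_ge0 ?expR_ge0.
  apply: (@le_trans _ _ ((H tt * expR (- (sigma2 * sqn (b tt) / 2)))%:E *
      (expR (sigma2 * sqn (b tt) / 2))%:E)%E).
    by apply: lee_wpmul2l => //; rewrite lee_fin mulr_ge0 ?expR_ge0.
  by rewrite -EFinM lee_fin -(mulrA (H tt)) -expRD addNr expR0 mulr1.
have := sample_subgaussian (T' := unit) (y := fun=> tt) mU indep (measurable_cst _) mq one
  (h := fun=> 1) (b := fun _ _ => th) (measurable_cst _) (fun=> ler01)
  (fun _ => measurable_cst _).
rewrite integral_prob_cst => le1.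
rewrite (_ : (fun w => _) = fun w => (expR (n%:R * sigma2 * sqn th / 2) *
   (1 * expR (\sum_(i < n) (dotv th (q (U i w)) - dotv th ((sigma2%:M : 'M[R]_k) *m th) / 2))))%:E).
  rewrite ge0_integral_realZl//; last first.
    apply: measurable_funM => //; apply: measurable_expR_comp.
    by apply: measurable_sum => i; exact: measurable_funB.
  by rewrite -[leRHS]mule1 lee_wpmul2l// lee_fin expR_ge0.
apply/funext => w; rewrite mul1r -expRD; congr (expR _)%:E.
rewrite dotC big_split/= sumr_const card_ord -mulr_natl.
have -> : \sum_(i < n) dotv th (q (U i w)) = dotv th (\sum_i q (U i w)).
  by rewrite /dotv mulmx_sumr summxE.
by ring.
Qed.

(** * The noise term of the regression *)

(** Pairing the entries of K F Uo with those of [Z] tests the i-th row of [F], that is the i-th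
    sample, in the direction of the i-th column of Uo Z^T K. *)
Lemma trace_pairing (R : comPzRingType) (n M N : nat) (Z : 'M[R]_(M, N)) (K : 'M[R]_(M, n))
    (F : 'M[R]_(n, N)) (Uo : 'M[R]_N) :
  \sum_p Z p.1 p.2 * (K *m F *m Uo) p.1 p.2 =
  \sum_i dotv (col i (Uo *m Z^T *m K)) (row i F)^T.
Proof.
transitivity (\tr (Z^T *m (K *m F *m Uo))).
  rewrite -(pair_bigA _ (fun l j => Z l j * (K *m F *m Uo) l j))/= exchange_big.
  by apply: eq_bigr => j _; rewrite [RHS]mxE; apply: eq_bigr => l _; rewrite [Z^T _ _]mxE.
rewrite mulmxA mxtrace_mulC !mulmxA mxtrace_mulC; apply: eq_bigr => i _.
by rewrite dotvE mxE; apply: eq_bigr => a _; rewrite !mxE mulrC.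
Qed.

Lemma measurable_col (R : realType) d (T : measurableType d) (m n : nat) (j : 'I_n)
    (f : T -> 'M[R]_(m, n)) :
  measurable_fun setT f -> measurable_fun setT (fun w => col j (f w)).
Proof.
move=> mf; apply/measurable_mxP => a b; rewrite (_ : (fun w => _) = fun w => f w a j).
  exact: measurableT_comp (measurable_entry _ _) mf.
by apply/funext => w; rewrite mxE.
Qed.

Lemma measurable_frobenius_sqr (R : realType) d (T : measurableType d) (m n : nat)
    (f : T -> 'M[R]_(m, n)) :
  measurable_fun setT f -> measurable_fun setT (fun w => frobenius (f w) ^+ 2).
Proof.
move=> mf; under eq_fun do rewrite frobenius_sum.
apply: measurable_sum => i; apply: measurable_sum => j; apply: measurable_funX.
exact: measurableT_comp (measurable_entry _ _) mf.
Qed.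

Section regression.
Context d (S : measurableType d) (R : realType) (Q : probability S R).
Variables (n N M : nat) (U : 'I_n -> S -> 'cV[R]_N * 'cV[R]_M).
Variables (Theta : 'M[R]_(M, N)) (g : 'cV[R]_M -> 'cV[R]_N) (Si : 'M[R]_M).

Let response (w : S) : n.-tuple 'cV[R]_M := [tuple (U i w).2 | i < n].

(** [Si] stands for C_YY^(-1/2), so this is the whitened sample matrix. Like [bias_mx] it takes the
    tuple of responses as argument, since the directions and weights of [sample_subgaussian] are
    functions of that tuple. *)
Definition design (y : n.-tuple 'cV[R]_M) : 'M[R]_(n, M) :=
  \matrix_(i, j) (Si *m tnth y i) j 0.

Definition bias_mx (y : n.-tuple 'cV[R]_M) : 'M[R]_(n, N) :=
  \matrix_(i, a) g (tnth y i) a 0.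

Definition residual_mx (w : S) : 'M[R]_(n, N) :=
  \matrix_(i, a) ((U i w).1 - Theta^T *m (U i w).2) a 0.

Hypothesis mU : forall i, measurable_fun setT (U i).
Hypothesis mg : measurable_fun setT g.

Lemma measurable_design : measurable_fun setT design.
Proof.
apply/measurable_mxP => i j.
rewrite (_ : (fun w => _) = fun y : n.-tuple 'cV[R]_M => (Si *m tnth y i) j 0).
  apply: (measurableT_comp (measurable_entry _ _)).
  by apply: (measurable_mulmx (f := fun=> Si)) => //; exact: measurable_tnth.
by apply/funext => y; rewrite mxE.
Qed.

Lemma measurable_bias_mx : measurable_fun setT bias_mx.
Proof.
apply/measurable_mxP => i j.
rewrite (_ : (fun w => _) = fun y : n.-tuple 'cV[R]_M => g (tnth y i) j 0).
  apply: (measurableT_comp (measurable_entry _ _)).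
  by apply: measurableT_comp mg _; exact: measurable_tnth.
by apply/funext => y; rewrite mxE.
Qed.

Let mU1 i : measurable_fun setT (fun w => (U i w).1).
Proof. exact: measurableT_comp measurable_fst (mU i). Qed.

Let mU2 i : measurable_fun setT (fun w => (U i w).2).
Proof. exact: measurableT_comp measurable_snd (mU i). Qed.

Lemma measurable_residual_mx : measurable_fun setT residual_mx.
Proof.
apply/measurable_mxP => i j.
rewrite (_ : (fun w => _) = fun w => ((U i w).1 + (- Theta^T) *m (U i w).2) j 0).
  apply: (measurableT_comp (measurable_entry _ _)).
  apply: measurable_addmx => //.
  exact: (measurable_mulmx (f := fun=> - Theta^T)).
by apply/funext => w; rewrite mxE mulNmx.
Qed.

Lemma design_bias_col (y : n.-tuple 'cV[R]_M) j :
  col j ((design y)^T *m bias_mx y) = \sum_i g (tnth y i) j 0 *: (Si *m tnth y i).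
Proof.
apply/colP => l; rewrite summxE !mxE; apply: eq_bigr => i _.
by rewrite 2!mxE mulrC !mxE.
Qed.

Lemma measurable_response : measurable_fun setT response.
Proof.
apply/measurable_fun_tnthP => i.
rewrite (_ : _ \o _ = (fun w => (U i w).2))//.
by apply/funext => w /=; rewrite tnth_mktuple.
Qed.

Let f (u : 'cV[R]_N * 'cV[R]_M) : 'cV[R]_N := u.1 - Theta^T *m u.2 - g u.2.

Lemma measurable_sample_error : measurable_fun setT f.
Proof.
rewrite (_ : f = fun u => u.1 + (- Theta^T) *m u.2 + (- 1%:M) *m g u.2).
  apply: measurable_addmx; first apply: measurable_addmx => //.
    exact: (measurable_mulmx (f := fun=> - Theta^T)).
  apply: (measurable_mulmx (f := fun=> - 1%:M)) => //.
  exact: measurableT_comp mg measurable_snd.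
by apply/funext => u; rewrite /f !mulNmx mul1mx.
Qed.

Hypothesis indep : mutually_independent Q U.
Variables (Uo : 'M[R]_N) (lam : 'rV[R]_N) (L k beta t : R).
Hypothesis UU : Uo^T *m Uo = 1%:M.
Hypothesis lam_ge0 : forall j, 0 <= lam 0 j.
Hypothesis lam_le : forall j, lam 0 j <= L.
Hypothesis L_ge0 : 0 <= L.
Hypothesis k_gt0 : 0 < k.
Hypothesis t_ge0 : 0 <= t.

Hypothesis one_sample : forall (k : 'I_n) (b : 'cV[R]_M -> 'cV[R]_N) (H : 'cV[R]_M -> R),
  measurable_fun setT b -> measurable_fun setT H -> (forall z, 0 <= H z) ->
  (\int[Q]_w (H (U k w).2 * expR (dotv (b (U k w).2) (f (U k w))
      - dotv (b (U k w).2) (Uo *m diag_mx lam *m Uo^T *m b (U k w).2) / 2))%:E <=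
   \int[Q]_w (H (U k w).2)%:E)%E.

Variable E : set (n.-tuple 'cV[R]_M).
Hypothesis mE : measurable E.
Hypothesis E_gram : forall y, E y -> forall v, k * sqn v <= sqn (design y *m v).
Hypothesis E_bias : forall y, E y ->
  frobenius (pinv (design y) *m bias_mx y) ^+ 2 <= beta.

Let v := \sum_(p : 'I_M * 'I_N) (k^-1 * lam 0 p.2) ^+ 2.

(** [quadratic_tail] for the M N entries of W^+ (F + B) [Uo], whose mean given the responses is W^+
    B [Uo]. On [E] the entry (l, j) has the variance proxy lam_j / k by [pinv_noise]. *)
Lemma regression_noise_tail : 0 < v ->
  (Q ((response @^-1` E) `&` [set w |
     (\sum_(p : 'I_M * 'I_N) k^-1 * lam 0 p.2 + 2 * Num.sqrt (v * t) + 2 * (k^-1 * L) * t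
       + beta * (1 + 2 * (k^-1 * L) * Num.sqrt (t / v))
      < frobenius (pinv (design (response w)) *m residual_mx w) ^+ 2)%R])
   <= (expR (- t))%:E)%E.
Proof.
move=> v0.
have k0 : 0 <= k^-1 by rewrite invr_ge0 ltW.
have mpinv : measurable_fun setT (fun y => pinv (design y)).
  by apply: measurable_pinv; exact: measurable_design.
have mUo d0 (T0 : measurableType d0) : measurable_fun setT (fun _ : T0 => Uo).
  exact: measurable_cst.
pose mm (y : n.-tuple 'cV[R]_M) : 'M[R]_(M, N) := pinv (design y) *m bias_mx y *m Uo.
have mmm : measurable_fun setT mm.
  apply: measurable_mulmx => //.
  exact: measurable_mulmx mpinv measurable_bias_mx.
pose xx w : 'M[R]_(M, N) := pinv (design (response w)) *m residual_mx w *m Uo.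
have mxx : measurable_fun setT xx.
  apply: measurable_mulmx => //; apply: measurable_mulmx measurable_residual_mx.
  exact: measurableT_comp mpinv measurable_response.
have mG : measurable (response @^-1` E).
  exact: measurable_preimageT measurable_response mE.
have fro w : frobenius (pinv (design (response w)) *m residual_mx w) ^+ 2 =
    \sum_p xx w p.1 p.2 ^+ 2.
  rewrite -(frobenius_orth _ UU) frobenius_sum.
  by rewrite (pair_bigA _ (fun l j => xx w l j ^+ 2)).
rewrite [X in Q (_ `&` X)](_ : _ = [set w : S |
    (\sum_(p : 'I_M * 'I_N) k^-1 * lam 0 p.2 +
    2 * Num.sqrt (v * t) + 2 * (k^-1 * L) * t +
    beta * (1 + 2 * (k^-1 * L) * Num.sqrt (t / v)) <
    \sum_(p : 'I_M * 'I_N) xx w p.1 p.2 ^+ 2)%R]);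
  last by apply/seteqP; split => w; rewrite /= fro.
apply: (quadratic_tail (xi := fun p w => xx w p.1 p.2)
  (m := fun p w => mm (response w) p.1 p.2) (lam := fun p => k^-1 * lam 0 p.2)) => //.
- by move=> p; exact: measurableT_comp (measurable_entry _ _) mxx.
- move=> p; apply: (measurableT_comp (f := fun A : 'M[R]_(M, N) => A p.1 p.2)).
    exact: measurable_entry.
  exact: measurableT_comp mmm measurable_response.
- by move=> p; rewrite mulr_ge0.
- by move=> p; rewrite ler_wpM2l.
- by rewrite mulr_ge0.
- move=> w Ew; rewrite -(pair_bigA _ (fun l j => mm (response w) l j ^+ 2))/=.
  by rewrite -frobenius_sum frobenius_orth// E_bias.
move=> z; pose Z : 'M[R]_(M, N) := \matrix_(l, j) z (l, j).
have Zz p : Z p.1 p.2 = z p by rewrite mxE; case: p.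
(* The mean part is a function of the responses and joins the indicator of [E] in the weight; only
   the centered errors are left to [sample_subgaussian]. *)
pose h (y : n.-tuple 'cV[R]_M) := \1_E y * expR (\sum_p z p * mm y p.1 p.2).
pose b i (y : n.-tuple 'cV[R]_M) := col i (Uo *m Z^T *m pinv (design y)).
have mh : measurable_fun setT h.
  apply: measurable_funM; first exact: measurable_indic.
  apply: measurable_expR_comp; apply: measurable_sum => p; apply: measurable_funM => //.
  exact: measurableT_comp (measurable_entry _ _) mmm.
have h0 y : 0 <= h y by rewrite mulr_ge0 ?expR_ge0.
have mb i : measurable_fun setT (b i).
  have mK : measurable_fun setT (fun y => Uo *m Z^T *m pinv (design y)).
    exact: (measurable_mulmx (f := fun=> Uo *m Z^T)).
  exact: measurable_col.
have := sample_subgaussian mU indep measurable_snd measurable_sample_error one_sample mh h0 mb.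
rewrite -/(response _); apply: le_trans.
apply: ge0_le_integral => //.
- apply/measurable_EFinP/measurable_funM; first exact: measurable_indic.
  apply: measurable_expR_comp; apply: measurable_sum => p; apply: measurable_funB => //.
  apply: measurable_funM => //.
  exact: measurableT_comp (measurable_entry _ _) mxx.
- apply/measurable_EFinP/measurable_funM; first exact: measurableT_comp mh measurable_response.
  apply: measurable_expR_comp; apply: measurable_sum => i.
  have mbi : measurable_fun setT (fun w => b i (response w)).
    exact: measurableT_comp (mb i) measurable_response.
  apply: measurable_funB.
    by apply: measurable_dotv => //; exact: measurableT_comp measurable_sample_error (mU i).
  apply: measurable_funM => //; apply: measurable_dotv => //.
  exact: (measurable_mulmx (f := fun=> Uo *m diag_mx lam *m Uo^T)).
move=> w _; rewrite lee_fin -/(response w) /h.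
rewrite (_ : \1_(response @^-1` E) w = \1_E (response w))//.
rewrite -mulrA indicE; have [/set_mem Ew|_] := boolP (response w \in E); last by rewrite !mul0r.
rewrite !mul1r -expRD ler_expR sumrB sumrB.
pose F := residual_mx w - bias_mx (response w).
have -> : \sum_i dotv (b i (response w)) (f (U i w)) =
    \sum_p z p * xx w p.1 p.2 - \sum_p z p * mm (response w) p.1 p.2.
  transitivity (\sum_p Z p.1 p.2 * (pinv (design (response w)) *m F *m Uo) p.1 p.2).
    rewrite trace_pairing; apply: eq_bigr => i _; congr (dotv _ _).
    by apply/colP => a; rewrite !mxE tnth_mktuple.
  rewrite -sumrB; apply: eq_bigr => p _.
  have subE (A B : 'M[R]_(M, N)) i j : (A - B) i j = A i j - B i j by rewrite !mxE.
  by rewrite Zz /F mulmxBr mulmxBl subE mulrBr.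
rewrite addrA addrCA subrr addr0 lerD2l lerN2 -mulr_suml -[leRHS]mulr_suml.
rewrite ler_pM2r// (le_trans (pinv_noise k_gt0 (E_gram Ew) Z UU lam_ge0))//.
under [leRHS]eq_bigr => p _ do rewrite -Zz.
rewrite -(pair_bigA _ (fun l j => k^-1 * lam 0 j * Z l j ^+ 2))/= exchange_big.
rewrite mulr_sumr; apply: ler_sum => j _; rewrite /sqn !mulr_sumr; apply: ler_sum => l _.
by rewrite [col _ _ _ _]mxE mulrA.
Qed.
End regression.

(** * The bias term, the error budget and the final estimate *)

Lemma mutually_independent_comp d (S : measurableType d) (R : realType)
    (Q : probability S R) (I : finType) d1 (V1 : measurableType d1)
    d2 (V2 : measurableType d2) (U : I -> S -> V1) (v : V1 -> V2) :
  measurable_fun setT v -> mutually_independent Q U ->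
  mutually_independent Q (fun i w => v (U i w)).
Proof.
move=> mv indep J B mB; apply: (indep J (fun i => v @^-1` B i)) => i.
exact: measurable_preimageT mv (mB i).
Qed.

(** [F] is here the whole estimation error. Being uncorrelated with [Y], it yields E[(th.B Y)
    E[F_j | Y]] = 0, the centering that the bounded multiplier estimate asks for. *)
Lemma bias_mgf d (T : measurableType d) (R : realType) (P : probability T R) (N M : nat)
    (Y : T -> 'cV[R]_M) (F CE : T -> 'cV[R]_N) (g : 'cV[R]_M -> 'cV[R]_N) (B : 'M[R]_M)
    (rho mu : R) (j : 'I_N) :
  measurable_fun setT Y -> square_integrable P Y -> square_integrable P F ->
  meanvec P Y = 0 -> mom P F Y = 0 ->
  measurable_fun setT g -> (forall w, CE w = g (Y w)) ->
  is_condexp P Y (EFin \o Defs.coord F j) (EFin \o Defs.coord CE j) ->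
  {ae P, forall w, `|CE w j 0| <= mu} ->
  subgaussian_vec P rho (fun w => B *m Y w) ->
  forall th, (\int[P]_w (expR (dotv th (g (Y w) j 0 *: (B *m Y w))))%:E <=
    (expR (3 / 2 * rho ^+ 2 * mu ^+ 2 * sqn th / 2))%:E)%E.
Proof.
move=> mY Y2 F2 Y0 FY mg CEg condF CEmu sub th.
have BY2 : square_integrable P (fun w => B *m Y w) by exact: square_integrable_mulmx.
have BY0 : meanvec P (fun w => B *m Y w) = 0 by rewrite meanvec_mulmx// Y0 mulmx0.
pose h y := dotv th (B *m y).
have mh : measurable_fun setT h.
  apply: (measurable_dotv (f := fun=> th)) => //.
  exact: (measurable_mulmx (f := fun=> B)).
have mgj : measurable_fun setT (fun y => g y j 0).
  exact: measurableT_comp (measurable_entry _ _) mg.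
have mV : measurable_fun setT (Defs.coord CE j).
  rewrite (_ : Defs.coord _ _ = (fun y => g y j 0) \o Y); first exact: measurableT_comp.
  by apply/funext => w; rewrite /Defs.coord CEg.
have L2 : square_integrable P (fun w => th^T *m (B *m Y w)) by exact: square_integrable_mulmx.
have i1 (f : T -> R) : f \in Lfun P 2%:E -> P.-integrable setT (EFin \o f).
  by move=> f2; apply/Lfun1_integrable; apply: Lfun_subset12 f2; exact: fin_num_measure.
have ih : P.-integrable setT (EFin \o (fun w => h (Y w))) by exact: i1 (L2 0).
have orth : (\int[P]_w (h (Y w) * Defs.coord CE j w)%:E = 0)%E.
  have ihF : P.-integrable setT (EFin \o (fun w => h (Y w) * Defs.coord F j w)).
    exact: Lfun2_integrable_mul (L2 0) (F2 j).
  rewrite (condexp_orthogonal mY mV condF CEmu (i1 _ (F2 j)) mh ih ihF).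
  rewrite -[LHS]fineK ?integral_fune_fin_num//; congr EFin.
  transitivity (mom P (fun w => th^T *m (B *m Y w)) F 0 j); first by rewrite mxE.
  by rewrite mom_mull// mom_mull// mom_tr FY trmx0 !mulmx0 mxE.
have sub' l : (\int[P]_w (expR (l * h (Y w)))%:E <=
    (expR (rho ^+ 2 * sqn th * l ^+ 2 / 2))%:E)%E.
  have := subgaussian_vec_mgf BY2 BY0 sub (l *: th); rewrite sqnZ.
  under eq_integral do rewrite dotvZl.
  by rewrite -[_ * sqn th * _]mulrA [sqn th * _]mulrC.
have mhY : measurable_fun setT (fun w => h (Y w)) by exact: measurableT_comp.
have -> : (fun w => (expR (dotv th (g (Y w) j 0 *: (B *m Y w))))%:E) =
    (fun w => (expR (h (Y w) * Defs.coord CE j w))%:E).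
  by apply/funext => w; rewrite dotvZr mulrC /Defs.coord CEg.
rewrite (_ : 3 / 2 * rho ^+ 2 * mu ^+ 2 * sqn th / 2 =
  3 / 2 * mu ^+ 2 * (rho ^+ 2 * sqn th) / 2); last by ring.
apply: (bounded_multiplier_mgf mhY mV CEmu _ orth sub').
exact: ae_bounded_integrable mV CEmu ih.
Qed.

Lemma posdef_spectral_traces (R : realType) (N : nat) (C : 'M[R]_N) :
  (0 < N)%N -> posdefmx C -> exists (Uo : 'M[R]_N) (lam : 'rV[R]_N),
  [/\ Uo^T *m Uo = 1%:M, C = Uo *m diag_mx lam *m Uo^T, forall j, 0 <= lam 0 j,
      forall j, lam 0 j <= spectral_norm C &
      [/\ \tr C = \sum_j lam 0 j, \tr (C *m C) = \sum_j lam 0 j ^+ 2 &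
      0 < \sum_j lam 0 j ^+ 2]].
Proof.
move=> N0 Cpos.
have [Uo [lam [UU CE lam0]]] := possemidef_spectral (posdef_possemidef Cpos).
exists Uo, lam; have tr_conj (D : 'M[R]_N) : \tr (Uo *m D *m Uo^T) = \tr D.
  by rewrite mxtrace_mulC mulmxA UU mul1mx.
have CC : C *m C = Uo *m (diag_mx lam *m diag_mx lam) *m Uo^T.
  by rewrite CE !mulmxA -[_ *m Uo^T *m Uo]mulmxA UU mulmx1.
have trC2 : \tr (C *m C) = \sum_j lam 0 j ^+ 2.
  rewrite CC tr_conj mulmx_diag mxtrace_diag; apply: eq_bigr => j _.
  by rewrite mxE expr2.
split=> //; first by move=> j; rewrite CE; exact: spectral_norm_ge.
split=> //; first by rewrite {1}CE tr_conj mxtrace_diag.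
rewrite lt_neqAle sumr_ge0 ?andbT; last by move=> j _; rewrite sqr_ge0.
apply/eqP => e; have /psumr_eq0P lam2 := esym e.
have lamE : lam = 0.
  by apply/rowP => j; apply/eqP; rewrite mxE -sqrf_eq0 lam2// => i _; exact: sqr_ge0.
have := posdef_unit Cpos.
rewrite CE lamE linear0 mulmx0 mul0mx.
move=> /mulmxV; rewrite mul0mx => /matrixP/(_ (Ordinal N0) (Ordinal N0))/eqP.
by rewrite !mxE eqxx eq_sym oner_eq0.
Qed.

(** With k = s0^2, v = M tr(C^2) / k^2. The noise terms all scale as 1 / k, whereas in the bias
    factor the product of L / k and sqrt(t / v) no longer contains k. *)
Lemma error_budget (R : realType) (n N M : nat) (c rho t s : R) (C : 'M[R]_N)
    (mu : 'cV[R]_N) (lam : 'rV[R]_N) :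
  (0 < M)%N -> 0 < c -> 0 <= t -> 0 <= s -> 0 <= spectral_norm C ->
  \tr C = \sum_j lam 0 j -> \tr (C *m C) = \sum_j lam 0 j ^+ 2 ->
  0 < \sum_j lam 0 j ^+ 2 ->
  let dev := c * rho ^+ 2 * (Num.sqrt M%:R + Num.sqrt t) in
  let s0 := Num.sqrt n%:R - dev in
  let v := \sum_(p : 'I_M * 'I_N) ((s0 ^+ 2)^-1 * lam 0 p.2) ^+ 2 in
  0 < s0 ->
  \sum_(p : 'I_M * 'I_N) (s0 ^+ 2)^-1 * lam 0 p.2 + 2 * Num.sqrt (v * t)
    + 2 * ((s0 ^+ 2)^-1 * spectral_norm C) * t
    + (s0 ^+ 2)^-1 ^+ 2 * (\sum_j n%:R * (3 / 2 * rho ^+ 2 * mu j 0 ^+ 2) *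
        (M%:R + 2 * Num.sqrt (M%:R * s) + 2 * s)) *
      (1 + 2 * ((s0 ^+ 2)^-1 * spectral_norm C) * Num.sqrt (t / v)) <=
  eps_err n M c rho t C + eps_bias n M c rho t s C mu.
Proof.
move=> M0 c0 t0 s0' L0 trC trC2 D2_gt0 dev s0 v s0_gt0.
rewrite /eps_err /eps_bias trC trC2 -/dev -/s0.
set D1 := \sum_j lam 0 j; set D2 := \sum_j lam 0 j ^+ 2 in D2_gt0 *.
set L := spectral_norm C in L0 *.
have M1 : 0 < M%:R :> R by rewrite ltr0n.
have k0 : 0 < (s0 ^+ 2)^-1 by rewrite invr_gt0 exprn_gt0.
have sump (f : 'I_N -> R) : \sum_(p : 'I_M * 'I_N) f p.2 = M%:R * \sum_j f j.
  by rewrite -(pair_bigA _ (fun=> f))/= sumr_const card_ord mulr_natl.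
have vE : v = (s0 ^+ 2)^-1 ^+ 2 * (M%:R * D2).
  rewrite /v (sump (fun j => ((s0 ^+ 2)^-1 * lam 0 j) ^+ 2)) mulrCA; congr (_ * _).
  by rewrite mulr_sumr; apply: eq_bigr => j _; rewrite exprMn.
rewrite (sump (fun j => (s0 ^+ 2)^-1 * lam 0 j)) -mulr_sumr -/D1.
rewrite -mulr_suml -mulr_sumr -mulr_sumr.
rewrite (_ : \sum_j mu j 0 ^+ 2 = norm2 mu ^+ 2); last by rewrite norm2_sqr.
set K := M%:R + 2 * _ + 2 * s.
have K0 : 0 <= K by rewrite /K !addr_ge0 ?mulr_ge0// ?sqrtr_ge0// ltW.
set mm := norm2 mu ^+ 2; have mm0 : 0 <= mm by exact: sqr_ge0.
have -> : Num.sqrt (v * t) = (s0 ^+ 2)^-1 * Num.sqrt (M%:R * D2 * t).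
  by rewrite vE -mulrA sqrtrM ?sqr_ge0// sqrtr_sqr gtr0_norm.
have -> : (s0 ^+ 2)^-1 * L = L * (s0 ^+ 2)^-1 by rewrite mulrC.
have MD0 : 0 < M%:R * D2 by rewrite mulr_gt0.
have -> : Num.sqrt (t / v) = s0 ^+ 2 * (Num.sqrt t / Num.sqrt (M%:R * D2)).
  rewrite vE invfM exprVn invrK mulrCA sqrtrM ?sqr_ge0// sqrtr_sqr gtr0_norm ?exprn_gt0//.
  by rewrite sqrtrM// sqrtrV// ltW.
set q := Num.sqrt t; set r := Num.sqrt (M%:R * D2); set e := Num.sqrt (_ * t).
have r0 : 0 < r by rewrite sqrtr_gt0.
have q0 : 0 <= q by exact: sqrtr_ge0.
have dev0 : 0 <= dev.
  by rewrite mulr_ge0 ?addr_ge0 ?sqrtr_ge0// mulr_ge0 ?sqr_ge0// ltW.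
(* As [dev] is nonnegative this ratio is at least 1, so it may multiply the second term of the bias
   factor. *)
have ratio : 1 <= ((Num.sqrt n%:R + dev) / s0) ^+ 2.
  rewrite exprn_ege1// ler_pdivlMr// mul1r /s0; lra.
set rt := ((Num.sqrt n%:R + dev) / s0) ^+ 2 in ratio *.
apply: lerD.
  rewrite le_eqVlt; apply/orP; left; apply/eqP.
  by rewrite -/e; field; rewrite gt_eqF.
rewrite (_ : _ * (_ * mm) * K = 3 / 2 * rho ^+ 2 * mm * n%:R * K); last by ring.
have -> : s0 ^- 2 ^+ 2 = (s0 ^+ 4)^-1 by rewrite -exprVn -exprM exprVn.
rewrite [_^-1 * _]mulrC; apply: ler_wpM2l.
  apply: divr_ge0; last by rewrite exprn_ge0// ltW.
  apply: mulr_ge0 K0; apply: mulr_ge0 (ler0n _ n); apply: mulr_ge0 mm0.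
  by rewrite mulr_ge0// sqr_ge0.
have -> : 2 * (L / s0 ^+ 2) * (s0 ^+ 2 * (q / r)) = 2 * q * L / r.
  by field; rewrite (gt_eqF r0) gt_eqF.
by rewrite lerD2l ler_peMr// !mulr_ge0// invr_ge0 ltW.
Qed.

(** A union bound: [A1] is covered by [A], the [B j] and [D]. *)
Lemma probability_exceptional d (S : measurableType d) (R : realType)
    (Q : probability S R) (N : nat) (A1 A D : set S) (B : 'I_N -> set S) (a b : R) :
  measurable A1 -> measurable A -> measurable D -> (forall j, measurable (B j)) ->
  (forall w, A1 w -> (forall j, ~ B j w) -> ~ D w -> A w) ->
  ((1 - 2 * a)%:E <= Q A1)%E -> (forall j, Q (B j) <= b%:E)%E -> (Q D <= a%:E)%E ->
  ((1 - 3 * a - N%:R * b)%:E <= Q A)%E.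
Proof.
move=> mA1 mA mD mB sub QA1 QB QD.
pose BB := \big[setU/set0]_(j < N) B j.
have [mBB QBB] : measurable BB /\ (Q BB <= (N%:R * b)%:E)%E.
  have -> : N%:R * b = \sum_(j < N) b by rewrite sumr_const card_ord mulr_natl.
  rewrite /BB -sumEFin; apply: (big_ind2 (fun X x => measurable X /\ (Q X <= x)%E)).
  - by rewrite measure0.
  - move=> X x Y y [mX Xx] [mY Yy]; split; first exact: measurableU.
    by apply: le_trans (measureU2 _ _ _) _ => //; exact: leeD.
  - by [].
have QA : Q A \is a fin_num by exact: fin_num_measure.
have : (Q A1 <= Q (A `|` (BB `|` D)))%E.
  apply: le_measure; rewrite ?inE//; first by do 2 apply: measurableU => //.
  move=> w A1w; have [Dw|Dw] := pselect (D w); first by right; right.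
  have [[j Bj]|nB] := pselect (exists j, B j w).
    by right; left; rewrite /BB (bigD1 j)//=; left.
  by left; apply: sub => // j Bj; apply: nB; exists j.
move=> /(le_trans QA1) H.
have : ((1 - 2 * a)%:E <= Q A + ((N%:R * b)%:E + a%:E))%E.
  apply: le_trans H (le_trans (measureU2 _ _ _) _) => //; first exact: measurableU.
  rewrite leeD2l//; apply: le_trans (measureU2 _ _ _) _ => //; exact: leeD.
by rewrite -(fineK QA) -!EFinD !lee_fin => ?; lra.
Qed.

Unset Implicit Arguments.

Theorem theorem5p14 (R : realType) (N M n : nat) (N_gt0 : (0 < N)%N)
    (M_gt0 : (0 < M)%N)
    (c : R) (c_gt0 : 0 < c) (c_const : singular_value_constant c)
    (d : measure_display) (T : measurableType d) (P : probability T R)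
    (X : {RV P >-> 'cV[R]_N}) (Z : {RV P >-> 'cV[R]_M})
    (XZ_indep : independent2 P X Z)
    (X_sqint : square_integrable P X) (Z_sqint : square_integrable P Z)
    (X_mean0 : meanvec P X = 0) (Z_mean0 : meanvec P Z = 0)
    (CXX_unit : covmx P X \in unitmx) (CZZ_unit : covmx P Z \in unitmx)
    (X_density : has_continuous_density P X)
    (Z_density : has_continuous_density P Z)
    (A : 'M[R]_(M, N)) :
  let Y := fun w : T => (A *m X w + Z w : 'cV[R]_M) in
  let Theta_s := Theta_star A (covmx P X) (covmx P Z) in
  let Err := fun w : T => (X w - Theta_s^T *m Y w : 'cV[R]_N) in
  forall
    (* the samples, on a probability space (S, Q) *)
    (d' : measure_display) (S : measurableType d') (Q : probability S R)
    (Xs : 'I_n -> {RV Q >-> 'cV[R]_N}) (Ys : 'I_n -> {RV Q >-> 'cV[R]_M})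
    (samples_law : forall (i : 'I_n) (B : set ('cV[R]_N * 'cV[R]_M)),
      measurable B ->
      Q ((fun w => (Xs i w, Ys i w)) @^-1` B)
      = P ((fun w => (X w, Y w)) @^-1` B))
    (samples_indep :
      mutually_independent Q (fun (i : 'I_n) w => (Xs i w, Ys i w)))
    (Theta_hat : S -> 'M[R]_(M, N))
    (Theta_hatP : forall w : S,
      least_squares (rows_mx Ys w) (rows_mx Xs w) (Theta_hat w))
    (* a version of E[Err | Y] *)
    (CE : T -> 'cV[R]_N) (CE_condexp : is_condexp_vec P Y Err CE)
    (* (i): G alpha is a version of the conditional expectation, given Y, of the
       exponential with parameter alpha *)
    (C : 'M[R]_N) (C_posdef : posdefmx C)
    (hyp_i : exists G : 'cV[R]_N -> T -> \bar R,
      (forall alpha : 'cV[R]_N,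
         is_condexp P Y
           (fun w => (expR ((alpha^T *m invmx (sqrtmx C)
                               *m (Err w - CE w)) 0 0))%:E)
           (G alpha)) /\
      {ae P, forall w, forall alpha : 'cV[R]_N,
         (G alpha w <= (expR (norm2 alpha ^+ 2 / 2))%:E)%E})
    (* (ii) *)
    (mu : 'cV[R]_N)
    (hyp_ii : forall i : 'I_N, {ae P, forall w, `|CE w i 0| <= mu i 0})
    (* (iii) *)
    (rho : R)
    (hyp_iii : subgaussian_vec P rho
      (fun w => invmx (sqrtmx (covmx P Y)) *m Y w))
    (t : R) (t_ge0 : 0 <= t)
    (t_small : 0 < Num.sqrt n%:R
                   - c * rho ^+ 2 * (Num.sqrt M%:R + Num.sqrt t))
    (s : R) (s_ge0 : 0 <= s),
  with_prob_at_least Q (1 - 3 * expR (- t) - N%:R * expR (- s))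
    [set w : S |
       ('E_P[fun w' =>
          (norm2 ((Theta_hat w)^T *m Y w' - Theta_s^T *m Y w') ^+ 2)%R]
        <= (eps_err n M c rho t C + eps_bias n M c rho t s C mu)%:E)%E].

Proof.
move=> Y Theta_s Err d' S Q Xs Ys samples_law samples_indep Theta_hat Theta_hatP CE
  CE_condexp C C_posdef [G [Gcond Gle]] mu hyp_ii rho hyp_iii t t_ge0 t_small s s_ge0.
set dev := c * rho ^+ 2 * _ in t_small.
set s0 := Num.sqrt n%:R - dev in t_small.
have k_gt0 : 0 < s0 ^+ 2 by rewrite exprn_gt0.
(* An empty sample would make s0 = - [dev], which is nonpositive. *)
have n_gt0 : (0 < n)%N.
  rewrite lt0n; apply: contraTneq t_small => n0; rewrite /s0 n0 sqrtr0 sub0r.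
  by rewrite oppr_gt0 -leNgt mulr_ge0 ?addr_ge0 ?sqrtr_ge0// mulr_ge0 ?sqr_ge0// ltW.
have mX : measurable_fun setT X by [].
have mZ : measurable_fun setT Z by [].
have [Y2 Y0 YY CYY_pos ErrY] := observation_moments A mX mZ XZ_indep X_sqint Z_sqint
  X_mean0 Z_mean0 CXX_unit CZZ_unit.
rewrite -/Y -/Theta_s -/Err in Y2 Y0 YY CYY_pos ErrY *.
have mY : measurable_fun setT Y.
  by apply: measurable_addmx => //; exact: (measurable_mulmx (f := fun=> A)).
have mErr : measurable_fun setT Err.
  rewrite (_ : Err = fun w => X w + (- Theta_s^T) *m Y w).
    apply: measurable_addmx => //; exact: (measurable_mulmx (f := fun=> - Theta_s^T)).
  by apply/funext => w; rewrite mulNmx.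
have Err2 : square_integrable P Err.
  rewrite (_ : Err = fun w => X w + (- Theta_s^T) *m Y w).
    by apply: square_integrable_add => //; exact: square_integrable_mulmx.
  by apply/funext => w; rewrite mulNmx.
have [[root_sym _] root_sqr] := sqrtmxP (posdef_possemidef CYY_pos).
set root := sqrtmx (covmx P Y) in root_sym root_sqr hyp_iii.
have root_unit : root \in unitmx.
  by have := posdef_unit CYY_pos; rewrite -{1}root_sqr unitmx_mul => /andP[].
set Si := invmx root in hyp_iii.
have Si_sym : Si^T = Si by rewrite /Si trmx_inv root_sym.
pose U (i : 'I_n) w := (Xs i w, Ys i w).
have mU i : measurable_fun setT (U i) by exact: measurable_fun_pair.
have mXY : measurable_fun setT (fun w => (X w, Y w)) by exact: measurable_fun_pair.
have law i B : measurable B -> Q (U i @^-1` B) = P ((fun w => (X w, Y w)) @^-1` B).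
  exact: samples_law.
have mSi : measurable_fun setT (fun u : 'cV[R]_N * 'cV[R]_M => Si *m u.2).
  exact: (measurable_mulmx (f := fun=> Si)).
(* [CE] is defined on the population space; as a function [g] of the response it can be evaluated at
   the samples. *)
have [g mg CEg] := is_condexp_vec_factor CE_condexp.
pose response w : n.-tuple 'cV[R]_M := [tuple (U i w).2 | i < n].
have mresp : measurable_fun setT response by exact: measurable_response mU.
pose W w := design Si (response w).
have mW : measurable_fun setT W.
  exact: measurableT_comp (measurable_design Si) mresp.
have rowW i : (fun w => (row i (W w))^T) = (fun w => Si *m (U i w).2).
  by apply/funext => w; apply/colP => j; rewrite !mxE tnth_mktuple.
have SiY2 : square_integrable P (fun w => Si *m Y w) by exact: square_integrable_mulmx.
have SiY0 : meanvec P (fun w => Si *m Y w) = 0 by rewrite meanvec_mulmx// Y0 mulmx0.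
have [A1 [mA1 QA1 A1_min]] : exists A1 : set 'M[R]_(n, M), [/\ measurable A1,
    ((1 - 2 * expR (- t))%:E <= Q (W @^-1` A1))%E &
    forall B, A1 B -> s0 <= sigma_min B].
  apply: singular_value_event => //.
  - rewrite (_ : (fun i w => _) = fun i w => Si *m (U i w).2).
      exact: (mutually_independent_comp (v := fun u => Si *m u.2)).
    by apply/funext => i; exact: rowW.
  - move=> i; rewrite rowW -SiY0.
    exact: (eq_law_meanvec (v := fun u => Si *m u.2) (mU i) mXY (law i)).
  - move=> i; rewrite rowW.
    rewrite (eq_law_covmx (v := fun u => Si *m u.2) (mU i) mXY (law i))//=.
    rewrite covmx_mom// mom_mull// mom_mulr// YY -root_sqr Si_sym /Si.
    by rewrite mulmxA mulKmx// mulmxV.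
  - move=> i; rewrite rowW.
    exact: (eq_law_subgaussian_vec (v := fun u => Si *m u.2) (mU i) mXY (law i)).
pose F w := Err w - CE w.
have mF : measurable_fun setT F.
  rewrite (_ : F = fun w => Err w + (- 1%:M) *m g (Y w)).
    apply: measurable_addmx => //; apply: (measurable_mulmx (f := fun=> - 1%:M)) => //.
    exact: measurableT_comp mg mY.
  by apply/funext => w; rewrite mulNmx mul1mx -CEg.
have [Uo [lam [UU CE_spec lam_ge0 lam_le [trC trC2 D2_gt0]]]] :=
  posdef_spectral_traces N_gt0 C_posdef.
have sub_one := conditional_subgaussian mY mF (conditional_mgf mY C_posdef Gcond Gle).
pose f (u : 'cV[R]_N * 'cV[R]_M) : 'cV[R]_N := u.1 - Theta_s^T *m u.2 - g u.2.
have mf : measurable_fun setT f by exact: measurable_sample_error.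
have one_sample (k : 'I_n) (b : 'cV[R]_M -> 'cV[R]_N) (H : 'cV[R]_M -> R) :
    measurable_fun setT b -> measurable_fun setT H -> (forall z, 0 <= H z) ->
  (\int[Q]_w (H (U k w).2 * expR (dotv (b (U k w).2) (f (U k w))
      - dotv (b (U k w).2) (Uo *m diag_mx lam *m Uo^T *m b (U k w).2) / 2))%:E <=
   \int[Q]_w (H (U k w).2)%:E)%E.
  move=> mb mH H0; rewrite -CE_spec.
  have mb2 : measurable_fun setT (fun u : 'cV[R]_N * 'cV[R]_M => b u.2).
    exact: measurableT_comp mb measurable_snd.
  have mH2 : measurable_fun setT (fun u : 'cV[R]_N * 'cV[R]_M => H u.2).
    exact: measurableT_comp mH measurable_snd.
  rewrite (ge0_eq_law_integral (mU k) mXY (law k) (H := fun u => H u.2 *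
    expR (dotv (b u.2) (f u) - dotv (b u.2) (C *m b u.2) / 2))); last 2 first.
  - apply: measurable_funM => //; apply: measurable_expR_comp.
    apply: measurable_funB; first exact: measurable_dotv.
    apply: measurable_funM => //; apply: measurable_dotv => //.
    exact: (measurable_mulmx (f := fun=> C)).
  - by move=> u; rewrite mulr_ge0 ?expR_ge0.
  rewrite (ge0_eq_law_integral (mU k) mXY (law k) (H := fun u => H u.2))//=.
  have := sub_one b H mb mH H0; apply: le_trans; rewrite le_eqVlt; apply/orP; left.
  by apply/eqP; apply: eq_integral => w _; rewrite /f /F CEg.
pose q j (u : 'cV[R]_N * 'cV[R]_M) := g u.2 j 0 *: (Si *m u.2).
have mq j : measurable_fun setT (q j).
  apply: measurable_scalemx => //.
  apply: (measurableT_comp (f := fun v : 'cV[R]_N => v j 0)); first exact: measurable_entry.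
  exact: measurableT_comp mg measurable_snd.
(* [sg j] is the variance proxy of one summand of the j-th column of W^T B, and [tau j] the level
   that the squared norm of this column exceeds with probability at most e^-s. *)
pose sg j := 3 / 2 * rho ^+ 2 * mu j 0 ^+ 2.
pose tau j := n%:R * sg j * (M%:R + 2 * Num.sqrt (M%:R * s) + 2 * s).
pose bias j (y : n.-tuple 'cV[R]_M) := col j ((design Si y)^T *m bias_mx g y).
have biasE j w : bias j (response w) = \sum_i q j (U i w).
  by rewrite /bias design_bias_col; apply: eq_bigr => i _; rewrite tnth_mktuple.
have mbias j : measurable_fun setT (bias j).
  apply: measurable_col; apply: measurable_mulmx; last exact: measurable_bias_mx mg.
  exact: measurable_trmx (measurable_design Si).
pose Bad j := response @^-1` [set y | tau j < sqn (bias j y)].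
have mBad0 j : measurable [set y | tau j < sqn (bias j y)].
  by apply: measurable_ltr_set => //; exact: measurable_sqn.
have QBad j : (Q (Bad j) <= (expR (- s))%:E)%E.
  have mgf th : (\int[Q]_w (expR (dotv th (bias j (response w))))%:E <=
      (expR (n%:R * sg j * sqn th / 2))%:E)%E.
    under eq_integral do rewrite biasE.
    apply: (iid_sum_mgf mU samples_indep (mq j)) => i {}th.
    rewrite (ge0_eq_law_integral (mU i) mXY (law i) (H := fun u => expR (dotv th (q j u)))).
    - exact: (bias_mgf mY Y2 Err2 Y0 ErrY mg CEg (CE_condexp j) (hyp_ii j) hyp_iii).
    - by apply: measurable_expR_comp; exact: (measurable_dotv (f := fun=> th)).
    - by move=> u; exact: expR_ge0.
  apply: (subgaussian_norm_tail M_gt0 _ s_ge0 _ mgf).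
    by rewrite mulr_ge0// mulr_ge0 ?sqr_ge0// mulr_ge0 ?sqr_ge0// divr_ge0.
  exact: measurableT_comp (mbias j) mresp.
(* Both conditions concern the responses alone, so the noise bound can be restricted to this event
   through the weight. *)
pose E := design Si @^-1` A1 `&`
  \bigcap_(j in [set: 'I_N]) [set y | sqn (bias j y) <= tau j].
have mE : measurable E.
  apply: measurableI; first exact: measurable_preimageT (measurable_design Si) mA1.
  apply: fin_bigcap_measurable => // j _.
  rewrite (_ : [set y | _] = ~` [set y | tau j < sqn (bias j y)]).
    exact: measurableC.
  by apply/seteqP; split => y /=; rewrite leNgt => /negP.
have E_gram y : E y -> forall v, s0 ^+ 2 * sqn v <= sqn (design Si y *m v).
  by case=> /A1_min s0_le _ v; apply: sigma_min_le => //; exact: ltW.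
pose beta := (s0 ^+ 2)^-1 ^+ 2 * \sum_j tau j.
have E_bias y : E y -> frobenius (pinv (design Si y) *m bias_mx g y) ^+ 2 <= beta.
  move=> Ey; apply: le_trans (frobenius_pinv k_gt0 (E_gram y Ey) _) _.
  rewrite frobenius_sqn ler_wpM2l ?sqr_ge0//; apply: ler_sum => j _.
  by case: Ey => _; apply.
have L_ge0 : 0 <= spectral_norm C.
  exact: le_trans (lam_ge0 (Ordinal N_gt0)) (lam_le _).
have v_gt0 : 0 < \sum_(p : 'I_M * 'I_N) ((s0 ^+ 2)^-1 * lam 0 p.2) ^+ 2.
  rewrite -(pair_bigA _ (fun _ j => ((s0 ^+ 2)^-1 * lam 0 j) ^+ 2))/=.
  rewrite sumr_const card_ord pmulrn_rgt0// (eq_bigr _ (fun j _ => exprMn _ _ _)).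
  by rewrite -mulr_sumr mulr_gt0// exprn_gt0// invr_gt0.
have noise := regression_noise_tail mU mg samples_indep UU lam_ge0 lam_le L_ge0 k_gt0
  t_ge0 one_sample mE E_gram E_bias v_gt0.
set total := _ + beta * _ in noise.
set resid := residual_mx U Theta_s in noise.
set D := _ `&` _ in noise.
pose est w := pinv (W w) *m resid w.
have mest : measurable_fun setT (fun w => frobenius (est w) ^+ 2).
  apply: measurable_frobenius_sqr; apply: measurable_mulmx; first exact: measurable_pinv.
  exact: measurable_residual_mx.
have mRE : measurable (response @^-1` E) by exact: measurable_preimageT mresp mE.
have mD : measurable D by apply: measurableI => //; exact: measurable_ltr_set.
(* [Theta_hat] is given as a minimizer for each outcome, with no measurability, so the measurable
   event is built from the samples instead. *)
exists (response @^-1` E `\` D); split; first exact: measurableD.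
  move=> w [Ew Dw] /=.
  rewrite (_ : (fun w' => _) = fun w' => norm2 ((Theta_hat w - Theta_s)^T *m Y w') ^+ 2);
    last by apply/funext => w'; rewrite linearB/= mulmxBl.
  rewrite (expected_sqr_error _ mY Y2 root_sym); last by rewrite root_sqr YY.
  rewrite lee_fin.
  (* The sample matrix is W C_YY^(1/2) with W injective on [E]: the least squares solution gives W^+
     times the sample of X, and [Theta_s] the part that W^+ W = 1 cancels. *)
  have -> : root *m (Theta_hat w - Theta_s) = est w.
    have YE : rows_mx Ys w = W w *m root.
      have -> : W w = rows_mx Ys w *m Si.
        apply/matrixP => i j; rewrite mxE tnth_mktuple -{1}Si_sym !mxE.
        by apply: eq_bigr => l _; rewrite !mxE mulrC.
      by rewrite -mulmxA mulVmx// mulmx1.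
    have XE : resid w = rows_mx Xs w - W w *m root *m Theta_s.
      rewrite -YE; apply/matrixP => i a; rewrite !mxE; congr (_ - _).
      by apply: eq_bigr => l _; rewrite !mxE mulrC.
    have pinvW : pinv (W w) *m W w = 1%:M by exact: pinvK k_gt0 (E_gram _ Ew).
    rewrite /est XE [LHS]mulmxBr [RHS]mulmxBr; congr (_ - _); last first.
      by rewrite -mulmxA [RHS]mulmxA pinvW mul1mx.
    apply: (least_squares_pinv k_gt0 (E_gram _ Ew)) => //.
    by have := Theta_hatP w; rewrite YE.
  apply: (@le_trans _ _ total).
    by rewrite leNgt; apply/negP => h; apply: Dw.
  exact: error_budget.
apply: (probability_exceptional (measurable_preimageT mW mA1) _ mD
  (fun j => measurable_preimageT mresp (mBad0 j)) _ QA1 QBad noise).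
  exact: measurableD.
move=> w A1w nBad nD; split=> //; split=> // j _ /=.
by rewrite leNgt; apply/negP; exact: nBad.
Qed.
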